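(* Let $(P,B)$ be a constant-coefficient boundary value problem of class $\mathcal{WR}$, $P=D_d+\mathcal A(D_t,D_y)$, and let $\Sigma_\gamma$ be a $\mathcal{WR}$ symmetrizer for it, with symbol $\sigma(\zeta)$. If $\underline\zeta\in\Gamma$, then $v\mapsto\langle\sigma(\underline\zeta)v,v\rangle$ vanishes on the Krylov space of $$\ell(\underline\zeta)=\mathbb E^-(\underline\zeta)\cap\ker b(\underline\zeta)$$ with respect to $\mathcal A$, that is, on the smallest invariant subspace of $a(\underline\zeta)$ containing $\ell(\underline\zeta)$.
   Context: Notation. $(t,x)=(t,y,x_d)$, $t\in\mathbb R$, $y\in\mathbb R^{d-1}$, $x_d\ge0$; $\mathbb R^{1+d}_+=\mathbb R\times\{x_d\ge0\}$; $D=-i\partial$. $\zeta=(\tau-i\gamma,\eta)\simeq(\tau,\eta,\gamma)$, where $(\tau,\eta)\in\mathbb R^d$ are the covariables of $(t,y)$ and $\gamma\ge0$; $\Xi=\{\zeta\ne0:\gamma\ge0\}$, $S^d=\{\zeta\in\Xi:\gamma^2+\tau^2+|\eta|^2=1\}$. For a symbol $\sigma(\zeta)$, $\mathrm{Op}_\gamma(\sigma)=e^{\gamma t}\mathrm{Op}(\sigma(\cdot,\gamma))e^{-\gamma t}$ (a Fourier multiplier in $(t,y)$ after conjugation by $e^{\gamma t}$); $\mathrm{OPS}^0$ is the class of such operators of order $0$. $L^2_\gamma=e^{\gamma t}L^2$; $\langle\cdot,\cdot\rangle$ and $|\cdot|$ are the inner product and norm of $L^2_\gamma(\mathbb R^d)$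 in $(t,y)$ for fixed $x_d$ (or of $\mathbb C^n$, for symbols); $v(0)=v|_{x_d=0}$. Problem. $Pu=(D_{x_d}+\mathcal A(D_t,D_y))u=f$ in $\mathbb R^{1+d}_+$, $Bu|_{x_d=0}=g$ on $\mathbb R^d$, where $\mathcal A$ is a first-order constant-coefficient differential operator with $n\times n$ symbol $a(\zeta)$, and $B$ a $p\times n$ matrix with symbol $b$, of rank $p=\dim\mathbb E^-(\zeta)$. $P$ is hyperbolic: with $\pi_P(\zeta,\xi_d)=\det(\xi_dI_n+a(\zeta))$ and $\underline\zeta\in S^d$, (i) if $\underline\gamma\ne0$, $\pi_P(\underline\zeta,\cdot)$ has no real root; (ii) if $\underline\xi_d\in\mathbb R$ is a root of $\pi_P(\underline\zeta,\cdot)$, then near $(\underline\zeta,\underline\xi_d)$ one has $\pi_P=e(\zeta,\xi_d)(\tau-i\gamma+\lambda(\eta,\xi_d))^\alpha$ with $\alpha\in\mathbb N$, $e,\lambda$ smooth, holomorphic in $\xi_d$, $e\neq0$, $\lambda$ real for real arguments, and there is a smooth projector $\Pi$ of rank $\alpha$, holomorphic in $\xi_d$, with $\ker(\xi_dI_n+a)=\Pi\mathbb C^n$ when $\tau-i\gamma+\lambda=0$. When $P$ arises from an operator $L=D_t+\sum_jA_jD_j$ (so $a(\zeta)=A_d^{-1}((\tau-i\gamma)I_n+\sum_{j<d}\eta_jA_j)$), it is also assumed that $L$ is symmetrizable hyperbolic with constant multiplicities (the eigenvalues of $\sum_j\xi_jA_j$ are real, semisimple, with multiplicities independent of $\xi$),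 $A_d$ is nonsingular, and $p$ is the number of positive eigenvalues of $A_d$. $\mathbb E^-(\zeta)$: for $\gamma>0$, the sum of generalized eigenspaces of $a(\zeta)$ for eigenvalues with negative imaginary part, extended continuously to $\gamma=0$. Hyperbolic region $\mathcal H$: the points with $\gamma=0$ near which $a$ is smoothly diagonalizable with scalar entries $a_j$ real when $\gamma=0$ and $i\partial_\gamma a_j\in\mathbb R\setminus\{0\}$. Lopatinskii determinant $\underline\Delta(\zeta)=\det(b\mathbf e_1,\dots,b\mathbf e_p)$, $(\mathbf e_j)$ a smooth homogeneous basis of $\mathbb E^-$. Class $\mathcal{WR}$: $\mathbb E^-(\zeta)\cap\ker b=\{0\}$ for $\zeta\in S^d$, $\gamma>0$; $\underline\Delta^{-1}(0)$ is nonempty and contained in $\mathcal H$; $\partial_\tau\underline\Delta\ne0$ where $\underline\Delta=0$. Critical set: $\Gamma=\{\zeta\in S^d:\mathbb E^-(\zeta)\cap\ker b(\zeta)\ne\{0\}\}$; for $\zeta\in\Gamma$ the intersection is one-dimensional, denoted $\ell(\zeta)$ (critical direction). Lopatinskii family: $\Delta_\gamma=\mathrm{Op}_\gamma(\delta)\in\mathrm{OPS}^0$, where $\delta\in C^\infty(\Xi,\mathcal M_{n\times n}(\mathbb C))$ is homogeneous of degree $0$, $\ker\delta(\zeta)$ is trivial for $\zeta\in S^d$ with $\gamma>0$, and for $\zeta\in\Gamma$ the kernel $\ker\delta(\zeta)$ is nontrivial and contains $\ell(\zeta)$. $L^2_\Delta=\{v\in\mathcal S'(\mathbb R^{1+d}_+,\mathbb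 R^n):\Delta_\gamma v\in L^2_\gamma(\mathbb R^{1+d}_+,\mathbb C^n)\}$. $\mathcal{WR}$ symmetrizer (relative to a Lopatinskii family $\Delta_\gamma$): a family $\Sigma_\gamma\in\mathrm{OPS}^0(\mathbb R^{1+d}_+\times[1,\infty))$ such that (i) $\Sigma_\gamma$ is Hermitian; (ii) there is $C>0$ with $\langle\Sigma_\gamma v_1,v_2\rangle\le C|\Delta_\gamma v_1||\Delta_\gamma v_2|$ for all $v_1,v_2\in L^2_\Delta$; (iii) there is $c>0$ with $\mathrm{Im}\langle\Sigma_\gamma\mathcal Av,v\rangle\ge c\gamma|\Delta_\gamma v|^2$ for all $v\in L^2_\Delta$; (iv) there are $\alpha,\beta>0$ and a family $Q_\gamma\in\mathrm{OPS}^0$ on the boundary with $\langle\Sigma_\gamma v(0),v(0)\rangle\ge\alpha|\Delta_\gamma v(0)|^2-\beta|Q_\gamma Bv(0)|^2$. *)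

(* Defs.v *)
From HB Require Import structures.
From mathcomp Require Import all_boot all_order all_algebra.
From mathcomp Require Import complex.
From mathcomp Require Import all_classical all_reals all_analysis.

Set Implicit Arguments.
Unset Strict Implicit.
Unset Printing Implicit Defensive.

Import Order.TTheory GRing.Theory Num.Theory numFieldNormedType.Exports.
Local Open Scope classical_set_scope.
Local Open Scope ring_scope.

Section LebesgueRn.
Variable R : realType.
Local Notation RT := (measurableTypeR R).

Section Step.
Variables (k : nat) (mu : {sigma_finite_measure set (k.-tuple RT) -> \bar R}).

Definition tcons (q : RT * k.-tuple RT) : k.+1.-tuple RT :=
  [tuple of q.1 :: q.2].

Definition tuncons (x : k.+1.-tuple RT) : RT * k.-tuple RT :=
  (tnth x ord0, [tuple of behead x]).

Lemma tconsK : cancel tcons tuncons.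
Proof. by case=> x y; congr pair; apply/val_inj. Qed.

Lemma measurable_tcons : measurable_fun setT tcons.
Proof. exact: measurable_cons. Qed.

Lemma measurable_tuncons : measurable_fun setT tuncons.
Proof.
apply/measurable_fun_pairP; split; first exact: measurable_tnth.
exact: measurable_behead.
Qed.

Definition lebesgue_step : set (k.+1.-tuple RT) -> \bar R :=
  pushforward (lebesgue_measure \x mu)%E tcons.

HB.instance Definition _ := Measure.copy lebesgue_step
  (measure_function_pushforward__canonical__measure_function_Measure
    (lebesgue_measure \x mu)%E measurable_tcons).

Let sigma_finite_step : sigma_finite setT lebesgue_step.
Proof.
have /sigma_finiteP[F [TF ndF Foo]] := sigma_finiteT (@lebesgue_measure R).
have /sigma_finiteP[G [TG ndG Goo]] := sigma_finiteT mu.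
exists (fun i => tuncons @^-1` (F i `*` G i)).
  apply/seteqP; split=> // x _.
  have [i _ Fi] : (\bigcup_i F i) (tuncons x).1 by rewrite -TF.
  have [j _ Gj] : (\bigcup_j G j) (tuncons x).2 by rewrite -TG.
  exists (maxn i j) => //; split.
    by move: Fi; exact/subsetPset/ndF/leq_maxl.
  by move: Gj; exact/subsetPset/ndG/leq_maxr.
move=> i; have [mF Fi] := Foo i; have [mG Gi] := Goo i.
have mFG : measurable (F i `*` G i) by exact: measurableX.
split; first by rewrite -[X in measurable X]setTI; exact: measurable_tuncons.
rewrite /lebesgue_step /pushforward.
rewrite (_ : tcons @^-1` _ = F i `*` G i); last first.
  by apply/funext => x; rewrite /preimage /mkset tconsK.
by rewrite product_measure1E// lte_mul_pinfty// ge0_fin_numE.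
Qed.

HB.instance Definition _ := Measure_isSigmaFinite.Build _ _ _ lebesgue_step
  sigma_finite_step.
End Step.

(* Lebesgue measure on [R^k], as an iterated product. *)
Fixpoint lebesgue_Rn (k : nat) :
    {sigma_finite_measure set (k.-tuple RT) -> \bar R} :=
  if k is k'.+1 then lebesgue_step (lebesgue_Rn k') else \d_[tuple].

End LebesgueRn.

Section Smoothness.
Variables (R : realType) (V : normedModType R).
Local Notation C := R[i].

Definition ReF (f : V -> C) : V -> R := fun x => complex.Re (f x).
Definition ImF (f : V -> C) : V -> R := fun x => complex.Im (f x).

(* Only meaningful for [U] open. *)
Fixpoint Ck (k : nat) (U : set V) (f : V -> R) : Prop :=
  (forall x, U x -> {for x, continuous f}) /\
  if k is k'.+1 then
    forall v, (forall x, U x -> derivable f x v) /\ Ck k' U ('D_v f)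
  else True.

Definition smooth_open (U : set V) (f : V -> C) : Prop :=
  forall k, Ck k U (ReF f) /\ Ck k U (ImF f).

(* [A] need not be open: this is smoothness up to the boundary, i.e. existence
   of local smooth extensions. *)
Definition smooth_on (A : set V) (f : V -> C) : Prop :=
  forall x, A x -> exists (U : set V) (g : V -> C),
    [/\ open U, U x, smooth_open U g & forall y, U y -> A y -> f y = g y].

Definition smooth_mx_on M N (A : set V) (f : V -> 'M[C]_(M, N)) : Prop :=
  forall i j, smooth_on A (fun x => f x i j).

Definition cderive (v : V) (f : V -> C) : V -> C :=
  fun x => ('D_v (ReF f) x +i* 'D_v (ImF f) x)%C.

End Smoothness.

Section Complex.
Variable R : realType.
Local Notation C := R[i].

Definition cx (q : R * R) : C := (q.1 +i* q.2)%C.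

Definition cmod (z : C) : R := ComplexField.Normc.normc z.

Definition holomorphic_at (f : C -> C) (z : C) : Prop :=
  derivable (f : C^o -> C^o) z 1.

Definition hdot N (v w : 'cV[C]_N) : C :=
  \sum_(k < N) v k ord0 * ((w k ord0)^*)%C.

Definition sqnorm N (v : 'cV[C]_N) : R := complex.Re (hdot v v).

End Complex.

Section Spaces.
Variables (R : realType) (n : nat).
Local Notation C := R[i].
Local Notation vec := 'cV[C]_n.

Definition subspace (W : set vec) : Prop :=
  W 0 /\ forall (c : C) u v, W u -> W v -> W (c *: u + v).

Definition invariant (T : 'M[C]_n) (W : set vec) : Prop :=
  forall v, W v -> W (T *m v).

Definition krylov (T : 'M[C]_n) (L : set vec) : set vec :=
  [set v | forall W, subspace W -> invariant T W -> L `<=` W -> W v].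

Definition kernel p (T : 'M[C]_(p, n)) : set vec := [set v | T *m v = 0].

Definition is_basis p (e : 'M[C]_(n, p)) (W : set vec) : Prop :=
  \rank e = p /\ W = [set e *m c | c in [set: 'cV[C]_p]].

Definition stable_space (T : 'M[C]_n) : set vec :=
  [set v | exists s : seq (C * vec),
    (forall q, q \in s ->
       complex.Im q.1 < 0 /\ (T - q.1%:M) ^+ n *m q.2 = 0) /\
    v = \sum_(q <- s) q.2].

End Spaces.

(* The dimension of [(t, y)]-space is [d = m.+1]; coordinate [0] is [t]. *)
Section Frequencies.
Variables (R : realType) (m : nat).
Local Notation C := R[i].

(* [((tau, eta), gamma)]. *)
Definition freq := ('rV[R]_m.+1 * R)%type.

Definition zeta0 (z : freq) : C := (z.1 ord0 ord0 +i* - z.2)%C.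

Definition eta (z : freq) : 'rV[R]_m := \row_j z.1 ord0 (lift ord0 j).

Definition Xi : set freq := [set z | z != 0 /\ 0 <= z.2].

Definition sphere : set freq :=
  [set z | Xi z /\ z.2 ^+ 2 + \sum_i z.1 ord0 i ^+ 2 = 1].

Definition dtau : freq := (delta_mx ord0 ord0, 0).
Definition dgamma : freq := (0, 1).

Definition homogeneous0 T (A : set freq) (f : freq -> T) : Prop :=
  forall z (s : R), A z -> 0 < s -> f (s *: z) = f z.

Definition symbol0 M N (s : freq -> 'M[C]_(M, N)) : Prop :=
  smooth_mx_on Xi s /\ homogeneous0 Xi s.

End Frequencies.
Arguments Xi {R m}.
Arguments sphere {R m}.

(* [P = D_{x_d} + A_0 D_t + \sum_j A_{j+1} D_{y_j}] acting on [C^n]-valued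
   functions. *)
Section Operator.
Variables (R : realType) (m n : nat).
Local Notation C := R[i].
Local Notation freq := (freq R m).
Variable A : 'I_m.+1 -> 'M[C]_n.

Definition asym (z : freq) : 'M[C]_n :=
  zeta0 z *: A ord0 +
  \sum_(j < m) (eta z ord0 j)%:C%C *: A (lift ord0 j).

Definition piP (z : freq) (xi : C) : C := \det (xi%:M + asym z).

Definition elliptic_interior : Prop :=
  forall z, sphere z -> z.2 != 0 -> forall x : R, piP z x%:C%C != 0.

(* Neighbourhoods of [(z, x)] are polydiscs of radius [r] in
   [(zeta, xi_d)], with [xi_d] complex. *)
Definition regular_root (z : freq) (x : R) : Prop :=
  exists (r : R) (alpha : nat) (e : freq -> C -> C) (lam : 'rV[R]_m -> C -> C)
         (Pi : freq -> C -> 'M[C]_n),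
  let NZ := [set z' : freq | Xi z' /\ `|z' - z| < r] in
  let NE := [set h : 'rV[R]_m | `|h - eta z| < r] in
  let NX := [set xi : C | cmod (xi - x%:C%C) < r] in
  [/\ 0 < r,
      [/\ smooth_on [set q : freq * (R * R) | NZ q.1 /\ NX (cx q.2)]
            (fun q => e q.1 (cx q.2)),
          smooth_on [set q : 'rV[R]_m * (R * R) | NE q.1 /\ NX (cx q.2)]
            (fun q => lam q.1 (cx q.2)) &
          smooth_mx_on [set q : freq * (R * R) | NZ q.1 /\ NX (cx q.2)]
            (fun q => Pi q.1 (cx q.2))],
      forall xi, NX xi ->
        [/\ forall z', NZ z' -> holomorphic_at (e z') xi,
            forall h, NE h -> holomorphic_at (lam h) xi &
            forall z', NZ z' ->
              forall i j, holomorphic_at (fun xi' => Pi z' xi' i j) xi],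
      forall h (y : R), NE h -> NX y%:C%C -> complex.Im (lam h y%:C%C) = 0 &
      forall z' xi, NZ z' -> NX xi ->
        [/\ e z' xi != 0,
            piP z' xi = e z' xi * (zeta0 z' + lam (eta z') xi) ^+ alpha,
            Pi z' xi *m Pi z' xi = Pi z' xi, \rank (Pi z' xi) = alpha &
            zeta0 z' + lam (eta z') xi = 0 ->
            kernel (xi%:M + asym z') = range (fun v : 'cV_n => Pi z' xi *m v)]].

Definition hyperbolic : Prop :=
  elliptic_interior /\
  forall z (x : R), sphere z -> piP z x%:C%C = 0 -> regular_root z x.

(* [E^-]: for [gamma = 0], the vectors that are limits of vectors of
   [E^-(z')] as [z' -> z], [gamma' > 0]; [standing] below forces the dimension
   to remain [p], so that this is the continuous extension. *)
Definition Eminus (z : freq) : set 'cV[C]_n :=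
  [set v | if 0 < z.2 then stable_space (asym z) v else
    forall eps : R, 0 < eps -> exists2 r : R, 0 < r &
      forall z' : freq, 0 < z'.2 -> `|z' - z| < r ->
        exists2 v', stable_space (asym z') v' & sqnorm (v' - v) < eps].

Definition hyperbolic_region : set freq :=
  [set z | [/\ Xi z, z.2 = 0 &
    exists (r : R) (T : freq -> 'M[C]_n) (mu : 'I_n -> freq -> C),
    let N := [set z' : freq | `|z' - z| < r] in
    [/\ 0 < r, smooth_mx_on N T, forall j, smooth_on N (mu j),
        forall z', N z' -> 0 <= z'.2 ->
          T z' \in unitmx /\
          asym z' = T z' *m diag_mx (\row_j mu j z') *m invmx (T z') &
        forall z' j, N z' -> z'.2 = 0 ->
          complex.Im (mu j z') = 0 /\
          exists2 c : R, c != 0 &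
            'i%C * cderive (dgamma R m) (mu j) z' = c%:C%C]]].

(* [L = D_t + \sum_j A'_j D_{y_j} + A_d D_{x_d}]. *)
Definition arises_from (A' : 'I_m -> 'M[C]_n) (Ad : 'M[C]_n) : Prop :=
  Ad \in unitmx /\
  forall z : freq, asym z =
    invmx Ad *m ((zeta0 z)%:M + \sum_(j < m) (eta z ord0 j)%:C%C *: A' j).

End Operator.

Section ConstantMultiplicities.
Variables (R : realType) (m n : nat).
Local Notation C := R[i].
Variables (A' : 'I_m -> 'M[C]_n) (Ad : 'M[C]_n).

Definition spatial_symbol (h : 'rV[R]_m) (x : R) : 'M[C]_n :=
  \sum_(j < m) (h ord0 j)%:C%C *: A' j + x%:C%C *: Ad.

(* Real eigenvalues, semisimple (geometric and algebraic multiplicities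
   agree), with multiplicities independent of the frequency. *)
Definition constant_multiplicities : Prop :=
  exists (q : nat) (mult : 'I_q -> nat), (forall j, (0 < mult j)%N) /\
  forall h x, (h, x) != 0 ->
  exists r : 'I_q -> R,
    [/\ injective r,
        char_poly (spatial_symbol h x) =
          \prod_(j < q) ('X - ((r j)%:C%C)%:P) ^+ mult j &
        forall j,
          (\rank (spatial_symbol h x - ((r j)%:C%C)%:M)%R + mult j)%N = n].

Definition nb_positive_eigenvalues (p : nat) : Prop :=
  exists s : seq R,
    char_poly Ad = \prod_(x <- s) ('X - (x%:C%C)%:P) /\
    count (fun x => 0 < x) s = p.

End ConstantMultiplicities.

Section BoundaryValueProblem.
Variables (R : realType) (m n p : nat).
Local Notation C := R[i].
Local Notation freq := (freq R m).
Variables (A : 'I_m.+1 -> 'M[C]_n) (b : freq -> 'M[C]_(p, n)).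

Definition standing : Prop :=
  [/\ hyperbolic A,
      symbol0 b,
      forall z, Xi z -> \rank (b z) = p,
      forall z, Xi z -> exists e : 'M[C]_(n, p), is_basis e (Eminus A z) &
      forall A' Ad, arises_from A A' Ad ->
        constant_multiplicities A' Ad /\ nb_positive_eigenvalues Ad p].

Definition ell (z : freq) : set 'cV[C]_n := Eminus A z `&` kernel (b z).

Definition Gamma : set freq :=
  [set z | sphere z /\ exists2 v, ell z v & v != 0].

Definition lopatinskii_det (e : freq -> 'M[C]_(n, p)) : freq -> C :=
  fun z => \det (b z *m e z).

(* [E^-] need not have a basis that is smooth and defined on all of [Xi] (it
   is not smooth at glancing points), so bases are taken locally; changing the
   basis multiplies the determinant by a nonvanishing smooth function. *)
Definition smooth_basis_near (z : freq) (e : freq -> 'M[C]_(n, p)) : Prop :=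
  exists U : set freq,
    [/\ open U, U z, forall z' (s : R), U z' -> 0 < s -> U (s *: z'),
        smooth_mx_on (Xi `&` U) e /\ homogeneous0 (Xi `&` U) e &
        forall z', Xi z' -> U z' -> is_basis (e z') (Eminus A z')].

Definition lopatinskii_zero : set freq :=
  [set z | Xi z /\
    exists2 e : 'M[C]_(n, p), is_basis e (Eminus A z) & \det (b z *m e) = 0].

Definition classWR : Prop :=
  [/\ standing,
      forall z, sphere z -> 0 < z.2 -> ell z = [set 0],
      lopatinskii_zero !=set0,
      lopatinskii_zero `<=` hyperbolic_region A &
      forall z, lopatinskii_zero z ->
        exists2 e, smooth_basis_near z e &
          cderive (dtau R m) (lopatinskii_det e) z != 0].

Definition lopatinskii_family (delta : freq -> 'M[C]_n) : Prop :=
  [/\ symbol0 delta,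
      forall z, sphere z -> 0 < z.2 -> kernel (delta z) = [set 0] &
      forall z, Gamma z ->
        (exists2 v, kernel (delta z) v & v != 0) /\
        ell z `<=` kernel (delta z)].

End BoundaryValueProblem.

Section Analysis.
Variables (R : realType) (m : nat).
Local Notation C := R[i].
Local Notation pt := 'rV[R]_m.+1.
Local Notation freq := (freq R m).

Definition row_of (x : m.+1.-tuple (measurableTypeR R)) : pt :=
  \row_i tnth x i.

Definition intC (f : pt -> C) : C :=
  ((\int[lebesgue_Rn R m.+1]_x complex.Re (f (row_of x))) +i*
   (\int[lebesgue_Rn R m.+1]_x complex.Im (f (row_of x))))%C.

Definition fourier (phi : pt -> C) : pt -> C := fun xi =>
  let theta x := \sum_i x ord0 i * xi ord0 i in
  intC (fun x => (cos (theta x) -i* sin (theta x))%C * phi x).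

Definition pderive (i : 'I_m.+1) (phi : pt -> C) : pt -> C :=
  cderive (delta_mx ord0 i) phi.

Definition pderives (s : seq 'I_m.+1) (phi : pt -> C) : pt -> C :=
  foldr pderive phi s.

Definition schwartz_bound (N : nat) (M : R) (phi : pt -> C) : Prop :=
  forall s x, (size s <= N)%N ->
    (1 + `|x|) ^+ N * cmod (pderives s phi x) <= M.

Definition schwartz (phi : pt -> C) : Prop :=
  smooth_open setT phi /\ forall N, exists M, schwartz_bound N M phi.

(* A distribution is a functional applied to test functions; its values off
   the relevant space of test functions are irrelevant. *)
Definition functional := (pt -> C) -> C.

Definition tempered (u : functional) : Prop :=
  (forall (c : C) phi psi, schwartz phi -> schwartz psi ->
     u (fun x => c * phi x + psi x) = c * u phi + u psi) /\
  exists (N : nat) (K : R), forall phi M, schwartz phi ->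
    schwartz_bound N M phi -> cmod (u phi) <= K * M.

Definition dmul (f : pt -> C) (u : functional) : functional :=
  fun phi => u (fun x => f x * phi x).

Definition weight (g : R) (x : pt) : R := expR (g * x ord0 ord0).

Definition unweight (g : R) (u : functional) : functional :=
  dmul (fun x => (weight (- g) x)%:C%C) u.

Definition vdist N := 'I_N -> functional.

(* [u \in e^{gamma t} S'], componentwise. *)
Definition tempered_g N (g : R) (u : vdist N) : Prop :=
  forall k, tempered (unweight g (u k)).

(* [w = Op_gamma(s) v = e^{gamma t} Op(s(., gamma)) e^{-gamma t} v].  For
   scalar tempered [u], [w], the equation [w^ = s u^] tested on [phi] reads
   [w(phi^) = u((s phi)^)]. *)
Definition is_Op M N (g : R) (s : freq -> 'M[C]_(M, N))
    (v : vdist N) (w : vdist M) : Prop :=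
  forall phi, schwartz phi -> forall k,
    unweight g (w k) (fourier phi) =
    \sum_(l < N) unweight g (v l) (fourier (fun xi => s (xi, g) k l * phi xi)).

Definition L2g N (g : R) (f : pt -> 'cV[C]_N) : Prop :=
  (forall k,
     measurable_fun setT (fun x => complex.Re (f (row_of x) k ord0)) /\
     measurable_fun setT (fun x => complex.Im (f (row_of x) k ord0))) /\
  (\int[lebesgue_Rn R m.+1]_x
     (weight (- (2 * g)) (row_of x) * sqnorm (f (row_of x)))%:E < +oo)%E.

Definition ipg N (g : R) (f h : pt -> 'cV[C]_N) : C :=
  intC (fun x => (weight (- (2 * g)) x)%:C%C * hdot (f x) (h x)).

Definition normg N (g : R) (f : pt -> 'cV[C]_N) : R :=
  Num.sqrt (complex.Re (ipg g f f)).

(* The distribution [w] is the function [f] of [L^2_gamma]. *)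
Definition is_L2 N (g : R) (w : vdist N) (f : pt -> 'cV[C]_N) : Prop :=
  L2g g f /\
  forall phi, schwartz phi -> forall k,
    unweight g (w k) phi =
    intC (fun x => (weight (- g) x)%:C%C * f x k ord0 * phi x).

(* [Op_gamma(s) v] is the function [f] of [L^2_gamma]. *)
Definition Op_L2 M N (g : R) (s : freq -> 'M[C]_(M, N)) (v : vdist N)
    (f : pt -> 'cV[C]_M) : Prop :=
  exists w : vdist M, [/\ tempered_g g w, is_Op g s v w & is_L2 g w f].

Definition L2Delta n (delta : freq -> 'M[C]_n) (g : R) (v : vdist n) : Prop :=
  tempered_g g v /\ exists h, Op_L2 g delta v h.

Section Symmetrizer.
Variables (n p : nat).
Variables (A : 'I_m.+1 -> 'M[C]_n) (b : freq -> 'M[C]_(p, n)).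
Variables (delta sigma : freq -> 'M[C]_n).

(* All operators act at fixed [x_d], so the inequalities, which are between
   inner products on [R^d] at fixed [x_d], are stated for the traces
   [v(., x_d)].  An inner product is considered when both its arguments lie in
   [L^2_gamma]. *)
Definition sym_hermitian : Prop :=
  forall g v1 v2 f1 f2 h1 h2, 1 <= g ->
    L2Delta delta g v1 -> L2Delta delta g v2 ->
    is_L2 g v1 f1 -> is_L2 g v2 f2 ->
    Op_L2 g sigma v1 h1 -> Op_L2 g sigma v2 h2 ->
    ipg g h1 f2 = ipg g f1 h2.

Definition sym_bounded : Prop :=
  exists2 K : R, 0 < K &
  forall g v1 v2 h1 f2 k1 k2, 1 <= g ->
    L2Delta delta g v1 -> L2Delta delta g v2 ->
    Op_L2 g sigma v1 h1 -> is_L2 g v2 f2 ->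
    Op_L2 g delta v1 k1 -> Op_L2 g delta v2 k2 ->
    cmod (ipg g h1 f2) <= K * normg g k1 * normg g k2.

Definition sym_positive : Prop :=
  exists2 c : R, 0 < c &
  forall g v w f h k, 1 <= g ->
    L2Delta delta g v -> is_L2 g v f ->
    tempered_g g w -> is_Op g (asym A) v w -> Op_L2 g sigma w h ->
    Op_L2 g delta v k ->
    c * g * normg g k ^+ 2 <= complex.Im (ipg g h f).

Definition sym_boundary : Prop :=
  exists (al be : R) (Q : freq -> 'M[C]_p),
  [/\ 0 < al, 0 < be, symbol0 Q &
  forall g v w f h k q, 1 <= g ->
    L2Delta delta g v -> is_L2 g v f -> Op_L2 g sigma v h ->
    Op_L2 g delta v k ->
    tempered_g g w -> is_Op g b v w -> Op_L2 g Q w q ->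
    al * normg g k ^+ 2 - be * normg g q ^+ 2 <= complex.Re (ipg g h f)].

Definition WR_symmetrizer : Prop :=
  symbol0 sigma /\
  [/\ sym_hermitian, sym_bounded, sym_positive & sym_boundary].

End Symmetrizer.
End Analysis.

(* Main.v *)
Require Import Defs.
From HB Require Import structures.
From mathcomp Require Import all_boot all_order all_algebra.
From mathcomp Require Import complex.
From mathcomp Require Import all_classical all_reals all_analysis.
From mathcomp Require Import measurable_realfun ring lra.

Set Implicit Arguments.
Unset Strict Implicit.
Unset Printing Implicit Defensive.

Import Order.TTheory GRing.Theory Num.Theory numFieldNormedType.Exports.
Local Open Scope classical_set_scope.
Local Open Scope ring_scope.

(* At [zeta = z] the symmetrizer inequalities hold for symbols.  They are first
   tested on wave packets [e^(gamma t) F^-1(tent . u)], where the tent function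
   is supported near a frequency [x0] and [gamma = 1]: by Parseval, each side
   becomes an integral of the symbols against [tent^2], and shrinking the tent
   gives the inequality at [(x0, 1)], hence on [gamma > 0] by homogeneity, and
   on [gamma = 0] by continuity.  At [z] one gets that [S = sigma z] is
   Hermitian, that [Re <S u, w> <= K (s |D u|^2 + |D w|^2 / s)] for all [s > 0],
   where [D = delta z], and that [Im <S T u, u> >= 0], where [T = asym A z].
   Taking [w = S u] and [s] large, the second one shows that [ker D] is
   contained in [ker S].  The last one is an equality when [S u = 0]; its first
   variation there is [|S T u|^2], so [ker S] is [T]-invariant.  As [ell z] is
   contained in [ker D], [S] vanishes on the whole Krylov space. *)

(** The symmetrizer conditions speak of operators on distributions, so each packet must first be
    shown to be tempered, to lie in [L^2_gamma], and to be turned by [Op_gamma(s)] into the packet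
    whose amplitude is multiplied by [s]. A tent is only Lipschitz, hence not a Schwartz function,
    and the inverse transform of an amplitude is not known to be integrable. Parseval is therefore
    proved for bounded integrable amplitudes with a weak continuity property; square integrability
    of the transforms has to be established on the way. The bound of condition (ii) is a product of
    two norms, that is, of two square roots of integrals, and such a product does not localize. The
    parameter [s] replaces it by a sum of integrals, which does. The conditions concern [gamma >= 1]
    only. By homogeneity [(x, gamma)] is equivalent to [(x / gamma, 1)], so approaching the boundary
    [gamma = 0] sends the tested frequency to infinity in general. The constants obtained at
    [gamma = 1] must then be uniform in the frequency. *)

Section ComplexNumbers.
Variable R : realType.
Local Notation C := R[i].
Implicit Types x y : C.

Lemma cReD x y : complex.Re (x + y) = complex.Re x + complex.Re y.
Proof. by case: x y => [a b] [c d]. Qed.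
Lemma cImD x y : complex.Im (x + y) = complex.Im x + complex.Im y.
Proof. by case: x y => [a b] [c d]. Qed.
Lemma cReN x : complex.Re (- x) = - complex.Re x.
Proof. by case: x. Qed.
Lemma cReM x y : complex.Re (x * y) =
  complex.Re x * complex.Re y - complex.Im x * complex.Im y.
Proof. by case: x y => [a b] [c d]. Qed.
Lemma cImM x y : complex.Im (x * y) =
  complex.Re x * complex.Im y + complex.Im x * complex.Re y.
Proof. by case: x y => [a b] [c d]. Qed.
Lemma cRe_realM (c : R) x : complex.Re (c%:C%C * x) = c * complex.Re x.
Proof. by rewrite cReM /= mul0r subr0. Qed.
Lemma cIm_realM (c : R) x : complex.Im (c%:C%C * x) = c * complex.Im x.
Proof. by rewrite cImM /= mul0r addr0. Qed.
Lemma cReJ x : complex.Re (x^*)%C = complex.Re x.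
Proof. by case: x. Qed.
Lemma cImJ x : complex.Im (x^*)%C = - complex.Im x.
Proof. by case: x. Qed.
Lemma complex_ext x y :
  complex.Re x = complex.Re y -> complex.Im x = complex.Im y -> x = y.
Proof. by case: x y => [a b] [c d] /= -> ->. Qed.

Lemma cRe_sum I (s : seq I) (F : I -> C) :
  complex.Re (\sum_(k <- s) F k) = \sum_(k <- s) complex.Re (F k).
Proof. by elim/big_rec2: _ => // k a b _ <-; rewrite cReD. Qed.
Lemma cIm_sum I (s : seq I) (F : I -> C) :
  complex.Im (\sum_(k <- s) F k) = \sum_(k <- s) complex.Im (F k).
Proof. by elim/big_rec2: _ => // k a b _ <-; rewrite cImD. Qed.

Lemma conjcD x y : ((x + y)^*)%C = (x^*)%C + (y^*)%C.
Proof. by apply: complex_ext; rewrite ?(cReJ, cImJ, cReD, cImD)// opprD. Qed.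
Lemma conjcMl x y : ((x * y)^*)%C = (x^*)%C * (y^*)%C.
Proof. by apply: complex_ext; rewrite ?(cReJ, cImJ, cReM, cImM); ring. Qed.
Lemma conjc_invol x : ((x^*)^*)%C = x.
Proof. by apply: complex_ext; rewrite !(cReJ, cImJ)// opprK. Qed.

Lemma cmod_ge0 x : 0 <= cmod x.
Proof. by case: x => a b; exact: sqrtr_ge0. Qed.
Lemma cmod_sqr x : cmod x ^+ 2 = complex.Re x ^+ 2 + complex.Im x ^+ 2.
Proof. by case: x => a b; rewrite /= sqr_sqrtr// addr_ge0// sqr_ge0. Qed.
Lemma cmodM x y : cmod (x * y) = cmod x * cmod y.
Proof. exact: ComplexField.Normc.normcM. Qed.
Lemma cmod_real (a : R) : cmod a%:C%C = `|a|.
Proof. by rewrite /cmod/= expr0n addr0 sqrtr_sqr. Qed.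
Lemma cmod0 : cmod (0 : C) = 0.
Proof. by rewrite -[0]/(0%:C%C) cmod_real normr0. Qed.
Lemma cmodJ x : cmod (x^*)%C = cmod x.
Proof. by case: x => a b; rewrite /cmod/= sqrrN. Qed.
Lemma cmodD x y : cmod (x + y) <= cmod x + cmod y.
Proof.
by have := ComplexField.lec_normD x y; rewrite /= => /andP[].
Qed.
Lemma Re_le_cmod x : `|complex.Re x| <= cmod x.
Proof.
rewrite -(ler_sqr (normr_ge0 _) (cmod_ge0 _)) cmod_sqr real_normK ?num_real//.
by rewrite lerDl sqr_ge0.
Qed.
Lemma Im_le_cmod x : `|complex.Im x| <= cmod x.
Proof.
rewrite -(ler_sqr (normr_ge0 _) (cmod_ge0 _)) cmod_sqr real_normK ?num_real//.
by rewrite lerDr sqr_ge0.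
Qed.
Lemma cmod_le x : cmod x <= `|complex.Re x| + `|complex.Im x|.
Proof.
rewrite -(ler_sqr (cmod_ge0 _) (addr_ge0 (normr_ge0 _) (normr_ge0 _))).
rewrite cmod_sqr sqrrD !real_normK ?num_real// addrAC lerDl.
by rewrite mulrn_wge0// mulr_ge0.
Qed.
Lemma cRe_mulJ x : complex.Re (x * (x^*)%C) = cmod x ^+ 2.
Proof. by rewrite cReM cReJ cImJ cmod_sqr; ring. Qed.
Lemma cIm_mulJ x : complex.Im (x * (x^*)%C) = 0.
Proof. by rewrite cImM cReJ cImJ; ring. Qed.

End ComplexNumbers.

(** * Complex-valued integrals, through real and imaginary parts *)

Section ComplexIntegral.
Context d (T : measurableType d) (R : realType).
Local Notation C := R[i].
Implicit Types (mu : {measure set T -> \bar R}) (f g : T -> C).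

Definition cmeas f := measurable_fun setT (@complex.Re R \o f) /\
  measurable_fun setT (@complex.Im R \o f).

Definition intc mu f : C :=
  ((\int[mu]_x complex.Re (f x)) +i* (\int[mu]_x complex.Im (f x)))%C.

Definition cint mu f :=
  cmeas f /\ mu.-integrable setT (EFin \o (@cmod R \o f)).

Lemma cmeasM f g : cmeas f -> cmeas g -> cmeas (fun x => f x * g x).
Proof.
move=> [f1 f2] [g1 g2]; split.
  rewrite (_ : _ \o _ = ((@complex.Re R \o f) \* (@complex.Re R \o g)) \-
    ((@complex.Im R \o f) \* (@complex.Im R \o g))).
    by apply: measurable_funB; apply: measurable_funM.
  by apply/funext => x /=; rewrite cReM.
rewrite (_ : _ \o _ = ((@complex.Re R \o f) \* (@complex.Im R \o g)) \+
  ((@complex.Im R \o f) \* (@complex.Re R \o g))).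
  by apply: measurable_funD; apply: measurable_funM.
by apply/funext => x /=; rewrite cImM.
Qed.

Lemma cmeasD f g : cmeas f -> cmeas g -> cmeas (fun x => f x + g x).
Proof.
move=> [f1 f2] [g1 g2]; split.
  rewrite (_ : _ \o _ = (@complex.Re R \o f) \+ (@complex.Re R \o g)).
    exact: measurable_funD.
  by apply/funext => x /=; rewrite cReD.
rewrite (_ : _ \o _ = (@complex.Im R \o f) \+ (@complex.Im R \o g)).
  exact: measurable_funD.
by apply/funext => x /=; rewrite cImD.
Qed.

Lemma cmeasJ f : cmeas f -> cmeas (fun x => ((f x)^*)%C).
Proof.
move=> [f1 f2]; split.
  by rewrite (_ : _ \o _ = @complex.Re R \o f)//; apply/funext => x /=; rewrite cReJ.
rewrite (_ : _ \o _ = \- (@complex.Im R \o f)).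
  exact: measurable_funN.
by apply/funext => x /=; rewrite cImJ.
Qed.

Lemma cmeas_real (h : T -> R) : measurable_fun setT h ->
  cmeas (fun x => (h x)%:C%C).
Proof. by move=> mh; split => //; exact: measurable_cst. Qed.

Lemma cmeas_cst (c : C) : cmeas (fun=> c).
Proof. by split; exact: measurable_cst. Qed.

Lemma cmeas_cmod f : cmeas f -> measurable_fun setT (@cmod R \o f).
Proof.
move=> [f1 f2].
rewrite (_ : _ \o _ = fun x => Num.sqrt (((@complex.Re R \o f) x) ^+ 2 +
   ((@complex.Im R \o f) x) ^+ 2)); last first.
  by apply/funext => x /=; case: (f x).
apply: (measurableT_comp (f := @Num.sqrt R)).
  by apply: continuous_measurable_fun; exact: sqrt_continuous.
by apply: measurable_funD; apply: measurable_funX.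
Qed.

Lemma cint_le mu f (g : T -> R) : cmeas f -> mu.-integrable setT (EFin \o g) ->
  (forall x, cmod (f x) <= g x) -> cint mu f.
Proof.
move=> mf ig fg; split=> //; apply: le_integrable ig => //.
  by apply/measurable_EFinP; exact: cmeas_cmod.
by move=> x _ /=; rewrite lee_fin ger0_norm ?cmod_ge0// (le_trans (fg x))// ler_norm.
Qed.

Lemma cint_Re mu f : cint mu f ->
  mu.-integrable setT (fun x => (complex.Re (f x))%:E).
Proof.
move=> [[mf _] iF]; apply: le_integrable iF => //.
  exact/measurable_EFinP.
move=> x _ /=; rewrite lee_fin [X in _ <= X]ger0_norm ?cmod_ge0//.
exact: Re_le_cmod.
Qed.

Lemma cint_Im mu f : cint mu f ->
  mu.-integrable setT (fun x => (complex.Im (f x))%:E).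
Proof.
move=> [[_ mf] iF]; apply: le_integrable iF => //.
  exact/measurable_EFinP.
move=> x _ /=; rewrite lee_fin [X in _ <= X]ger0_norm ?cmod_ge0//.
exact: Im_le_cmod.
Qed.

Lemma eq_intc mu f g : f =1 g -> intc mu f = intc mu g.
Proof. by move=> /funext ->. Qed.

Lemma intcD mu f g : cint mu f -> cint mu g ->
  intc mu (fun x => f x + g x) = intc mu f + intc mu g.
Proof.
move=> fi gi; apply: complex_ext; rewrite ?cReD ?cImD /=.
  under eq_Rintegral do rewrite cReD.
  by rewrite RintegralD//; exact: cint_Re.
under eq_Rintegral do rewrite cImD.
by rewrite RintegralD//; exact: cint_Im.
Qed.

Lemma intcZ mu (c : C) f : cint mu f ->
  intc mu (fun x => c * f x) = c * intc mu f.
Proof.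
move=> fi; have [fR fI] := (cint_Re fi, cint_Im fi).
have Z1 (r : R) h : mu.-integrable setT (fun x => (h x)%:E) ->
   mu.-integrable setT (fun x => (r * h x)%:E).
  by move=> ih; under eq_fun do rewrite EFinM; exact: integrableZl.
apply: complex_ext; rewrite ?cReM ?cImM /=.
  under eq_Rintegral do rewrite cReM.
  by rewrite RintegralB ?RintegralZl//; exact: Z1.
under eq_Rintegral do rewrite cImM.
by rewrite RintegralD ?RintegralZl//; exact: Z1.
Qed.

Lemma intcJ mu f : cint mu f ->
  intc mu (fun x => ((f x)^*)%C) = ((intc mu f)^*)%C.
Proof.
move=> fi; have fI := cint_Im fi.
apply: complex_ext; rewrite ?cReJ ?cImJ/=.
  by under eq_Rintegral do rewrite cReJ.
under eq_Rintegral do rewrite cImJ -mulN1r.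
by rewrite RintegralZl// mulN1r.
Qed.

Lemma intc_real mu (h : T -> R) :
  intc mu (fun x => (h x)%:C%C) = (\int[mu]_x h x)%:C%C.
Proof.
apply: complex_ext => //=; rewrite /Rintegral.
by rewrite integral0_eq.
Qed.

Lemma cint0 mu : cint mu (fun=> 0).
Proof.
split; first exact: cmeas_cst.
rewrite (_ : _ \o _ = cst 0%E); first exact: integrable0.
by apply/funext => x; congr EFin; exact: cmod0.
Qed.

Lemma intc0 mu : intc mu (fun=> 0) = 0.
Proof. by rewrite (intc_real mu (fun=> 0)) /Rintegral integral0. Qed.

Lemma cintZ mu (c : C) f : cint mu f -> cint mu (fun x => c * f x).
Proof.
move=> [mf fi]; apply: (@cint_le _ _ (fun x => cmod c * cmod (f x))).
- by apply: cmeasM => //; exact: cmeas_cst.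
- rewrite (_ : _ \o _ = fun x => ((cmod c)%:E * (EFin \o (@cmod R \o f)) x)%E).
    exact: integrableZl.
  by apply/funext => x /=; rewrite EFinM.
- by move=> x; rewrite cmodM.
Qed.

Lemma cintD mu f g : cint mu f -> cint mu g -> cint mu (fun x => f x + g x).
Proof.
move=> [mf fi] [mg gi].
apply: (@cint_le _ _ (fun x => cmod (f x) + cmod (g x))).
- exact: cmeasD.
- exact: (integrableD measurableT fi gi).
- by move=> x; exact: cmodD.
Qed.

Lemma cintJ mu f : cint mu f -> cint mu (fun x => ((f x)^*)%C).
Proof.
move=> [mf fi]; apply: (cint_le _ fi); first exact: cmeasJ.
by move=> x; rewrite cmodJ.
Qed.

Lemma cint_Mbounded mu f g (B : R) : cmeas f -> (forall x, cmod (f x) <= B) ->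
  cint mu g -> cint mu (fun x => f x * g x).
Proof.
move=> mf fB [mg gi]; apply: (@cint_le _ _ (fun x => B * cmod (g x))).
- exact: cmeasM.
- rewrite (_ : _ \o _ = fun x => (B%:E * (EFin \o (@cmod R \o g)) x)%E).
    exact: integrableZl.
  by apply/funext => x /=; rewrite EFinM.
- by move=> x; rewrite cmodM ler_wpM2r// cmod_ge0.
Qed.

Lemma cint_sum mu I (s : seq I) (F : I -> T -> C) :
  (forall k, cint mu (F k)) -> cint mu (fun x => \sum_(k <- s) F k x).
Proof.
move=> Fi; elim: s => [|k s ih].
  by under eq_fun do rewrite big_nil; exact: cint0.
by under eq_fun do rewrite big_cons; exact: cintD.
Qed.

Lemma intc_sum mu I (s : seq I) (F : I -> T -> C) :
  (forall k, cint mu (F k)) ->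
  intc mu (fun x => \sum_(k <- s) F k x) = \sum_(k <- s) intc mu (F k).
Proof.
move=> Fi; elim: s => [|k s ih].
  by under eq_fun do rewrite big_nil; rewrite big_nil intc0.
under eq_fun do rewrite big_cons.
by rewrite intcD// ?ih ?big_cons//; exact: cint_sum.
Qed.

(** The constant 2 comes from bounding the modulus by [|Re| + |Im|]. Every use is a domination or a
    finiteness bound, where its size is immaterial. *)
Lemma cmod_intc mu f : cint mu f ->
  cmod (intc mu f) <= 2 * \int[mu]_x cmod (f x).
Proof.
move=> fi; have [fR fI] := (cint_Re fi, cint_Im fi); case: (fi) => _ fm.
have K h : mu.-integrable setT (fun x => (h x)%:E) ->
    (forall x, `|h x| <= cmod (f x)) ->
    `|\int[mu]_x h x| <= \int[mu]_x cmod (f x).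
  move=> ih hf; rewrite (le_trans (le_normr_Rintegral _ ih))//.
  by apply: le_Rintegral => //; exact: (integrable_norm ih).
rewrite (le_trans (cmod_le _))// mulr_natl mulr2n lerD//= K// => x.
  exact: Re_le_cmod.
exact: Im_le_cmod.
Qed.

Lemma intc_dct mu (F : nat -> T -> C) f (g : T -> R) :
  (forall n, cmeas (F n)) -> cmeas f -> mu.-integrable setT (EFin \o g) ->
  (forall n x, cmod (F n x) <= g x) ->
  (forall x, complex.Re (F n x) @[n --> \oo] --> complex.Re (f x)) ->
  (forall x, complex.Im (F n x) @[n --> \oo] --> complex.Im (f x)) ->
  (complex.Re (intc mu (F n)) @[n --> \oo] --> complex.Re (intc mu f)) /\
  (complex.Im (intc mu (F n)) @[n --> \oo] --> complex.Im (intc mu f)).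
Proof.
move=> mF mf ig Fg cR cI.
have K (H : nat -> T -> R) (h : T -> R) : (forall n, measurable_fun setT (H n)) ->
    measurable_fun setT h -> (forall n x, `|H n x| <= g x) ->
    (forall x, H n x @[n --> \oo] --> h x) ->
    \int[mu]_x H n x @[n --> \oo] --> \int[mu]_x h x.
  move=> mH mh Hg cH.
  have [||||ih _ c] := @dominated_convergence _ _ _ mu setT measurableT
     (fun n => EFin \o H n) (EFin \o h) (EFin \o g) _ _ _ ig _.
  - by move=> n; exact/measurable_EFinP.
  - exact/measurable_EFinP.
  - by apply/aeW => x _; apply: cvg_EFin; [exact: nearW|exact: cH].
  - by apply/aeW => x n _; rewrite /= lee_fin.
  by apply: fine_cvg; rewrite fineK//; exact: integrable_fin_num.
split; apply: K => //=.
- by move=> n; case: (mF n).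
- by case: mf.
- by move=> n x; rewrite (le_trans (Re_le_cmod _)).
- by move=> n; case: (mF n).
- by case: mf.
- by move=> n x; rewrite (le_trans (Im_le_cmod _)).
Qed.

End ComplexIntegral.

(** * Fubini for complex integrands *)

Section ComplexFubini.
Context d1 d2 (T1 : measurableType d1) (T2 : measurableType d2) (R : realType).
Variables (m1 : {sigma_finite_measure set T1 -> \bar R})
  (m2 : {sigma_finite_measure set T2 -> \bar R}).
Local Notation C := R[i].

Section Real.
Variables (f : T1 * T2 -> R) (g1 : T1 -> R) (g2 : T2 -> R).
Hypotheses (mf : measurable_fun setT f)
  (i1 : m1.-integrable setT (EFin \o g1)) (i2 : m2.-integrable setT (EFin \o g2))
  (fg : forall x y, `|f (x, y)| <= g1 x * g2 y).

Let mf2 x : measurable_fun setT (fun y => f (x, y)).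
Proof. by apply: measurableT_comp mf _; exact: measurable_pair1. Qed.

Let if2 x : m2.-integrable setT (fun y => (f (x, y))%:E).
Proof.
have : m2.-integrable setT (fun y => ((g1 x)%:E * (EFin \o g2) y)%E).
  exact: integrableZl.
apply: le_integrable => //; first exact/measurable_EFinP.
by move=> y _ /=; rewrite lee_fin (le_trans (fg _ _))// ler_norm.
Qed.

(** A tensor-product majorant makes every slice integrable, not only almost every one. The iterated
    [Rintegral]s below, which apply [fine] slice by slice, therefore agree everywhere with the
    extended integrals. *)
Lemma integrable_prod_dominated : (m1 \x m2)%E.-integrable setT (EFin \o f).
Proof.
apply/integrable12ltyP; first exact/measurable_EFinP.
have I2 : (\int[m2]_y `|(g2 y)%:E| < +oo)%E by case/integrableP: i2.
have I1 : (\int[m1]_x `|(g1 x)%:E| < +oo)%E by case/integrableP: i1.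
have m1' : measurable_fun setT g1 by apply/measurable_EFinP; case/integrableP: i1.
have m2' : measurable_fun setT g2 by apply/measurable_EFinP; case/integrableP: i2.
apply: (@le_lt_trans _ _
  (\int[m1]_x (`|(g1 x)%:E| * \int[m2]_y `|(g2 y)%:E|))%E).
  apply: ge0_le_integral => //.
  - by move=> x _; apply: integral_ge0.
  - apply: (measurable_fun_fubini_tonelli_F (fun z => `|(f z)%:E|%E)) => //.
    by apply: measurableT_comp => //; exact/measurable_EFinP.
  - apply: emeasurable_funM => //; apply: measurableT_comp => //.
    exact/measurable_EFinP.
  move=> x _; rewrite -ge0_integralZl//; last first.
    by apply: measurableT_comp => //; exact/measurable_EFinP.
  apply: ge0_le_integral => //.
  - by apply: measurableT_comp => //; exact/measurable_EFinP.
  - apply: emeasurable_funM => //; apply: measurableT_comp => //.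
    exact/measurable_EFinP.
  - by move=> y _; rewrite -EFinM lee_fin -normrM (le_trans (fg _ _))// ler_norm.
rewrite ge0_integralZr//.
- by rewrite lte_mul_pinfty// ?integral_ge0// ge0_fin_numE// integral_ge0.
- by apply: measurableT_comp => //; exact/measurable_EFinP.
- exact: integral_ge0.
Qed.

Lemma Rintegral_prod12 :
  \int[(m1 \x m2)%E]_z f z = \int[m1]_x \int[m2]_y f (x, y).
Proof.
rewrite /Rintegral -(integral12_prod_meas1 integrable_prod_dominated).
congr fine; apply: eq_integral => x _.
by rewrite /fubini_F fineK//; exact: integrable_fin_num.
Qed.

Let mf1 y : measurable_fun setT (fun x => f (x, y)).
Proof. by apply: measurableT_comp mf _; exact: measurable_pair2. Qed.

Let if1 y : m1.-integrable setT (fun x => (f (x, y))%:E).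
Proof.
have : m1.-integrable setT (fun x => ((g2 y)%:E * (EFin \o g1) x)%E).
  exact: integrableZl.
apply: le_integrable => //; first exact/measurable_EFinP.
by move=> x _ /=; rewrite lee_fin (le_trans (fg _ _))// mulrC ler_norm.
Qed.

Lemma Rintegral_prod21 :
  \int[(m1 \x m2)%E]_z f z = \int[m2]_y \int[m1]_x f (x, y).
Proof.
rewrite /Rintegral -(integral21_prod_meas1 integrable_prod_dominated).
congr fine; apply: eq_integral => x _.
by rewrite /fubini_G fineK//; exact: integrable_fin_num.
Qed.

End Real.

Variables (f : T1 * T2 -> C) (g1 : T1 -> R) (g2 : T2 -> R).
Hypotheses (mf : cmeas f)
  (i1 : m1.-integrable setT (EFin \o g1)) (i2 : m2.-integrable setT (EFin \o g2))
  (fg : forall x y, cmod (f (x, y)) <= g1 x * g2 y).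

Lemma intc_prod12 :
  intc (m1 \x m2)%E f = intc m1 (fun x => intc m2 (fun y => f (x, y))).
Proof.
case: mf => mR mI; apply: complex_ext => /=.
  apply: (Rintegral_prod12 (f := @complex.Re R \o f) mR i1 i2) => x y /=.
  by rewrite (le_trans (Re_le_cmod _)).
apply: (Rintegral_prod12 (f := @complex.Im R \o f) mI i1 i2) => x y /=.
by rewrite (le_trans (Im_le_cmod _)).
Qed.

Lemma intc_prod21 :
  intc (m1 \x m2)%E f = intc m2 (fun y => intc m1 (fun x => f (x, y))).
Proof.
case: mf => mR mI; apply: complex_ext => /=.
  apply: (Rintegral_prod21 (f := @complex.Re R \o f) mR i1 i2) => x y /=.
  by rewrite (le_trans (Re_le_cmod _)).
apply: (Rintegral_prod21 (f := @complex.Im R \o f) mI i1 i2) => x y /=.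
by rewrite (le_trans (Im_le_cmod _)).
Qed.

Lemma intc_swap : intc m1 (fun x => intc m2 (fun y => f (x, y))) =
  intc m2 (fun y => intc m1 (fun x => f (x, y))).
Proof. by rewrite -intc_prod12 intc_prod21. Qed.

End ComplexFubini.

Section ParameterMeasurability.
Context d1 d2 (T1 : measurableType d1) (T2 : measurableType d2) (R : realType).
Variables (m2 : {sigma_finite_measure set T2 -> \bar R}).

Lemma measurable_Rintegral_param (f : T1 * T2 -> R) : measurable_fun setT f ->
  measurable_fun setT (fun x => \int[m2]_y f (x, y)).
Proof.
move=> /measurable_EFinP mf; apply: measurableT_comp => //.
(* Slice integrals of nonnegative functions are measurable, hence the split into parts. As [fine] is
   itself measurable, slices whose integral is infinite do no harm. *)
rewrite (_ : (fun x => _) =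
  (fun x => \int[m2]_y (EFin \o f)^\+ (x, y) -
            \int[m2]_y (EFin \o f)^\- (x, y))%E); last first.
  apply/funext => x; rewrite [LHS]integralE; congr (_ - _)%E;
    by apply: eq_integral => y _; rewrite ?(funeposE, funenegE).
apply: emeasurable_funB.
  apply: measurable_fun_fubini_tonelli_F => //; exact: measurable_funepos.
apply: measurable_fun_fubini_tonelli_F => //; exact: measurable_funeneg.
Qed.

Lemma cmeas_intc_param (f : T1 * T2 -> R[i]) : cmeas f ->
  cmeas (fun x => intc m2 (fun y => f (x, y))).
Proof.
move=> [mR mI]; split.
  exact: (measurable_Rintegral_param (f := @complex.Re R \o f)).
exact: (measurable_Rintegral_param (f := @complex.Im R \o f)).
Qed.

End ParameterMeasurability.

(** * Affine substitution on the line *)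

Section AffineLine.
Variable R : realType.
Local Notation RT := (measurableTypeR R).
Local Notation mu := (@lebesgue_measure R).
Variables (a b : R).
Hypothesis a0 : a != 0.

Let phi : RT -> RT := fun x => a * x + b.

Let mphi : measurable_fun setT phi.
Proof. by apply: measurable_funD => //; exact: measurable_funM. Qed.

Let affine_measure : {measure set RT -> \bar R} :=
  mscale (NngNum (normr_ge0 a)) (measure_function_pushforward__canonical__measure_function_Measure
    mu mphi).

(** Lebesgue measure is determined by its values on half-open intervals, so only the preimages of
    []u, v]] have to be measured. *)
Let lebesgue_affine A : measurable A -> mu A = (`|a|%:E * mu (phi @^-1` A))%E.
Proof.
move=> mA; apply: (lebesgue_measure_unique (mu := affine_measure)) => // X [[u v] _ <-] /=.
rewrite /mscale/= /pushforward lebesgue_measure_itv/= lte_fin.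
have [ap|an|a00] := ltgtP 0 a; last by move: a0; rewrite -a00 eqxx.
- have -> : phi @^-1` `]u, v] = `](u - b) / a, (v - b) / a]%classic.
    apply/seteqP; split => x; rewrite /phi /= !in_itv/= ltr_pdivrMr// ler_pdivlMr//;
    rewrite ltrBlDr lerBrDr (mulrC x)//.
  rewrite lebesgue_measure_itv/= lte_fin ltr_pM2r ?invr_gt0// ltrD2r.
  case: ifPn => uv; last by rewrite mule0.
  rewrite -!EFinB -EFinM ger0_norm ?ltW//; congr EFin.
  by field.
(* A negative slope exchanges the endpoints and the interval becomes closed on the left; its length
   is still [(v - u) / |a|]. *)
- have -> : phi @^-1` `]u, v] = `[(v - b) / a, (u - b) / a[%classic.
    apply/seteqP; split => x; rewrite /phi /= !in_itv/= ltr_ndivlMr// ler_ndivrMr//;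
    by rewrite ltrBlDr lerBrDr (mulrC x) andbC.
  rewrite lebesgue_measure_itv/= lte_fin ltr_nM2r ?invr_lt0// ltrD2r.
  case: ifPn => uv; last by rewrite mule0.
  rewrite -!EFinB -EFinM ltr0_norm//; congr EFin.
  by field.
Qed.

Lemma ge0_integral_affine (f : R -> \bar R) : measurable_fun setT f ->
  (forall x, 0 <= f x)%E ->
  (\int[mu]_x f x = `|a|%:E * \int[mu]_x f (a * x + b)%R)%E.
Proof.
move=> mf f0; rewrite (eq_measure_integral affine_measure); last first.
  by move=> A mA _; exact: lebesgue_affine.
rewrite /affine_measure ge0_integral_mscale//=.
by rewrite (ge0_integral_pushforward mphi).
Qed.

Lemma Rintegral_affine (f : R -> R) : mu.-integrable setT (EFin \o f) ->
  \int[mu]_x f x = `|a| * \int[mu]_x f (a * x + b).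
Proof.
move=> fi; have mf : measurable_fun setT (EFin \o f) by exact: measurable_int fi.
rewrite /Rintegral [in LHS]integralE.
rewrite (@ge0_integral_affine (fun x => (EFin \o f)^\+ x)%E); last 2 first.
- exact: measurable_funepos.
- by [].
rewrite (@ge0_integral_affine (fun x => (EFin \o f)^\- x)%E); last 2 first.
- exact: measurable_funeneg.
- by [].
have [p1 p2] : (\int[mu]_x (EFin \o f)^\+ x < +oo)%E /\
    (\int[mu]_x (EFin \o f)^\- x < +oo)%E.
  by split; [exact: integral_funepos_lt_pinfty|exact: integral_funeneg_lt_pinfty].
move: p1 p2; rewrite (@ge0_integral_affine (fun x => (EFin \o f)^\+ x)%E)//; last first.
  exact: measurable_funepos.
rewrite (@ge0_integral_affine (fun x => (EFin \o f)^\- x)%E)//; last first.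
  exact: measurable_funeneg.
(* Dividing by [|a|] shows that both parts of the substituted integrand have finite integrals, so
   the factor can be taken out of their difference. *)
have an : 0 < `|a| by rewrite normr_gt0.
rewrite ![(_%:E * _)%E]muleC -!lte_pdivlMr// !mulyr gtr0_sg ?invr_gt0// mul1e => p1 p2.
rewrite -muleBl//; last first.
  by rewrite fin_num_adde_defl// fin_numN ge0_fin_numE// integral_ge0.
rewrite fineM//; last first.
  by rewrite fin_numB !ge0_fin_numE// ?integral_ge0// p1 p2.
rewrite mulrC; congr (_ * fine _); rewrite [RHS]integralE; congr (_ - _)%E;
  by apply: eq_integral => x _; rewrite ?(funeposE, funenegE).
Qed.

End AffineLine.

(** * Fourier transform of [exp(- eps |x|)] *)

Section ExponentialKernel.
Variable R : realType.
Local Notation mu := (@lebesgue_measure R).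
Variable eps : R.
Hypothesis eps0 : 0 < eps.

Definition expk (x : R) : R := expR (- (eps * `|x|)).

Lemma expk_gt0 x : 0 < expk x. Proof. exact: expR_gt0. Qed.

Lemma continuous_expk : continuous expk.
Proof.
move=> x; rewrite /expk.
apply: (@continuous_comp _ _ _ (fun x => - (eps * `|x|)) (@expR R)); last first.
  exact: continuous_expR.
apply: continuousN; apply: continuousM; first exact: cst_continuous.
exact: norm_continuous.
Qed.

Let D (xi : R) := eps ^+ 2 + xi ^+ 2.
Let D0 xi : D xi != 0.
Proof. by rewrite gt_eqF// ltr_wpDr ?sqr_ge0// exprn_gt0. Qed.

(** A primitive of [exp(- eps x) (1 + cos(x xi))], from two integrations by parts. Adding 1 to the
    cosine makes the integrand nonnegative, as the fundamental theorem on a half-line requires; the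
    same formula then gives the mass of [expk] (at [xi = 0]) and, by subtraction, its cosine
    transform. *)
Let prim (xi x : R) := expR (- eps * x) *
  ((xi * sin (x * xi) - eps * cos (x * xi)) / D xi - eps^-1).

Let is_derive_prim (xi x : R) :
  is_derive x (1 : R) (prim xi) (expR (- eps * x) * (1 + cos (x * xi))).
Proof.
apply: is_derive_eq; rewrite /GRing.scale/= /D.
have := D0 xi; rewrite /D => d0.
have e0 : eps != 0 by rewrite gt_eqF.
field.
by rewrite d0 e0.
Qed.

Let prim_cvg xi : prim xi x @[x --> +oo] --> 0.
Proof.
pose B := (`|xi| + eps) / D xi + eps^-1.
have cB c : expR (- eps * x) * c @[x --> +oo] --> 0.
  rewrite -[X in _ --> X](mul0r c); apply: cvgMr_tmp.
  have -> : (fun x => expR (- eps * x)) = (fun x => expR (- x)) \o ( *%R eps).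
    by apply/funext => x; rewrite /= mulNr.
  apply: cvg_comp; last exact: cvgr_expR.
  exact: gt0_cvgMry.
apply: (@squeeze_cvgr _ _ _ _ (fun x => expR (- eps * x) * - B) (fun x => expR (- eps * x) * B)); [|exact: cB|exact: cB].
apply: nearW => x; rewrite /prim !ler_pM2l ?expR_gt0// -ler_norml.
rewrite /B (le_trans (ler_normB _ _))// lerD//; last by rewrite ger0_norm// invr_ge0 ltW.
have Dp : 0 < D xi by rewrite lt_def D0 addr_ge0// sqr_ge0.
rewrite normrM normfV (ger0_norm (ltW Dp)) ler_pM2r ?invr_gt0//.
rewrite (le_trans (ler_normB _ _))// !normrM (ger0_norm (ltW eps0)) lerD//.
  by rewrite ler_piMr// ler_norml sin_geN1 sin_le1.
by rewrite ler_piMr ?(ltW eps0)// ler_norml cos_geN1 cos_le1.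
Qed.

Let integral_expk_1cos xi :
  (\int[mu]_x (expk x * (1 + cos (x * xi)))%:E =
   (2 * (eps^-1 + eps / D xi))%:E)%E.
Proof.
have cf : continuous (fun x : R => expk x * (1 + cos (x * xi))).
  move=> x; apply: continuousM; first exact: continuous_expk.
  exact/differentiable_continuous/derivable1_diffP.
rewrite ge0_symfun_integralT//; last 2 first.
- move=> x; rewrite mulr_ge0 ?expR_ge0// -lerBlDl sub0r; exact: cos_geN1.
- by move=> x; rewrite /= /expk normrN mulNr cosN.
rewrite -set_itvcy.
under eq_integral.
  move=> x; rewrite inE/= in_itv/= andbT => x0.
  rewrite /expk ger0_norm// -mulNr.
  over.
rewrite (@ge0_continuous_FTC2y _ _ (prim xi) _ 0) => [||||||].
- rewrite /prim !(mulr0, mul0r) expR0 sin0 cos0.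
  rewrite -EFinB -EFinM; congr EFin.
  have e0 : eps != 0 by rewrite gt_eqF.
  have := D0 xi => d0.
  field.
  by rewrite d0 e0.
- move=> x _; rewrite mulr_ge0 ?expR_ge0// -lerBlDl sub0r; exact: cos_geN1.
- apply: continuous_subspaceT => x.
  exact/differentiable_continuous/derivable1_diffP.
- exact: prim_cvg.
- by move=> x _; exact: ex_derive.
- apply: cvg_at_right_filter.
  exact/differentiable_continuous/derivable1_diffP.
- by move=> x _; rewrite derive1E; exact: derive_val.
Qed.

Lemma integrable_expk : mu.-integrable setT (EFin \o expk).
Proof.
apply/integrableP; split.
  apply/measurable_EFinP; apply: continuous_measurable_fun; exact: continuous_expk.
(* At frequency 0 the factor [1 + cos] equals 2, so the integral just computed dominates that of
   [expk]. *)
apply: (@le_lt_trans _ _ (\int[mu]_x (expk x * (1 + cos (x * 0)))%:E)%E); last first.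
  by rewrite integral_expk_1cos ltry.
apply: ge0_le_integral => //=.
- apply/measurable_EFinP; apply: measurableT_comp => //.
  by apply: continuous_measurable_fun; exact: continuous_expk.
- apply/measurable_EFinP; apply: measurable_funM.
    by apply: continuous_measurable_fun; exact: continuous_expk.
  by apply: measurable_funD => //; under eq_fun do rewrite mulr0; exact: measurable_cst.
- move=> x _; rewrite lee_fin ger0_norm ?expR_ge0// mulr0 cos0.
  by rewrite ler_peMr ?expR_ge0// lerDl.
Qed.

Let integrable_expkM (h : R -> R) : measurable_fun setT h ->
  (forall x, `|h x| <= 1) ->
  mu.-integrable setT (EFin \o (fun x => expk x * h x)).
Proof.
move=> mh h1; apply: (le_integrable _ _ _ integrable_expk) => //=.
  apply/measurable_EFinP; apply: measurable_funM => //.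
  by apply: continuous_measurable_fun; exact: continuous_expk.
move=> x _; rewrite lee_fin normrM ger0_norm ?expR_ge0//.
by rewrite ler_piMr ?expR_ge0.
Qed.

Let measurable_coslin xi : measurable_fun setT (fun x : R => cos (x * xi)).
Proof.
apply: measurableT_comp; last exact: measurable_funM.
apply: continuous_measurable_fun; exact: continuous_cos.
Qed.

Let measurable_sinlin xi : measurable_fun setT (fun x : R => sin (x * xi)).
Proof.
apply: measurableT_comp; last exact: measurable_funM.
apply: continuous_measurable_fun; exact: continuous_sin.
Qed.

Let norm_cos_le1 (x : R) : `|cos x| <= 1.
Proof. by rewrite ler_norml cos_geN1 cos_le1. Qed.
Let norm_sin_le1 (x : R) : `|sin x| <= 1.
Proof. by rewrite ler_norml sin_geN1 sin_le1. Qed.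

Let Rintegral_expk_1cos xi :
  \int[mu]_x expk x + \int[mu]_x (expk x * cos (x * xi)) =
  2 * (eps^-1 + eps / D xi).
Proof.
rewrite -RintegralD//; [|exact: integrable_expk|exact: integrable_expkM].
rewrite -[RHS]/(fine (2 * (eps^-1 + eps / D xi))%:E) -integral_expk_1cos.
by congr fine; apply: eq_integral => x _; rewrite mulrDr mulr1.
Qed.

Lemma Rintegral_expk : \int[mu]_x expk x = 2 / eps.
Proof.
have := Rintegral_expk_1cos 0.
under [X in _ + X]eq_Rintegral do rewrite mulr0 cos0 mulr1.
rewrite /D expr0n addr0 /= => h.
have e0 : eps != 0 by rewrite gt_eqF.
have e2 : eps / eps ^+ 2 = eps^-1 by field.
move: h; rewrite e2; lra.
Qed.

Lemma Rintegral_expk_cos xi :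
  \int[mu]_x (expk x * cos (x * xi)) = 2 * eps / (eps ^+ 2 + xi ^+ 2).
Proof.
have := Rintegral_expk_1cos xi; rewrite Rintegral_expk => h.
rewrite -[LHS](addKr (2 / eps)) h -/(D xi).
by ring.
Qed.

(** The integrand is odd: the reflection [a = -1], [b = 0] turns the integral into its opposite. *)
Lemma Rintegral_expk_sin xi : \int[mu]_x (expk x * sin (x * xi)) = 0.
Proof.
have := @Rintegral_affine R (-1) 0 _ _ (integrable_expkM (measurable_sinlin xi) (fun x => norm_sin_le1 _)).
rewrite oppr_eq0 oner_eq0 => /(_ isT); rewrite normrN1 mul1r.
have -> : \int[mu]_x (expk (-1 * x + 0) * sin ((-1 * x + 0) * xi)) =
   \int[mu]_x (- 1 * (expk x * sin (x * xi))).
  apply: eq_Rintegral => x _.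
  by rewrite addr0 mulN1r /expk normrN mulNr sinN mulrN mulN1r.
rewrite RintegralZl//; last exact: integrable_expkM.
lra.
Qed.

End ExponentialKernel.

(** * The one-dimensional Poisson kernel *)

Section PoissonKernel.
Variable R : realType.
Local Notation mu := (@lebesgue_measure R).

(** The transform of [expk] at [eps = 1]. Its mass [2 pi], obtained from the primitive [2 atan], is
    the source of every factor [massT] below. *)
Definition poissonk (u : R) : R := 2 / (1 + u ^+ 2).

Lemma poissonk_gt0 u : 0 < poissonk u.
Proof. by rewrite divr_gt0// ltr_wpDr ?sqr_ge0. Qed.

Lemma continuous_poissonk : continuous poissonk.
Proof.
move=> u; apply: cvgM; first exact: cvg_cst.
apply: cvgV; first by rewrite gt_eqF// ltr_wpDr ?sqr_ge0.
apply: cvgD; first exact: cvg_cst.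
exact: exprn_continuous.
Qed.

Lemma integral_poissonk : (\int[mu]_x (poissonk x)%:E = (2 * pi)%:E)%E.
Proof.
rewrite ge0_symfun_integralT//; last 3 first.
- by move=> x; exact/ltW/poissonk_gt0.
- exact: continuous_poissonk.
- by move=> x; rewrite /poissonk/= sqrrN.
rewrite -set_itvcy.
rewrite (@ge0_continuous_FTC2y _ _ (fun x => 2 * atan x) _ (2 * (pi / 2))) => [||||||].
- rewrite atan0 mulr0 sube0 -EFinM; congr EFin.
  by field.
- by move=> x _; exact/ltW/poissonk_gt0.
- exact/continuous_subspaceT/continuous_poissonk.
- by apply: cvgMr; exact: cvgy_atan.
- by move=> x _; exact: ex_derive.
- apply: cvg_at_right_filter; apply: cvgM; first exact: cvg_cst.
  exact: continuous_atan.
- by move=> x _; rewrite derive1E derive_val /poissonk /GRing.scale/=.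
Qed.

Lemma integrable_poissonk : mu.-integrable setT (EFin \o poissonk).
Proof.
apply/integrableP; split.
  apply/measurable_EFinP; apply: continuous_measurable_fun; exact: continuous_poissonk.
under eq_integral do rewrite /= ger0_norm ?(ltW (poissonk_gt0 _))//.
by rewrite integral_poissonk ltry.
Qed.

End PoissonKernel.

(** * Integration over [R^k] by induction on the dimension *)

Section LebesgueTuples.
Variable R : realType.
Local Notation RT := (measurableTypeR R).
Local Notation mu := (@lebesgue_measure R).
Local Notation C := R[i].

Lemma tconsE k (t : k.+1.-tuple RT) : tcons (tuncons t) = t.
Proof. by case: t => -[//|x s] st; apply/val_inj. Qed.

Lemma tnth_tcons0 k (x : RT) (t : k.-tuple RT) : tnth (tcons (x, t)) ord0 = x.
Proof. exact: tnth0. Qed.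

Lemma tnth_tconsS k (x : RT) (t : k.-tuple RT) i :
  tnth (tcons (x, t)) (lift ord0 i) = tnth t i.
Proof. by rewrite [LHS]tnthS. Qed.

Lemma ge0_integral_RnS k (F : k.+1.-tuple RT -> \bar R) :
  measurable_fun setT F -> (forall t, 0 <= F t)%E ->
  (\int[lebesgue_Rn R k.+1]_t F t =
   \int[mu]_x \int[lebesgue_Rn R k]_t F (tcons (x, t)))%E.
Proof.
move=> mF F0; rewrite [LHS](ge0_integral_pushforward (@measurable_tcons R k))//.
rewrite preimage_setT (fubini_tonelli1 (F \o @tcons R k))//=.
by apply: measurableT_comp => //; exact: measurable_tcons.
Qed.

Lemma integrable_RnS k (f : k.+1.-tuple RT -> R) (g1 : R -> R)
    (g2 : k.-tuple RT -> R) :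
  measurable_fun setT f -> mu.-integrable setT (EFin \o g1) ->
  (lebesgue_Rn R k).-integrable setT (EFin \o g2) ->
  (forall x t, `|f (tcons (x, t))| <= g1 x * g2 t) ->
  (lebesgue_Rn R k.+1).-integrable setT (EFin \o f).
Proof.
move=> mf i1 i2 fg; apply: (integrable_pushforward (@measurable_tcons R k)) => //.
  exact/measurable_EFinP.
rewrite preimage_setT.
apply: (@integrable_prod_dominated _ _ _ _ _ _ _ (f \o @tcons R k) g1 g2) => //.
by apply: measurableT_comp => //; exact: measurable_tcons.
Qed.

Lemma Rintegral_RnS k (f : k.+1.-tuple RT -> R) (g1 : R -> R)
    (g2 : k.-tuple RT -> R) :
  measurable_fun setT f -> mu.-integrable setT (EFin \o g1) ->
  (lebesgue_Rn R k).-integrable setT (EFin \o g2) ->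
  (forall x t, `|f (tcons (x, t))| <= g1 x * g2 t) ->
  \int[lebesgue_Rn R k.+1]_t f t =
  \int[mu]_x \int[lebesgue_Rn R k]_t f (tcons (x, t)).
Proof.
move=> mf i1 i2 fg.
have mft : measurable_fun setT (f \o @tcons R k).
  by apply: measurableT_comp => //; exact: measurable_tcons.
rewrite -(@Rintegral_prod12 _ _ _ _ _ _ _ (f \o @tcons R k) g1 g2)//.
rewrite /Rintegral; congr fine.
rewrite [LHS](integral_pushforward (@measurable_tcons R k))//.
  exact/measurable_EFinP.
rewrite preimage_setT; exact: (integrable_prod_dominated (f := f \o @tcons R k) mft i1 i2).
Qed.

Lemma intc_RnS k (f : k.+1.-tuple RT -> C) (g1 : R -> R)
    (g2 : k.-tuple RT -> R) :
  cmeas f -> mu.-integrable setT (EFin \o g1) ->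
  (lebesgue_Rn R k).-integrable setT (EFin \o g2) ->
  (forall x t, cmod (f (tcons (x, t))) <= g1 x * g2 t) ->
  cint (lebesgue_Rn R k.+1) f /\
  intc (lebesgue_Rn R k.+1) f =
  intc mu (fun x => intc (lebesgue_Rn R k) (fun t => f (tcons (x, t)))).
Proof.
move=> mf i1 i2 fg; split.
  split => //; apply: (integrable_RnS (g1 := g1) (g2 := g2)) => //.
    exact: cmeas_cmod.
  by move=> x t; rewrite /= ger0_norm ?cmod_ge0.
case: mf => mR mI; apply: complex_ext => /=.
  apply: (Rintegral_RnS (f := @complex.Re R \o f) mR i1 i2) => x t /=.
  by rewrite (le_trans (Re_le_cmod _)).
apply: (Rintegral_RnS (f := @complex.Im R \o f) mI i1 i2) => x t /=.
by rewrite (le_trans (Im_le_cmod _)).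
Qed.

Lemma cmeas_prod k (h : 'I_k -> R -> C) :
  (forall i, cmeas (h i : RT -> C)) ->
  cmeas (fun t : k.-tuple RT => \prod_i h i (tnth t i)).
Proof.
move=> mh; elim: (index_enum _) => [|i s ih].
  by under eq_fun do rewrite big_nil; exact: cmeas_cst.
under eq_fun do rewrite big_cons.
apply: cmeasM => //; have [m1 m2] := mh i; split.
  apply: (measurableT_comp (f := @complex.Re R \o h i)) => //.
  exact: measurable_tnth.
apply: (measurableT_comp (f := @complex.Im R \o h i)) => //.
exact: measurable_tnth.
Qed.

(** All explicit integrals in dimension [k] reduce to this one: the damping factor and its
    transform, the Poisson kernel, and the indicator of a box are products over the coordinates. *)
Lemma intc_prod k (h : 'I_k -> R -> C) : (forall i, cint mu (h i)) ->
  cint (lebesgue_Rn R k) (fun t => \prod_i h i (tnth t i)) /\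
  intc (lebesgue_Rn R k) (fun t => \prod_i h i (tnth t i)) =
  \prod_i intc mu (h i).
Proof.
elim: k h => [|k ih] h hi.
  (* In dimension 0 the measure is the Dirac mass at the empty tuple, and both sides are the empty
     product 1. *)
  rewrite big_ord0; under eq_fun do rewrite big_ord0.
  split.
    split; first exact: cmeas_cst.
    rewrite (_ : _ \o _ = cst (cmod (1 : C))%:E)//.
    apply/integrableP; split; first exact: measurable_cst.
    by rewrite integral_dirac//= diracT mul1e ltry.
  rewrite [LHS](intc_real _ (fun=> 1)) /Rintegral integral_dirac//.
  by rewrite diracT mul1e.
have [ihi ihe] := ih (fun i => h (lift ord0 i)) (fun i => hi _).
have mp : cmeas (fun t : k.+1.-tuple RT => \prod_i h i (tnth t i)).
  by apply: cmeas_prod => i; case: (hi i).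
have E (x : RT) (t : k.-tuple RT) :
    \prod_i h (lift ord0 i) (tnth (tcons (x, t)) (lift ord0 i)) =
    \prod_i h (lift ord0 i) (tnth t i).
  by apply: eq_bigr => i _; rewrite tnth_tconsS.
have [|||pi pe] := @intc_RnS k _ (@cmod R \o h ord0)
  (fun t => cmod (\prod_i h (lift ord0 i) (tnth t i))) mp.
- by case: (hi ord0).
- by case: ihi.
- move=> x t; rewrite big_ord_recl tnth_tcons0 cmodM E; exact: lexx.
split; first exact: pi.
rewrite pe big_ord_recl -ihe.
rewrite -[RHS]mulrC -(intcZ _ (hi ord0)).
apply: eq_intc => x; rewrite -[RHS]mulrC -(intcZ _ ihi).
apply: eq_intc => t; rewrite big_ord_recl tnth_tcons0 E //.
Qed.

(** A dilation followed by a translation. With [a = eps] and [b = y] it is the substitution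
    [z = y + eps u] that turns a kernel concentrating at [y] into a fixed one. *)
Definition affine k (a : R) (b t : k.-tuple RT) : k.-tuple RT :=
  [tuple a * tnth t i + tnth b i | i < k].

Lemma measurable_affine k a (b : k.-tuple RT) : measurable_fun setT (affine a b).
Proof.
apply/measurable_fun_tnthP => i.
rewrite (_ : _ \o _ = fun t => a * tnth t i + tnth b i); last first.
  by apply/funext => t; rewrite /= tnth_mktuple.
apply: measurable_funD => //; apply: measurable_funM => //.
exact: measurable_tnth.
Qed.

Lemma affine_tcons k a (b : k.+1.-tuple RT) x (t : k.-tuple RT) :
  affine a b (tcons (x, t)) =
  tcons (a * x + tnth b ord0, affine a (tuncons b).2 t).
Proof.
apply: eq_from_tnth => i; rewrite tnth_mktuple.
have [j ->|->] := unliftP ord0 i; last by rewrite !tnth_tcons0.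
rewrite !tnth_tconsS tnth_mktuple; congr (_ + _).
by rewrite -[in LHS](tconsE b) tnth_tconsS.
Qed.

Lemma ge0_integral_Rn_affine k a (b : k.-tuple RT) (F : k.-tuple RT -> \bar R) :
  a != 0 -> measurable_fun setT F -> (forall t, 0 <= F t)%E ->
  (\int[lebesgue_Rn R k]_t F t =
   (`|a| ^+ k)%:E * \int[lebesgue_Rn R k]_t F (affine a b t))%E.
Proof.
move=> a0; elim: k b F => [|k ih] b F mF F0.
  rewrite expr0 mul1e; apply: eq_integral => t _.
  by rewrite (tuple0 t) (tuple0 (affine _ _ _)).
have mFx x : measurable_fun setT (fun t => F (tcons (x, t))).
  apply: measurableT_comp => //; apply: (measurableT_comp (@measurable_tcons R k)).
  exact: measurable_pair1.
have mFF : measurable_fun setT (fun x => \int[lebesgue_Rn R k]_t F (affine a b (tcons (x, t))))%E.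
  apply: (measurable_fun_fubini_tonelli_F (fun z => F (affine a b (tcons z)))) => //.
  apply: measurableT_comp => //; apply: measurableT_comp; first exact: measurable_affine.
  exact: measurable_tcons.
rewrite !ge0_integral_RnS//; last first.
  by apply: measurableT_comp => //; exact: measurable_affine.
rewrite (ge0_integral_affine (tnth b ord0) a0); last 2 first.
- apply: (measurable_fun_fubini_tonelli_F (F \o @tcons R k)) => [|z]; last exact: F0.
  by apply: measurableT_comp => //; exact: measurable_tcons.
- by move=> x; exact: integral_ge0.
rewrite exprS EFinM -muleA; congr (_ * _)%E.
rewrite -ge0_integralZl//; last by move=> x _; exact: integral_ge0.
apply: eq_integral => x _; rewrite (ih (tuncons b).2)//.
by under [in RHS]eq_integral do rewrite affine_tcons.
Qed.

Lemma Rintegral_Rn_affine k a (b : k.-tuple RT) (f : k.-tuple RT -> R) :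
  a != 0 -> (lebesgue_Rn R k).-integrable setT (EFin \o f) ->
  (lebesgue_Rn R k).-integrable setT (EFin \o (f \o affine a b)) /\
  \int[lebesgue_Rn R k]_t f t =
  `|a| ^+ k * \int[lebesgue_Rn R k]_t f (affine a b t).
Proof.
move=> a0 fi; have mf : measurable_fun setT (EFin \o f) by exact: measurable_int fi.
have an : 0 < `|a| ^+ k by rewrite exprn_gt0// normr_gt0.
have faI : (lebesgue_Rn R k).-integrable setT (EFin \o (f \o affine a b)).
  apply/integrableP; split.
    by apply: (measurableT_comp mf); exact: measurable_affine.
  move/integrableP: fi => [_].
  rewrite (ge0_integral_Rn_affine b a0)//; last exact: measurableT_comp.
  by rewrite muleC -lte_pdivlMr// mulyr gtr0_sg ?invr_gt0// mul1e.
split=> //.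
rewrite /Rintegral [in LHS]integralE.
rewrite (@ge0_integral_Rn_affine _ a b (fun x => (EFin \o f)^\+ x)%E)//; last first.
  exact: measurable_funepos.
rewrite (@ge0_integral_Rn_affine _ a b (fun x => (EFin \o f)^\- x)%E)//; last first.
  exact: measurable_funeneg.
have := integrable_pos_fin_num measurableT faI; have := integrable_neg_fin_num measurableT faI.
move=> p2 p1.
have ep : (\int[lebesgue_Rn R k]_t (EFin \o f)^\+ (affine a b t) =
    \int[lebesgue_Rn R k]_t (EFin \o (f \o affine a b))^\+ t)%E.
  by apply: eq_integral => x _; rewrite !funeposE.
have en : (\int[lebesgue_Rn R k]_t (EFin \o f)^\- (affine a b t) =
    \int[lebesgue_Rn R k]_t (EFin \o (f \o affine a b))^\- t)%E.
  by apply: eq_integral => x _; rewrite !funenegE.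
rewrite ep en fineB ?fin_numM// !fineM// -mulrBr -fineB//.
by congr (_ * fine _); rewrite [RHS]integralE.
Qed.

Lemma intc_Rn_affine k a (b : k.-tuple RT) (f : k.-tuple RT -> C) :
  a != 0 -> cint (lebesgue_Rn R k) f ->
  intc (lebesgue_Rn R k) f =
  (`|a| ^+ k)%:C%C * intc (lebesgue_Rn R k) (f \o affine a b).
Proof.
move=> a0 fi; apply: complex_ext; rewrite ?cRe_realM ?cIm_realM.
  by have [_] := Rintegral_Rn_affine b a0 (cint_Re fi).
by have [_] := Rintegral_Rn_affine b a0 (cint_Im fi).
Qed.

End LebesgueTuples.

(** * Unit complex exponentials *)

Section Cis.
Variable R : realType.
Local Notation C := R[i].

Definition cis (a : R) : C := (cos a +i* sin a)%C.

Lemma cisD a b : cis (a + b) = cis a * cis b.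
Proof. by apply: complex_ext; rewrite ?cReM ?cImM /= ?cosD ?sinD; ring. Qed.

Lemma cis0 : cis 0 = 1.
Proof. by rewrite /cis cos0 sin0. Qed.

Lemma cisN a : cis (- a) = ((cis a)^*)%C.
Proof. by rewrite /cis cosN sinN. Qed.

Lemma cmod_cis a : cmod (cis a) = 1.
Proof. by rewrite /cmod/= cos2Dsin2 sqrtr1. Qed.

Lemma cis_sum I (s : seq I) (F : I -> R) :
  cis (\sum_(i <- s) F i) = \prod_(i <- s) cis (F i).
Proof.
elim: s => [|i s ih]; first by rewrite !big_nil cis0.
by rewrite !big_cons cisD ih.
Qed.

Lemma prod_complex I (s : seq I) (F : I -> R) :
  \prod_(i <- s) (F i)%:C%C = (\prod_(i <- s) F i)%:C%C :> C.
Proof. by rewrite rmorph_prod. Qed.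

Lemma cmeas_comp d1 d2 (T1 : measurableType d1) (T2 : measurableType d2)
    (f : T2 -> C) (phi : T1 -> T2) :
  cmeas f -> measurable_fun setT phi -> cmeas (f \o phi).
Proof.
by move=> [m1 m2] mp; split; [exact: (measurableT_comp m1 mp)|exact: (measurableT_comp m2 mp)].
Qed.

Lemma cmeas_cis d (T : measurableType d) (h : T -> R) :
  measurable_fun setT h -> cmeas (fun x => cis (h x)).
Proof.
move=> mh; split.
  apply: (measurableT_comp (f := @cos R)) => //.
  by apply: continuous_measurable_fun; exact: continuous_cos.
apply: (measurableT_comp (f := @sin R)) => //.
by apply: continuous_measurable_fun; exact: continuous_sin.
Qed.

End Cis.

(** * Parseval's identity on [R^k] *)

Section FourierTuples.
Variables (R : realType) (k : nat).
Local Notation RT := (measurableTypeR R).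
Local Notation mu := (@lebesgue_measure R).
Local Notation T := (k.-tuple RT).
Local Notation L := (lebesgue_Rn R k).
Local Notation C := R[i].
Implicit Types (f g : T -> C).

Definition tdot (x y : T) : R := \sum_i tnth x i * tnth y i.

(** Neither transform is normalized, in agreement with [fourier]; the factor [massT = (2 pi)^k]
    appears in [parseval] instead. *)
Definition ft f (x : T) : C := intc L (fun y => cis (- tdot y x) * f y).
Definition ift f (x : T) : C := intc L (fun y => cis (tdot y x) * f y).

Arguments ft : simpl never.
Arguments ift : simpl never.
Arguments cmod : simpl never.

(** A product of one-dimensional exponentials rather than a radial one, so that its transform
    factors over the coordinates. *)
Definition expT (eps : R) (x : T) : R := \prod_i expk eps (tnth x i).
Definition poissonT (x : T) : R := \prod_i poissonk (tnth x i).
Definition massT : R := (2 * pi) ^+ k.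

Lemma massT_gt0 : 0 < massT.
Proof. by rewrite exprn_gt0// mulr_gt0// pi_gt0. Qed.

Lemma measurable_tdot d (X : measurableType d) (a b : X -> T) :
  measurable_fun setT a -> measurable_fun setT b ->
  measurable_fun setT (fun x => tdot (a x) (b x)).
Proof.
move=> ma mb; apply: measurable_sum => i; apply: measurable_funM.
  exact: (measurableT_comp (measurable_tnth i) ma).
exact: (measurableT_comp (measurable_tnth i) mb).
Qed.

Lemma measurable_tdotr (y : T) : measurable_fun setT (tdot^~ y).
Proof. exact: measurable_tdot. Qed.

Lemma cint_cisM (h : T -> R) f : measurable_fun setT h -> cint L f ->
  cint L (fun y => cis (h y) * f y).
Proof.
move=> mh fi; apply: (cint_Mbounded (B := 1)) => //; first exact: cmeas_cis.
by move=> y; rewrite cmod_cis.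
Qed.

(** This lets the bilinear identity [parseval], which pairs an [ift] with an [ft], yield Hermitian
    products and squared norms. *)
Lemma ftJ f (x : T) : cint L f -> ft (fun y => ((f y)^*)%C) x = ((ift f x)^*)%C.
Proof.
move=> fi; rewrite -intcJ; last exact: cint_cisM (measurable_tdotr x) fi.
by apply: eq_intc => y; rewrite conjcMl cisN.
Qed.

Lemma cmeas_ift f : cmeas f -> cmeas (ift f).
Proof.
move=> mf; apply: (@cmeas_intc_param _ _ T T R L
  (fun z : T * T => cis (tdot z.2 z.1) * f z.2)).
apply: cmeasM; last exact: (cmeas_comp mf).
by apply: cmeas_cis; exact: measurable_tdot.
Qed.

Lemma cmeas_ft f : cmeas f -> cmeas (ft f).
Proof.
move=> mf; apply: (@cmeas_intc_param _ _ T T R L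
  (fun z : T * T => cis (- tdot z.2 z.1) * f z.2)).
apply: cmeasM; last exact: (cmeas_comp mf).
by apply: cmeas_cis; apply: measurableT_comp => //; exact: measurable_tdot.
Qed.

Lemma cmod_ift_le f (x : T) : cint L f -> cmod (ift f x) <= 2 * \int[L]_y cmod (f y).
Proof.
move=> fi; rewrite (le_trans (cmod_intc _))//.
  exact: cint_cisM (measurable_tdotr x) fi.
by under eq_Rintegral do rewrite cmodM cmod_cis mul1r.
Qed.

Lemma cmod_ft_le f (x : T) : cint L f -> cmod (ft f x) <= 2 * \int[L]_y cmod (f y).
Proof.
move=> fi; rewrite (le_trans (cmod_intc _))//.
  apply: cint_cisM => //; apply: measurableT_comp => //.
  exact: measurable_tdotr x.
by under eq_Rintegral do rewrite cmodM cmod_cis mul1r.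
Qed.

Let cint_expk_cis eps (c : R) : 0 < eps ->
  cint mu (fun x : R => (expk eps x)%:C%C * cis (x * c)).
Proof.
move=> e0; apply: (@cint_le _ (measurableTypeR R) R mu _ (expk eps)); last first.
- by move=> x; rewrite cmodM cmod_cis mulr1 cmod_real ger0_norm// ltW// expk_gt0.
- exact: integrable_expk.
- apply: cmeasM.
    apply: cmeas_real; apply: continuous_measurable_fun; exact: continuous_expk.
  by apply: cmeas_cis; exact: measurable_funM.
Qed.

Let intc_expk_cis eps (c : R) : 0 < eps ->
  intc mu (fun x : R => (expk eps x)%:C%C * cis (x * c)) =
  (2 * eps / (eps ^+ 2 + c ^+ 2))%:C%C.
Proof.
move=> e0; apply: complex_ext => /=.
  rewrite -Rintegral_expk_cos//; apply: eq_Rintegral => x _.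
  by rewrite mul0r subr0.
rewrite -[RHS](Rintegral_expk_sin e0 c); apply: eq_Rintegral => x _.
by rewrite mul0r addr0.
Qed.

Lemma expT_prod eps (x : T) : (expT eps x)%:C%C = \prod_i (expk eps (tnth x i))%:C%C :> C.
Proof. by rewrite prod_complex. Qed.

Lemma cint_expT eps : 0 < eps -> cint L (fun x => (expT eps x)%:C%C).
Proof.
move=> e0; under eq_fun do rewrite expT_prod.
apply: (@intc_prod R k (fun _ x => (expk eps x)%:C%C) _).1 => _.
have := cint_expk_cis 0 e0.
by under eq_fun do rewrite mulr0 cis0 mulr1.
Qed.

Lemma expT_gt0 eps (x : T) : 0 < expT eps x.
Proof. by apply: prodr_gt0 => i _; exact: expk_gt0. Qed.

Lemma integrable_expT eps : 0 < eps -> L.-integrable setT (EFin \o expT eps).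
Proof. by move=> /cint_expT /cint_Re. Qed.

Lemma measurable_expT eps : 0 < eps -> measurable_fun setT (expT eps).
Proof. by move=> /integrable_expT /measurable_int /measurable_EFinP. Qed.

Lemma intc_expT_cis eps (y z : T) : 0 < eps ->
  intc L (fun x => (expT eps x)%:C%C * (cis (tdot y x) * cis (- tdot z x))) =
  (\prod_i (2 * eps / (eps ^+ 2 + (tnth y i - tnth z i) ^+ 2)))%:C%C.
Proof.
move=> e0.
have [_ h] := @intc_prod R k (fun i x => (expk eps x)%:C%C * cis (x * (tnth y i - tnth z i)))
  (fun i => cint_expk_cis _ e0).
rewrite -prod_complex -(eq_bigr _ (fun i _ => intc_expk_cis (tnth y i - tnth z i) e0)) -h.
apply: eq_intc => x; rewrite expT_prod -cisD -sumrB cis_sum -big_split/=.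
by apply: eq_bigr => i _; congr (_ * cis _); ring.
Qed.

Lemma poissonT_gt0 (x : T) : 0 < poissonT x.
Proof. by apply: prodr_gt0 => i _; exact: poissonk_gt0. Qed.

Let cint_poissonk : cint mu (fun x : R => (poissonk x)%:C%C).
Proof.
apply: (@cint_le _ (measurableTypeR R) R mu _ (@poissonk R)).
- apply: cmeas_real; apply: continuous_measurable_fun; exact: continuous_poissonk.
- exact: integrable_poissonk.
- by move=> x; rewrite cmod_real ger0_norm// ltW// poissonk_gt0.
Qed.

Lemma cint_poissonT : cint L (fun x => (poissonT x)%:C%C).
Proof.
have [+ _] := @intc_prod R k (fun _ x => (poissonk x)%:C%C) (fun=> cint_poissonk).
by under eq_fun do rewrite prod_complex.
Qed.

Lemma intc_poissonT : intc L (fun x => (poissonT x)%:C%C) = massT%:C%C.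
Proof.
have [_] := @intc_prod R k (fun _ x => (poissonk x)%:C%C) (fun=> cint_poissonk).
under eq_fun do rewrite prod_complex.
move=> ->; under eq_bigr do rewrite intc_real /Rintegral integral_poissonk/=.
by rewrite prod_complex prodr_const card_ord.
Qed.

Lemma integrable_poissonT : L.-integrable setT (EFin \o poissonT).
Proof. exact: (cint_Re cint_poissonT). Qed.

Lemma Rintegral_poissonT : \int[L]_x poissonT x = massT.
Proof. by have /(congr1 (@complex.Re R)) := intc_poissonT; rewrite intc_real. Qed.

Lemma measurable_poissonT : measurable_fun setT poissonT.
Proof. by have /measurable_int/measurable_EFinP := integrable_poissonT. Qed.

(** Convolution of [g] with the Poisson kernel dilated by [eps], written after the substitution
    [z = y + eps u]. The kernel is not normalized: it has mass [massT]. *)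
Definition smear g eps (y : T) : C :=
  intc L (fun u => (poissonT u)%:C%C * g (affine eps y u)).

(** The factor [eps^-k] is what the Jacobian [eps^k] of the substitution cancels. *)
Lemma kernel_affine eps (y u : T) : 0 < eps ->
  \prod_i (2 * eps / (eps ^+ 2 + (tnth y i - tnth (affine eps y u) i) ^+ 2)) =
  (eps ^+ k)^-1 * poissonT u.
Proof.
move=> e0; rewrite -[k in RHS](card_ord k) -prodr_const -prodfV -big_split/=.
apply: eq_bigr => i _; rewrite tnth_mktuple /poissonk.
have e1 : eps != 0 by rewrite gt_eqF.
have e2 : 1 + tnth u i ^+ 2 != 0 by rewrite gt_eqF// ltr_wpDr ?sqr_ge0.
have -> : tnth y i - (eps * tnth u i + tnth y i) = - (eps * tnth u i) by ring.
have e3 : eps ^+ 2 + (- (eps * tnth u i)) ^+ 2 = eps ^+ 2 * (1 + tnth u i ^+ 2) by ring.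
rewrite e3; field.
by rewrite e1 e2.
Qed.

(* The damping factor [expT eps] makes Fubini applicable; its transform is a
   dilated Poisson kernel, so that [eps -> 0] is an approximate identity. *)
Lemma parseval_smear eps f g (B : R) : 0 < eps -> cint L f -> cint L g ->
  (forall z, cmod (g z) <= B) ->
  intc L (fun x => (expT eps x)%:C%C * (ift f x * ft g x)) =
  intc L (fun y => f y * smear g eps y).
Proof.
move=> e0 fi gi gB; have [mf fI] := fi; have [mg gI] := gi.
have e1 : eps != 0 by rewrite gt_eqF.
have Ei := cint_expT e0.
have mE : cmeas (fun x => (expT eps x)%:C%C : C) by case: Ei.
pose G := 2 * \int[L]_y cmod (g y).
have ftG x : cmod (ft g x) <= G by exact: cmod_ft_le.
(* First exchange: [ift f x] is unfolded and [y] becomes the outer variable. Here [ft g] is merely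
   bounded, so integrability in [x] comes from [expT eps]. *)
transitivity (intc L (fun x => intc L (fun y =>
    (expT eps x)%:C%C * ft g x * (cis (tdot y x) * f y)))).
  apply: eq_intc => x; rewrite [RHS]intcZ; first by rewrite /ift; ring.
  exact: cint_cisM (measurable_tdotr x) fi.
rewrite (intc_swap (f := fun z : T * T => (expT eps z.1)%:C%C * ft g z.1 *
    (cis (tdot z.2 z.1) * f z.2)) (g1 := fun x => G * expT eps x)
    (g2 := fun y => cmod (f y)))//; last 3 first.
- apply: cmeasM.
    apply: cmeasM.
      exact: (cmeas_comp (f := fun x => (expT eps x)%:C%C) mE).
    exact: (cmeas_comp (cmeas_ft mg)).
  apply: cmeasM; first by apply: cmeas_cis; exact: measurable_tdot.
  exact: (cmeas_comp mf).
- rewrite (_ : _ \o _ = fun x => (G%:E * (EFin \o expT eps) x)%E); last first.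
    by apply/funext => x /=; rewrite EFinM.
  by apply: integrableZl => //; exact: integrable_expT.
- move=> x y; rewrite !cmodM cmod_cis mul1r cmod_real ler_wpM2r ?cmod_ge0//.
  by rewrite ger0_norm ?(ltW (expT_gt0 _ _))// mulrC ler_wpM2r ?(ltW (expT_gt0 _ _)).
apply: eq_intc => y /=.
transitivity (f y * intc L (fun x => intc L (fun z =>
   (expT eps x)%:C%C * cis (tdot y x) * (cis (- tdot z x) * g z)))).
  have ftE x : intc L (fun z => (expT eps x)%:C%C * cis (tdot y x) *
      (cis (- tdot z x) * g z)) = cis (tdot y x) * ft g x * (expT eps x)%:C%C.
    rewrite intcZ; first by rewrite /ft; ring.
    apply: cint_cisM => //; apply: measurableT_comp => //.
    exact: measurable_tdotr x.
  under [in RHS]eq_fun do rewrite ftE.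
  rewrite -intcZ; first by apply: eq_intc => x; ring.
  apply: (cint_Mbounded (B := G)) => //.
    apply: cmeasM; last exact: cmeas_ft.
    by apply: cmeas_cis; exact: measurable_tdot.
  by move=> x; rewrite cmodM cmod_cis mul1r.
congr (_ * _).
(* Second exchange: integrating over [x] first gathers the two exponentials and the damping into the
   kernel [K], known from [intc_expT_cis]. *)
rewrite (intc_swap (f := fun w : T * T => (expT eps w.1)%:C%C * cis (tdot y w.1) *
    (cis (- tdot w.2 w.1) * g w.2)) (g1 := expT eps)
    (g2 := fun z => cmod (g z)))//; last 3 first.
- apply: cmeasM.
    apply: cmeasM.
      exact: (cmeas_comp (f := fun x => (expT eps x)%:C%C) mE).
    by apply: cmeas_cis; exact: measurable_tdot.
  apply: cmeasM.
    by apply: cmeas_cis; apply: measurableT_comp => //; exact: measurable_tdot.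
  exact: (cmeas_comp mg).
- exact: integrable_expT.
- move=> x z; rewrite !cmodM !cmod_cis mul1r mulr1 cmod_real.
  by rewrite ger0_norm ?(ltW (expT_gt0 _ _)).
have cc z : cint L (fun x => (cis (tdot y x) * cis (- tdot z x)) * (expT eps x)%:C%C).
  apply: (cint_Mbounded (B := 1)) => //.
    apply: cmeasM; apply: cmeas_cis; first exact: measurable_tdot.
    by apply: measurableT_comp => //; exact: measurable_tdot.
  by move=> x; rewrite cmodM !cmod_cis mulr1.
pose K z := intc L (fun x => (cis (tdot y x) * cis (- tdot z x)) * (expT eps x)%:C%C).
have KE z : K z =
    (\prod_i (2 * eps / (eps ^+ 2 + (tnth y i - tnth z i) ^+ 2)))%:C%C.
  by rewrite -intc_expT_cis//; apply: eq_intc => x; rewrite mulrC.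
have mK : cmeas K.
  apply: (@cmeas_intc_param _ _ T T R L (fun w : T * T =>
    (cis (tdot y w.2) * cis (- tdot w.1 w.2)) * (expT eps w.2)%:C%C)).
  apply: cmeasM; last exact: (cmeas_comp (f := fun x => (expT eps x)%:C%C) mE).
  apply: cmeasM; apply: cmeas_cis; first exact: measurable_tdot.
  by apply: measurableT_comp => //; exact: measurable_tdot.
have KB z : cmod (K z) <= 2 * \int[L]_x expT eps x.
  rewrite (le_trans (cmod_intc (cc z)))// ler_wpM2l//.
  under eq_Rintegral do rewrite !cmodM !cmod_cis !mul1r cmod_real
    ger0_norm ?(ltW (expT_gt0 _ _))//.
  exact: lexx.
transitivity (intc L (fun z => K z * g z)).
  apply: eq_intc => z; rewrite mulrC -intcZ//.
  by apply: eq_intc => x; ring.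
rewrite (intc_Rn_affine y e1); last exact: (cint_Mbounded mK KB).
have -> : (fun z => K z * g z) \o affine eps y = fun u => ((eps ^+ k)^-1)%:C%C *
    ((poissonT u)%:C%C * g (affine eps y u)).
  apply/funext => u; rewrite /= KE kernel_affine// rmorphM/=; ring.
rewrite intcZ; last first.
  under eq_fun do rewrite mulrC.
  apply: (cint_Mbounded (B := B)) => //; last exact: cint_poissonT.
  exact: (cmeas_comp (f := g) (phi := affine eps y) mg (measurable_affine _ _)).
rewrite mulrA -rmorphM/= ger0_norm ?ltW// mulfV ?mul1r//.
by rewrite expf_neq0.
Qed.

(** Continuity only along the points [y + u / (n + 1)], which are the ones that [smear] evaluates;
    this is the pointwise limit that dominated convergence asks for. *)
Definition tcont f := forall y u,
  (complex.Re (f (affine n.+1%:R^-1 y u)) @[n --> \oo] --> complex.Re (f y)) /\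
  (complex.Im (f (affine n.+1%:R^-1 y u)) @[n --> \oo] --> complex.Im (f y)).

Definition tame f :=
  [/\ cint L f, exists B : R, forall z, cmod (f z) <= B & tcont f].

Lemma tameJ f : tame f -> tame (fun z => ((f z)^*)%C).
Proof.
move=> [fi [B fB] fc]; split; first exact: cintJ.
  by exists B => z; rewrite cmodJ.
move=> y u; have [cR cI] := fc y u; split.
  by under eq_fun do rewrite cReJ; rewrite cReJ.
by under eq_fun do rewrite cImJ; rewrite cImJ; exact: cvgN.
Qed.

Lemma measurable_affine2 eps : measurable_fun setT (fun z : T * T => affine eps z.1 z.2).
Proof.
apply/measurable_fun_tnthP => i.
rewrite (_ : _ \o _ = fun z => eps * tnth z.2 i + tnth z.1 i); last first.
  by apply/funext => t; rewrite /= tnth_mktuple.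
apply: measurable_funD.
  apply: measurable_funM => //; exact: (measurableT_comp (measurable_tnth i)).
exact: (measurableT_comp (measurable_tnth i)).
Qed.

Lemma cmeas_smear g eps : cmeas g -> cmeas (smear g eps).
Proof.
move=> mg; apply: (@cmeas_intc_param _ _ T T R L
  (fun z : T * T => (poissonT z.2)%:C%C * g (affine eps z.1 z.2))).
apply: cmeasM.
  by apply: cmeas_real; exact: (measurableT_comp measurable_poissonT).
exact: (cmeas_comp mg (measurable_affine2 eps)).
Qed.

Lemma cint_smear g eps (B : R) (y : T) : cmeas g -> (forall z, cmod (g z) <= B) ->
  cint L (fun u => (poissonT u)%:C%C * g (affine eps y u)).
Proof.
move=> mg gB; under eq_fun do rewrite mulrC.
apply: (cint_Mbounded (B := B)) => //; last exact: cint_poissonT.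
exact: (cmeas_comp (f := g) (phi := affine eps y) mg (measurable_affine _ _)).
Qed.

Lemma cmod_smear g eps (B : R) (y : T) : cmeas g -> (forall z, cmod (g z) <= B) ->
  cmod (smear g eps y) <= 2 * (B * massT).
Proof.
move=> mg gB; have si := cint_smear eps y mg gB.
rewrite (le_trans (cmod_intc si))// ler_wpM2l// -Rintegral_poissonT.
rewrite -RintegralZl//; last exact: integrable_poissonT.
apply: le_Rintegral => //; first by case: si.
- rewrite (_ : _ \o _ = fun x => (B%:E * (EFin \o poissonT) x)%E); last first.
    by apply/funext => x /=; rewrite EFinM.
  by apply: integrableZl => //; exact: integrable_poissonT.
- move=> u _; rewrite cmodM cmod_real ger0_norm ?(ltW (poissonT_gt0 _))// mulrC.
  by rewrite ler_wpM2r ?(ltW (poissonT_gt0 _)).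
Qed.

(** Approximate identity: the integrand tends to [poissonT u * g y] for each [u] and is dominated by
    [B * poissonT u], whatever [n] is. *)
Lemma cvg_smear g (y : T) : tame g ->
  (complex.Re (smear g n.+1%:R^-1 y) @[n --> \oo] --> complex.Re (massT%:C%C * g y)) /\
  (complex.Im (smear g n.+1%:R^-1 y) @[n --> \oo] --> complex.Im (massT%:C%C * g y)).
Proof.
move=> [gi [B gB] gc]; have [mg _] := gi.
have -> : massT%:C%C * g y = intc L (fun u => (poissonT u)%:C%C * g y).
  rewrite -intc_poissonT mulrC -intcZ; last exact: cint_poissonT.
  by apply: eq_intc => u; rewrite mulrC.
apply: (intc_dct (g := fun u => B * poissonT u)).
- by move=> n; have [] := cint_smear n.+1%:R^-1 y mg gB.
- apply: cmeasM; last exact: cmeas_cst.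
  by apply: cmeas_real; exact: measurable_poissonT.
- rewrite (_ : _ \o _ = fun x => (B%:E * (EFin \o poissonT) x)%E); last first.
    by apply/funext => x /=; rewrite EFinM.
  by apply: integrableZl => //; exact: integrable_poissonT.
- move=> n u; rewrite cmodM cmod_real ger0_norm ?(ltW (poissonT_gt0 _))// mulrC.
  by rewrite ler_wpM2r ?(ltW (poissonT_gt0 _)).
- move=> u; rewrite cReM /= mul0r subr0; under eq_fun do rewrite cReM /= mul0r subr0.
  by apply: cvgM; [exact: cvg_cst|exact: (gc y u).1].
- move=> u; rewrite cImM /= mul0r addr0; under eq_fun do rewrite cImM /= mul0r addr0.
  by apply: cvgM; [exact: cvg_cst|exact: (gc y u).2].
Qed.

Lemma cvg_intc_smear f g : cint L f -> tame g ->
  let J n := intc L (fun y => f y * smear g n.+1%:R^-1 y) in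
  let l := massT%:C%C * intc L (fun y => f y * g y) in
  (complex.Re (J n) @[n --> \oo] --> complex.Re l) /\
  (complex.Im (J n) @[n --> \oo] --> complex.Im l).
Proof.
move=> fi tg; have [gi [B gB] gc] := tg; have [mg _] := gi.
have [mf fI] := fi.
have fgi : cint L (fun y => f y * g y).
  by under eq_fun do rewrite mulrC; exact: (cint_Mbounded (B := B)).
move=> J l; rewrite /J /l {J l} -(intcZ massT%:C%C fgi).
apply: (intc_dct (g := fun y => 2 * (B * massT) * cmod (f y))).
- by move=> n; apply: cmeasM => //; exact: cmeas_smear.
- by apply: cmeasM; [exact: cmeas_cst|exact: cmeasM].
- rewrite (_ : _ \o _ = fun x => ((2 * (B * massT))%:E * (EFin \o (@cmod R \o f)) x)%E); last first.
    by apply/funext => x /=; rewrite EFinM.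
  exact: integrableZl.
- by move=> n y; rewrite cmodM mulrC ler_wpM2r ?cmod_ge0//; exact: cmod_smear.
- move=> y; have [cR cI] := cvg_smear y tg.
  rewrite mulrCA cReM; under eq_fun do rewrite cReM.
  by apply: cvgB; apply: cvgM => //; exact: cvg_cst.
- move=> y; have [cR cI] := cvg_smear y tg.
  rewrite mulrCA cImM; under eq_fun do rewrite cImM.
  by apply: cvgD; apply: cvgM => //; exact: cvg_cst.
Qed.

Lemma expT_le1 eps (x : T) : 0 < eps -> expT eps x <= 1.
Proof.
move=> e0; rewrite -[leRHS](@big1_eq _ 1 *%R _ (index_enum 'I_k) xpredT).
apply: ler_prod => i _; rewrite (ltW (expk_gt0 _ _))/= -[leRHS]expR0 ler_expR.
by rewrite oppr_le0 mulr_ge0// ltW.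
Qed.

Lemma expT_nondecreasing (x : T) n n' : (n <= n')%N ->
  expT n.+1%:R^-1 x <= expT n'.+1%:R^-1 x.
Proof.
move=> nn; apply: ler_prod => i _; rewrite (ltW (expk_gt0 _ _))/= ler_expR.
by rewrite lerN2 ler_wpM2r// lef_pV2 ?posrE// ler_nat.
Qed.

Lemma cvg_expT (x : T) : expT n.+1%:R^-1 x @[n --> \oo] --> (1 : R).
Proof.
rewrite -[X in _ --> X](@big1_eq _ 1 *%R _ (index_enum 'I_k) xpredT) /expT.
elim: (index_enum _) => [|i s ih].
  rewrite big_nil; under eq_fun do rewrite big_nil; exact: cvg_cst.
rewrite big_cons; under eq_fun do rewrite big_cons.
apply: cvgM => //; rewrite /expk -[X in _ --> X]expR0.
apply: continuous_cvg; first exact: continuous_expR.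
rewrite -[X in _ --> X]oppr0; apply: cvgN.
rewrite -[X in _ --> X](mul0r `|tnth x i|).
by apply: cvgM; [exact: cvg_harmonic|exact: cvg_cst].
Qed.

(** With [g] the conjugate of [f], [parseval_smear] expresses the damped square integral of [ift f]
    as an integral of [f] against a smeared [f], bounded independently of [eps]. This has to precede
    [parseval]: without it there is no majorant with which to remove the damping. *)
Lemma ift_L2 f : tame f -> L.-integrable setT (fun x => (cmod (ift f x) ^+ 2)%:E).
Proof.
move=> tf; have [fi [B fB] fc] := tf; have [mf fI] := fi.
have mF : measurable_fun setT (fun x => cmod (ift f x) ^+ 2).
  by apply: measurable_funX; apply: cmeas_cmod; exact: cmeas_ift.
have n0 n : 0 < n.+1%:R^-1 :> R by rewrite invr_gt0.
pose G := 2 * \int[L]_y cmod (f y).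
have G0 : 0 <= G by rewrite mulr_ge0// Rintegral_ge0// => y _; exact: cmod_ge0.
(* [M] does not depend on [n]; the inner factor 2 comes from [cmod_smear] and the outer one from
   [cmod_intc]. *)
pose M := 2 * (2 * (B * massT) * \int[L]_y cmod (f y)).
have Ei n : L.-integrable setT
    (fun x => (expT n.+1%:R^-1 x * cmod (ift f x) ^+ 2)%:E).
  apply: (@le_integrable _ _ _ L setT measurableT _
     (fun x => ((G ^+ 2)%:E * (EFin \o expT n.+1%:R^-1) x)%E)).
  - apply/measurable_EFinP; apply: measurable_funM => //; exact: measurable_expT.
  - move=> x _; suff h : `|expT n.+1%:R^-1 x * cmod (ift f x) ^+ 2| <=
        `|G ^+ 2 * expT n.+1%:R^-1 x| by exact: h.
    rewrite !normrM mulrC ler_wpM2r// !ger0_norm ?exprn_ge0 ?cmod_ge0//; last first.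
      by rewrite Rintegral_ge0// => y _; exact: cmod_ge0.
    by apply: ler_pM; rewrite ?cmod_ge0//; exact: cmod_ift_le.
  - by apply: integrableZl => //; exact: integrable_expT.
have EM n : (\int[L]_x (expT n.+1%:R^-1 x * cmod (ift f x) ^+ 2)%:E <= M%:E)%E.
  rewrite -[leLHS]fineK; last exact: integrable_fin_num.
  rewrite lee_fin; set r := (X in X <= _).
  have -> : r = complex.Re (intc L (fun y => f y *
      smear (fun z => ((f z)^*)%C) n.+1%:R^-1 y)).
    rewrite -(parseval_smear (B := B))//; last 2 first.
    - exact: cintJ.
    - by move=> z; rewrite cmodJ.
    rewrite /r; apply: eq_Rintegral => x _.
    by rewrite ftJ// cReM cRe_mulJ cIm_mulJ mulr0 subr0.
  have si : cint L (fun y => f y * smear (fun z => ((f z)^*)%C) n.+1%:R^-1 y).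
    under eq_fun do rewrite mulrC.
    apply: (cint_Mbounded (B := 2 * (B * massT))) => //.
      by apply: cmeas_smear; exact: cmeasJ.
    by move=> y; apply: cmod_smear => [|z]; [exact: cmeasJ|rewrite cmodJ].
  rewrite (le_trans (ler_norm _))// (le_trans (Re_le_cmod _))//.
  rewrite (le_trans (cmod_intc si))// ler_wpM2l//.
  rewrite -RintegralZl//; apply: le_Rintegral => //.
  - by case: si.
  - rewrite (_ : _ \o _ = fun x => ((2 * (B * massT))%:E * (EFin \o (@cmod R \o f)) x)%E); last first.
      by apply/funext => x /=; rewrite EFinM.
    exact: integrableZl.
  - move=> y _; rewrite cmodM mulrC ler_wpM2r ?cmod_ge0//.
    by apply: cmod_smear => [|z]; [exact: cmeasJ|rewrite cmodJ].
apply/integrableP; split; first exact/measurable_EFinP.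
apply: (@le_lt_trans _ _ M%:E); last exact: ltry.
(* The damping factors increase to 1, so monotone convergence carries the uniform bound over to the
   undamped square. *)
have lim x : limn (fun n => (expT n.+1%:R^-1 x * cmod (ift f x) ^+ 2)%:E) =
    (`|(cmod (ift f x) ^+ 2)%:E|)%E.
  apply/cvg_lim => //; apply: cvg_EFin; first exact: nearW.
  rewrite /= ger0_norm ?exprn_ge0 ?cmod_ge0// -[X in _ --> X]mul1r.
  by apply: cvgM; [exact: cvg_expT|exact: cvg_cst].
under eq_integral do rewrite -lim.
have cv := @cvg_monotone_convergence _ _ _ L setT measurableT
  (fun n x => (expT n.+1%:R^-1 x * cmod (ift f x) ^+ 2)%:E).
apply: cvge_le (cv _ _ _); first exact: nearW.
- by move=> n; apply: measurable_int (Ei n).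
- move=> n x _; rewrite lee_fin mulr_ge0 ?exprn_ge0 ?cmod_ge0//.
  exact/ltW/expT_gt0.
- move=> x _ n n' nn; rewrite lee_fin ler_wpM2r ?exprn_ge0 ?cmod_ge0//.
  exact: expT_nondecreasing.
Qed.

Lemma ft_L2 g : tame g -> L.-integrable setT (fun x => (cmod (ft g x) ^+ 2)%:E).
Proof.
move=> tg; have := ift_L2 (tameJ tg); apply: eq_integrable => // x _.
case: (tg) => gi _ _; congr (_ ^+ 2)%:E.
rewrite -[RHS]cmodJ -[LHS]cmodJ -(ftJ _ (cintJ gi)) cmodJ.
by congr cmod; apply: eq_intc => y; rewrite conjc_invol.
Qed.

Lemma cint_ift_ft f g : tame f -> tame g -> cint L (fun x => ift f x * ft g x).
Proof.
move=> tf tg; have [[[mf _] _ _] [[mg _] _ _]] := (tf, tg).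
apply: (cint_le (g := fun x => cmod (ift f x) ^+ 2 + cmod (ft g x) ^+ 2)).
- by apply: cmeasM; [exact: cmeas_ift|exact: cmeas_ft].
- exact: (integrableD measurableT (ift_L2 tf) (ft_L2 tg)).
- move=> x; rewrite cmodM; set a := cmod _; set c := cmod _.
  have : 0 <= (a - c) ^+ 2 by exact: sqr_ge0.
  have a0 : 0 <= a by exact: cmod_ge0.
  have c0 : 0 <= c by exact: cmod_ge0.
  have := mulr_ge0 a0 c0.
  nra.
Qed.

(** The damped integrals have two limits. On the transform side the undamped product is now
    integrable and serves as the majorant; on the other side [smear] is an approximate identity of
    mass [massT]. *)
Theorem parseval f g : tame f -> tame g ->
  intc L (fun x => ift f x * ft g x) = massT%:C%C * intc L (fun y => f y * g y).
Proof.
move=> tf tg; have [[fi _ _] [gi [B gB] _]] := (tf, tg).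
have fgi := cint_ift_ft tf tg; have [mfg fgI] := fgi.
have [cR cI] := cvg_intc_smear fi tg.
have n0 n : 0 < n.+1%:R^-1 :> R by rewrite invr_gt0.
pose J n := intc L (fun x => (expT n.+1%:R^-1 x)%:C%C * (ift f x * ft g x)).
have JE n : J n = intc L (fun y => f y * smear g n.+1%:R^-1 y).
  exact: parseval_smear gB.
have [dR dI] : (complex.Re (J n) @[n --> \oo] --> complex.Re (intc L (fun x => ift f x * ft g x))) /\
  (complex.Im (J n) @[n --> \oo] --> complex.Im (intc L (fun x => ift f x * ft g x))).
  apply: (intc_dct (g := fun x => cmod (ift f x * ft g x))) => //.
  - move=> n; apply: cmeasM => //; apply: cmeas_real; exact: measurable_expT.
  - move=> n x; rewrite cmodM cmod_real ger0_norm ?(ltW (expT_gt0 _ _))//.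
    by rewrite ler_piMl ?cmod_ge0// expT_le1.
  - move=> x; move: (ift f x * ft g x) => w.
    under eq_fun do rewrite cReM /= mul0r subr0.
    suff: expT n.+1%:R^-1 x * complex.Re w @[n --> \oo] --> 1 * complex.Re w.
      by rewrite mul1r.
    by apply: cvgM; [exact: cvg_expT|exact: cvg_cst].
  - move=> x; move: (ift f x * ft g x) => w.
    under eq_fun do rewrite cImM /= mul0r addr0.
    suff: expT n.+1%:R^-1 x * complex.Im w @[n --> \oo] --> 1 * complex.Im w.
      by rewrite mul1r.
    by apply: cvgM; [exact: cvg_expT|exact: cvg_cst].
have JE' : J = (fun n => intc L (fun y => f y * smear g n.+1%:R^-1 y)).
  exact/funext.
rewrite JE' in dR dI.
apply: complex_ext.
  by apply: (cvg_unique _ dR cR) => //.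
by apply: (cvg_unique _ dI cI) => //.
Qed.

End FourierTuples.

(** * Continuous complex-valued functions *)

Section ContinuousComplex.
Variables (R : realType) (V : topologicalType).
Local Notation C := R[i].

Definition ccont (f : V -> C) :=
  continuous (@complex.Re R \o f) /\ continuous (@complex.Im R \o f).

Lemma ccont_cst (c : C) : ccont (fun=> c).
Proof. by split=> x; exact: cvg_cst. Qed.

Lemma ccontD (f g : V -> C) : ccont f -> ccont g -> ccont (fun x => f x + g x).
Proof.
move=> [f1 f2] [g1 g2]; split=> x.
  rewrite (_ : _ \o _ = fun y => complex.Re (f y) + complex.Re (g y)); last first.
    by apply/funext => y; rewrite /= cReD.
  by apply: cvgD; [exact: f1|exact: g1].
rewrite (_ : _ \o _ = fun y => complex.Im (f y) + complex.Im (g y)); last first.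
  by apply/funext => y; rewrite /= cImD.
by apply: cvgD; [exact: f2|exact: g2].
Qed.

Lemma ccontM (f g : V -> C) : ccont f -> ccont g -> ccont (fun x => f x * g x).
Proof.
move=> [f1 f2] [g1 g2]; split=> x.
  rewrite (_ : _ \o _ = fun y => complex.Re (f y) * complex.Re (g y) -
    complex.Im (f y) * complex.Im (g y)); last first.
    by apply/funext => y; rewrite /= cReM.
  by apply: cvgB; apply: cvgM; [exact: f1|exact: g1|exact: f2|exact: g2].
rewrite (_ : _ \o _ = fun y => complex.Re (f y) * complex.Im (g y) +
  complex.Im (f y) * complex.Re (g y)); last first.
  by apply/funext => y; rewrite /= cImM.
by apply: cvgD; apply: cvgM; [exact: f1|exact: g2|exact: f2|exact: g1].
Qed.

Lemma ccontJ (f : V -> C) : ccont f -> ccont (fun x => ((f x)^*)%C).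
Proof.
move=> [f1 f2]; split=> x.
  rewrite (_ : _ \o _ = @complex.Re R \o f); last first.
    by apply/funext => y; rewrite /= cReJ.
  exact: f1.
rewrite (_ : _ \o _ = fun y => - complex.Im (f y)); last first.
  by apply/funext => y; rewrite /= cImJ.
by apply: cvgN; exact: f2.
Qed.


Lemma ccont_real (h : V -> R) : continuous h -> ccont (fun x => (h x)%:C%C).
Proof. by move=> ch; split => //= x; exact: cvg_cst. Qed.

End ContinuousComplex.

Lemma continuous_tent (R : realType) (V : normedModType R) (x0 : V) (r : R) :
  continuous (fun x : V => Num.max 0 (r - `|x - x0|)).
Proof.
move=> x; apply: (@continuous_max R V (cst 0) (fun x => r - `|x - x0|)).
  exact: cst_continuous.
have h : (r - `|y - x0|) @[y --> x] --> r - `|x - x0|.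
  apply: cvgB; first exact: cvg_cst.
  apply: cvg_norm; apply: cvgB; first exact: cvg_id.
  exact: cvg_cst.
exact: h.
Qed.

(** * Row vectors as points of [R^d]: measurability, decay and growth *)

Section RowPoints.
Variables (R : realType) (m : nat).
Local Notation RT := (measurableTypeR R).
Local Notation T := (m.+1.-tuple RT).
Local Notation L := (lebesgue_Rn R m.+1).
Local Notation C := R[i].
Local Notation pt := 'rV[R]_m.+1.
Implicit Types (f : pt -> C).

Definition coords (x : pt) : T := [tuple x ord0 i | i < m.+1].

Lemma row_ofK : cancel (@row_of R m) coords.
Proof. by move=> t; apply: eq_from_tnth => i; rewrite tnth_mktuple mxE. Qed.


Lemma norm_coord_le (x : pt) i : `|x ord0 i| <= `|x|.
Proof.
have -> : `|x| = mx_norm x by [].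
rewrite mx_normrE.
exact: (le_bigmax _ (fun ij : 'I_1 * 'I_m.+1 => `|x ij.1 ij.2|) (ord0, i)).
Qed.

Lemma cvg_row_of (u : nat -> T) (t : T) :
  (forall i, (tnth (u n) i : R) @[n --> \oo] --> (tnth t i : R)) ->
  row_of (u n) @[n --> \oo] --> row_of t.
Proof.
move=> ut; apply/cvg_ballP => e e0.
have : \forall n \near \oo, forall i, ball (tnth t i : R) e (tnth (u n) i : R).
  by apply: filter_forall => i; exact: (cvg_ballP _ _).1 (ut i) _ e0.
by apply: filterS => n h; split => // i j; rewrite !mxE.
Qed.

Let grid (n : nat) (t : T) : T :=
  [tuple (Num.floor (n.+1%:R * (tnth t i : R)))%:~R / n.+1%:R | i < m.+1].

Let gridE n t : grid n t =
  [tuple (tnth [tuple Num.floor (n.+1%:R * (tnth t i : R)) | i < m.+1] i)%:~R / n.+1%:R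
  | i < m.+1].
Proof. by apply: eq_from_tnth => i; rewrite !tnth_mktuple. Qed.

(** This holds for an arbitrary [F]: the rounded point takes countably many values, indexed by
    integer tuples, each of them on a finite intersection of strips. *)
Let measurable_grid (F : T -> R) n : measurable_fun setT (F \o grid n).
Proof.
move=> _ Y mY; rewrite setTI.
pose G (q : m.+1.-tuple int) : T := [tuple (tnth q i)%:~R / n.+1%:R | i < m.+1].
have -> : (F \o grid n) @^-1` Y = \bigcup_(q in [set q | Y (F (G q))])
    \bigcap_(i in [set: 'I_m.+1])
      [set t : T | Num.floor (n.+1%:R * (tnth t i : R)) = tnth q i].
  apply/seteqP; split => [t|t [q Yq qt]] /=.
    rewrite gridE => Yt.
    exists [tuple Num.floor (n.+1%:R * (tnth t i : R)) | i < m.+1] => //.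
    by move=> i _ /=; rewrite tnth_mktuple.
  rewrite /= (_ : grid n t = G q)//; apply: eq_from_tnth => i.
  by rewrite !tnth_mktuple qt.
rewrite bigcup_mkcond; apply: countable_bigcupT_measurable => // q.
case: ifPn => // _; apply: fin_bigcap_measurable; first exact: finite_finset.
move=> i _.
have -> : [set t : T | Num.floor (n.+1%:R * (tnth t i : R)) = tnth q i] =
    (fun t : T => n.+1%:R * (tnth t i : R)) @^-1` `[(tnth q i)%:~R, (tnth q i + 1)%:~R[.
  apply/seteqP; split => t /=; rewrite in_itv/=.
    by move/eqP; rewrite floor_eq.
  by rewrite -floor_eq => /eqP.
rewrite -[X in measurable X]setTI.
have mh : measurable_fun setT (fun t : T => n.+1%:R * (tnth t i : R)).
  by apply: measurable_funM => //; exact: measurable_tnth.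
exact: mh.
Qed.

Let cvg_grid (t : T) : row_of (grid n t) @[n --> \oo] --> row_of t.
Proof.
apply: cvg_row_of => i.
under eq_fun do rewrite tnth_mktuple.
move: (tnth t i : R) => x.
apply: (@squeeze_cvgr _ _ _ _ (fun n => x - n.+1%:R^-1) (fun=> x)).
- apply: nearW => n; have n0 : 0 < n.+1%:R :> R by [].
  rewrite ler_pdivlMr// ler_pdivrMr// mulrBl mulVf ?gt_eqF// mulrC.
  have /andP[h1 h2] := floor_itv (n.+1%:R * x).
  rewrite h1 andbT lerBlDr -intrD1.
  exact: ltW.
- rewrite -[X in _ --> X]subr0; apply: cvgB; first exact: cvg_cst.
  exact: cvg_harmonic.
- exact: cvg_cst.
Qed.

(* ['rV_n] carries no measurable structure here, so the measurability of
   [h \o row_of] comes from approximation by functions of grid points. *)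
Lemma measurable_row_of (h : pt -> R) : continuous h ->
  measurable_fun setT (h \o @row_of R m).
Proof.
move=> ch; apply: (measurable_fun_cvg (h := fun n => (h \o @row_of R m) \o grid n)).
  by move=> n; exact: measurable_grid.
move=> t _.
have cc : h (row_of (grid n t)) @[n --> \oo] --> h (row_of t) :=
  (@cvg_comp _ _ _ (fun n => row_of (grid n t)) h _ _ _ (@cvg_grid t) (ch _)).
exact: cc.
Qed.

Lemma cmeas_row_of f : ccont f -> cmeas (f \o @row_of R m).
Proof. by move=> [c1 c2]; split; [exact: (measurable_row_of c1)|exact: (measurable_row_of c2)]. Qed.

Lemma tcont_row_of f : ccont f -> tcont (f \o @row_of R m).
Proof.
move=> [c1 c2] y u.
have cv : row_of (affine n.+1%:R^-1 y u) @[n --> \oo] --> row_of y.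
  apply: cvg_row_of => i.
  have -> : (fun n : nat => tnth (affine n.+1%:R^-1 y u) i : R) =
      (fun n => n.+1%:R^-1 * tnth u i + tnth y i).
    by apply/funext => n; rewrite tnth_mktuple.
  have : n.+1%:R^-1 * (tnth u i : R) + tnth y i @[n --> \oo] -->
      0 * (tnth u i : R) + tnth y i.
    apply: cvgD; last exact: cvg_cst.
    by apply: cvgM; [exact: cvg_harmonic|exact: cvg_cst].
  by rewrite mul0r add0r.
split.
  exact: (@cvg_comp _ _ _ (fun n => row_of (affine n.+1%:R^-1 y u)) (@complex.Re R \o f) _ _ _ cv (c1 _)).
exact: (@cvg_comp _ _ _ (fun n => row_of (affine n.+1%:R^-1 y u)) (@complex.Im R \o f) _ _ _ cv (c2 _)).
Qed.

(** Schwartz decay without derivatives. The class contains the tents as well as the test functions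
    and is stable under multiplication by symbols. *)
Definition rapid f := ccont f /\
  forall N, exists M : R, forall x, (1 + `|x|) ^+ N * cmod (f x) <= M.

(** Covers both the bounded symbols of order 0 and [asym], which grows linearly. *)
Definition slow f := ccont f /\
  exists (N : nat) (M : R), forall x, cmod (f x) <= M * (1 + `|x|) ^+ N.

Let base_ge1 (x : pt) : 1 <= 1 + `|x|. Proof. by rewrite lerDl. Qed.
Let base_ge0 (x : pt) N : 0 <= (1 + `|x|) ^+ N.
Proof. by rewrite exprn_ge0// addr_ge0. Qed.

Lemma slow_cst (c : C) : slow (fun=> c).
Proof.
split; first exact: ccont_cst.
by exists 0%N, (cmod c) => x; rewrite expr0 mulr1.
Qed.

Lemma slowM f g : slow f -> slow g -> slow (fun x => f x * g x).
Proof.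
move=> [cf [N [M fM]]] [cg [N' [M' gM]]]; split; first exact: ccontM.
exists (N + N')%N, (M * M') => x; rewrite cmodM exprD mulrACA.
by apply: ler_pM; rewrite ?cmod_ge0.
Qed.

Lemma slowD f g : slow f -> slow g -> slow (fun x => f x + g x).
Proof.
move=> [cf [N [M fM]]] [cg [N' [M' gM]]]; split; first exact: ccontD.
have M0 : 0 <= M by have := le_trans (cmod_ge0 _) (fM 0); rewrite normr0 addr0 expr1n mulr1.
have M'0 : 0 <= M' by have := le_trans (cmod_ge0 _) (gM 0); rewrite normr0 addr0 expr1n mulr1.
exists (N + N')%N, (M + M') => x; rewrite (le_trans (cmodD _ _))// mulrDl lerD//.
  by rewrite (le_trans (fM x))// ler_wpM2l// ler_weXn2l// leq_addr.
by rewrite (le_trans (gM x))// ler_wpM2l// ler_weXn2l// leq_addl.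
Qed.

Lemma slowJ f : slow f -> slow (fun x => ((f x)^*)%C).
Proof.
move=> [cf [N [M h]]]; split; first exact: ccontJ.
by exists N, M => x; rewrite cmodJ.
Qed.

Lemma slow_sum I (s : seq I) (F : I -> pt -> C) : (forall i, slow (F i)) ->
  slow (fun x => \sum_(i <- s) F i x).
Proof.
move=> rF; elim: s => [|i s ih].
  by under eq_fun do rewrite big_nil; exact: slow_cst.
by under eq_fun do rewrite big_cons; exact: slowD.
Qed.

Lemma rapid_slow f g : slow f -> rapid g -> rapid (fun x => f x * g x).
Proof.
move=> [cf [N [M fM]]] [cg gr]; split; first exact: ccontM.
move=> N'; have [M' gM] := gr (N + N')%N; exists (M * M') => x.
have M0 : 0 <= M by have := le_trans (cmod_ge0 _) (fM 0); rewrite normr0 addr0 expr1n mulr1.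
have e : (1 + `|x|) ^+ N' * cmod (f x * g x) <= M * ((1 + `|x|) ^+ (N + N') * cmod (g x)).
  rewrite cmodM exprD mulrCA.
  rewrite (_ : M * _ = (M * (1 + `|x|) ^+ N) * ((1 + `|x|) ^+ N' * cmod (g x))); last by ring.
  by rewrite ler_wpM2r ?fM// mulr_ge0 ?cmod_ge0.
by rewrite (le_trans e)// ler_wpM2l.
Qed.

Lemma rapidJ f : rapid f -> rapid (fun x => ((f x)^*)%C).
Proof.
move=> [cf fr]; split; first exact: ccontJ.
by move=> N; have [M h] := fr N; exists M => x; rewrite cmodJ.
Qed.

Lemma rapid0 : rapid (fun=> 0).
Proof.
split; first exact: ccont_cst.
by move=> N; exists 0 => x; rewrite cmod0 mulr0.
Qed.

Lemma rapidD f g : rapid f -> rapid g -> rapid (fun x => f x + g x).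
Proof.
move=> [cf fr] [cg gr]; split; first exact: ccontD.
move=> N; have [M h] := fr N; have [M' h'] := gr N; exists (M + M') => x.
rewrite (le_trans _ (lerD (h x) (h' x)))// -mulrDr ler_wpM2l ?cmodD//.
Qed.

Lemma rapid_sum I (s : seq I) (F : I -> pt -> C) : (forall i, rapid (F i)) ->
  rapid (fun x => \sum_(i <- s) F i x).
Proof.
move=> rF; elim: s => [|i s ih].
  by under eq_fun do rewrite big_nil; exact: rapid0.
by under eq_fun do rewrite big_cons; exact: rapidD.
Qed.

(** The norm is the maximum of the coordinates, so each [1 + x_i^2] is at most [(1 + |x|)^2]; hence
    two powers per coordinate. Decay of order [2 * m.+1] thus makes [poissonT] a common integrable
    majorant. *)
Lemma poissonT_decay (x : pt) : (1 + `|x|) ^- (2 * m.+1) <= poissonT (coords x).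
Proof.
have x1 : 0 < 1 + `|x| by rewrite ltr_pwDl.
rewrite exprM -[X in _ ^- X](card_ord m.+1) -exprVn -prodr_const.
apply: ler_prod => i _; rewrite invr_ge0 exprn_ge0 ?(ltW x1)//=.
rewrite tnth_mktuple /poissonk; set a := x ord0 i.
have a1 : 0 < 1 + a ^+ 2 by rewrite ltr_pwDl ?sqr_ge0.
rewrite (@le_trans _ _ (1 + a ^+ 2)^-1)//; last first.
  by rewrite -[leLHS]mul1r ler_wpM2r ?invr_ge0 ?(ltW a1)// ler1n.
rewrite lef_pV2 ?posrE ?exprn_gt0//.
have ax : a ^+ 2 <= `|x| ^+ 2
  by rewrite -(real_normK (num_real a)) ler_pXn2r ?nnegrE// norm_coord_le.
have := normr_ge0 x; move: (`|x|) ax => b; nra.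
Qed.

Lemma cint_decay f (M : R) : ccont f ->
  (forall x, (1 + `|x|) ^+ (2 * m.+1) * cmod (f x) <= M) ->
  [/\ cint L (f \o @row_of R m), forall t : T, cmod (f (row_of t)) <= M * poissonT t &
    forall x, cmod (f x) <= M].
Proof.
move=> cf fM.
have M0 : 0 <= M by rewrite (le_trans _ (fM 0))// mulr_ge0 ?cmod_ge0// exprn_ge0// addr_ge0.
have b (t : T) : cmod (f (row_of t)) <= M * poissonT t.
  have x1 : 0 < (1 + `|row_of t|) ^+ (2 * m.+1) by rewrite exprn_gt0// ltr_pwDl.
  have h := fM (row_of t); rewrite mulrC -ler_pdivlMr// in h.
  rewrite (le_trans h)// ler_wpM2l// -[in leRHS](row_ofK t).
  exact: poissonT_decay.
split => //.
  apply: (cint_le (g := fun t => M * poissonT t)) => //; first exact: cmeas_row_of.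
  rewrite (_ : _ \o _ = fun x => (M%:E * (EFin \o @poissonT R m.+1) x)%E); last first.
    by apply/funext => x /=; rewrite EFinM.
  by apply: integrableZl => //; exact: integrable_poissonT.
move=> x; rewrite (le_trans _ (fM x))// ler_peMl ?cmod_ge0// exprn_ege1//.
Qed.

Lemma rapid_tame f : rapid f -> tame (f \o @row_of R m).
Proof.
move=> [cf fr]; have [M fM] := fr (2 * m.+1)%N.
have [fi _ fb] := cint_decay cf fM; split => //.
  by exists M => t; exact: fb.
exact: tcont_row_of.
Qed.

Lemma schwartz_rapid f : schwartz f -> rapid f.
Proof.
move=> [sf fb]; split.
  have [[c1 _] [c2 _]] := sf 0%N.
  by split=> x; [exact: c1|exact: c2].
by move=> N; have [M h] := fb N; exists M => x; exact: (h [::] x isT).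
Qed.

Definition tent (x0 : pt) (r : R) (x : pt) : R := Num.max 0 (r - `|x - x0|).

Lemma rapid_tent (x0 : pt) (r : R) : rapid (fun x => (tent x0 r x)%:C%C).
Proof.
split; first by apply: ccont_real; exact: (@continuous_tent R pt).
(* Where the tent is nonzero, [|x| <= |x0| + |r|], and its height is at most [|r|]; the absolute
   values cover any sign of [r]. *)
move=> N; exists ((1 + (`|x0| + `|r|)) ^+ N * `|r|) => x.
rewrite cmod_real /tent.
have [h|h] := leP (r - `|x - x0|) 0.
  by rewrite normr0 mulr0 mulr_ge0// exprn_ge0// addr_ge0// addr_ge0.
rewrite (ger0_norm (ltW h)); apply: ler_pM => //.
- exact: ltW.
- rewrite lerXn2r ?nnegrE ?addr_ge0// lerD2l.
  rewrite -[x in leLHS](subrK x0) (le_trans (ler_normD _ _))// addrC lerD2l.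
  by rewrite (le_trans _ (ler_norm _))// ltW// -subr_gt0.
- by rewrite (le_trans _ (ler_norm _))// gerBl.
Qed.

End RowPoints.

(** * Wave packets and the action of symbols on them *)

Section WavePackets.
Variables (R : realType) (m : nat).
Local Notation RT := (measurableTypeR R).
Local Notation T := (m.+1.-tuple RT).
Local Notation L := (lebesgue_Rn R m.+1).
Local Notation C := R[i].
Local Notation pt := 'rV[R]_m.+1.
Local Notation freq := (Defs.freq R m).
Variable g : R.

(** [F] is the amplitude on the frequency side. The weight compensates the conjugation by [exp(g t)]
    in [Op_gamma], so that symbols act on packets by multiplying amplitudes. *)
Definition packet N (F : 'I_N -> pt -> C) : pt -> 'cV[C]_N := fun x =>
  \col_k ((weight g x)%:C%C * ift (F k \o @row_of R m) (coords x)).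

Definition packetd N (F : 'I_N -> pt -> C) : vdist R m N := fun k phi =>
  intC (fun x => packet F x k ord0 * phi x).

Lemma weightN (x : pt) : weight (- g) x * weight g x = 1.
Proof. by rewrite /weight -expRD mulNr addNr expR0. Qed.

Lemma fourier_row_of (phi : pt -> C) (t : T) :
  fourier phi (row_of t) = ft (phi \o @row_of R m) t.
Proof.
apply: eq_intc => s /=; rewrite cisN; congr (((_ +i* _)^*)%C * _).
  by congr cos; apply: eq_bigr => i _; rewrite !mxE.
by congr sin; apply: eq_bigr => i _; rewrite !mxE.
Qed.

Lemma unweight_packetd N (F : 'I_N -> pt -> C) k phi :
  unweight g (packetd F k) phi =
  intc L (fun t => ift (F k \o @row_of R m) t * phi (row_of t)).
Proof.
apply: eq_intc => t; rewrite /= mxE row_ofK.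
rewrite mulrCA !mulrA -rmorphM/= weightN mul1r; ring.
Qed.

Let cint_ift_rapid f phi : rapid f -> rapid phi ->
  cint L (fun t => ift (f \o @row_of R m) t * phi (row_of t)).
Proof.
move=> rf rphi; have [fi _ _] := rapid_tame rf; have [pi _ _] := rapid_tame rphi.
apply: (cint_Mbounded (B := 2 * \int[L]_y cmod ((f \o @row_of R m) y))) => //.
  by apply: cmeas_ift; case: fi.
by move=> t; exact: cmod_ift_le.
Qed.

Lemma tempered_packetd N (F : 'I_N -> pt -> C) :
  (forall k, rapid (F k)) -> tempered_g g (packetd F).
Proof.
move=> rF k; have [fi _ _] := rapid_tame (rF k).
split.
  move=> c phi psi sphi spsi; rewrite !unweight_packetd.
  have i1 := cint_ift_rapid (rF k) (schwartz_rapid sphi).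
  have i2 := cint_ift_rapid (rF k) (schwartz_rapid spsi).
  rewrite -(intcZ c i1) -intcD//; last exact: cintZ.
  by apply: eq_intc => t; ring.
pose B := 2 * \int[L]_y cmod ((F k \o @row_of R m) y).
(* The seminorm of order [2 * m.+1] gives [|phi| <= M * poissonT], [B] bounds the inverse transform,
   and 2 is the constant of [cmod_intc]. *)
exists (2 * m.+1)%N, (2 * (B * massT R m.+1)) => phi M sphi bM.
rewrite unweight_packetd.
have i1 := cint_ift_rapid (rF k) (schwartz_rapid sphi).
have [|_ pM _] := @cint_decay R m phi M (schwartz_rapid sphi).1.
  by move=> x; exact: (bM [::] x isT).
have B0 : 0 <= B by rewrite mulr_ge0// Rintegral_ge0// => y _; exact: cmod_ge0.
rewrite (le_trans (cmod_intc i1))// -mulrA ler_wpM2l//.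
rewrite -Rintegral_poissonT mulrAC -RintegralZl//; last exact: integrable_poissonT.
apply: le_Rintegral => //; first by case: i1.
- rewrite (_ : _ \o _ = fun x => ((B * M)%:E * (EFin \o @poissonT R m.+1) x)%E); last first.
    by apply/funext => x /=; rewrite EFinM.
  by apply: integrableZl => //; exact: integrable_poissonT.
- move=> t _; rewrite cmodM -mulrA; apply: ler_pM; rewrite ?cmod_ge0//.
  exact: cmod_ift_le.
Qed.

Let measurable_weight c : measurable_fun setT (fun t : T => weight c (row_of t)).
Proof.
apply: (measurableT_comp (f := @expR R)).
  by apply: continuous_measurable_fun; exact: continuous_expR.
apply: measurable_funM => //.
rewrite (_ : (fun _ => _) = (fun t : T => tnth t ord0 : R)).
  exact: measurable_tnth.
by apply/funext => t; rewrite mxE.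
Qed.

Lemma sqnormE N (v : 'cV[C]_N) : sqnorm v = \sum_k cmod (v k ord0) ^+ 2.
Proof. by rewrite /sqnorm /hdot cRe_sum; apply: eq_bigr => k _; rewrite cRe_mulJ. Qed.

Lemma weight2 (x : pt) : weight (- (2 * g)) x * weight g x * weight g x = 1.
Proof. by rewrite /weight -!expRD -[RHS]expR0; congr expR; ring. Qed.

Lemma is_L2_packet N (F : 'I_N -> pt -> C) :
  (forall k, rapid (F k)) -> is_L2 g (packetd F) (packet F).
Proof.
move=> rF; split; last first.
  move=> phi sphi k; rewrite /unweight /dmul.
  by apply: eq_intc => t /=; ring.
split.
  move=> k.
  have [mR mI] : cmeas (fun t : T => packet F (row_of t) k ord0).
    rewrite (_ : (fun _ => _) = (fun t : T => (weight g (row_of t))%:C%C *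
       ift (F k \o @row_of R m) t)); last first.
      by apply/funext => t; rewrite mxE row_ofK.
    apply: cmeasM; first exact: cmeas_real.
    by apply: cmeas_ift; apply: cmeas_row_of; case: (rF k).
  by split.
rewrite (_ : (fun x => _) = (fun x =>
   \sum_(k <- index_enum 'I_N) (cmod (ift (F k \o @row_of R m) x) ^+ 2)%:E)%E); last first.
  apply/funext => t; rewrite sqnormE sumEFin; congr EFin.
  rewrite mulr_sumr; apply: eq_bigr => k _.
  rewrite mxE row_ofK cmodM cmod_real ger0_norm ?expR_ge0// exprMn mulrA.
  by rewrite (expr2 (weight g _)) mulrA weight2 mul1r.
have ii : L.-integrable setT (fun x =>
   \sum_(k <- index_enum 'I_N) (cmod (ift (F k \o @row_of R m) x) ^+ 2)%:E)%E.
  apply: integrable_sum => // k _; apply: ift_L2; exact: rapid_tame.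
have mm := measurable_int _ ii.
move/integrableP : ii => [_]; apply: le_lt_trans.
apply: ge0_le_integral => //.
- by move=> x _; apply: sume_ge0 => k _; rewrite lee_fin exprn_ge0// cmod_ge0.
- exact: measurableT_comp mm.
- by move=> x _; exact: lee_abs.
Qed.

Definition matvec M N (s : freq -> 'M[C]_(M, N)) (F : 'I_N -> pt -> C) :
    'I_M -> pt -> C :=
  fun k x => \sum_l s (x, g) k l * F l x.

Lemma rapid_matvec M N (s : freq -> 'M[C]_(M, N)) (F : 'I_N -> pt -> C) :
  (forall k l, slow (fun x => s (x, g) k l)) -> (forall l, rapid (F l)) ->
  forall k, rapid (matvec s F k).
Proof. by move=> ss rF k; apply: rapid_sum => l; exact: rapid_slow. Qed.

(** [parseval] is used twice: once to pass to an integral over frequencies, where the symbol moves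
    from the amplitude to the test function, and once to come back. The product of a symbol entry
    and [phi] is treated only as a [rapid] function. *)
Lemma is_Op_packet M N (s : freq -> 'M[C]_(M, N)) (F : 'I_N -> pt -> C) :
  (forall k l, slow (fun x => s (x, g) k l)) -> (forall l, rapid (F l)) ->
  is_Op g s (packetd F) (packetd (matvec s F)).
Proof.
move=> ss rF phi sphi k; have rphi := schwartz_rapid sphi.
have rs l : rapid (fun x => s (x, g) k l * phi x) by exact: rapid_slow.
have rsF l : rapid (fun x => s (x, g) k l * F l x) by exact: rapid_slow.
have tphi := rapid_tame rphi.
have [prsF prs] : rapid (matvec s F k) /\ forall l, tame ((fun x => s (x, g) k l * phi x) \o @row_of R m).
  by split; [exact: rapid_matvec|move=> l; exact: rapid_tame].
pose c : C := (massT R m.+1)%:C%C.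
have PE (f psi : pt -> C) : rapid f -> rapid psi ->
    intc L (fun t => ift (f \o @row_of R m) t * ft (psi \o @row_of R m) t) =
    c * intc L (fun t => f (row_of t) * psi (row_of t)).
  by move=> rf rpsi; rewrite (parseval (rapid_tame rf) (rapid_tame rpsi)).
transitivity (c * intc L (fun t => matvec s F k (row_of t) * phi (row_of t))).
  rewrite -(PE _ _ prsF rphi) unweight_packetd.
  by congr (intc _ _); apply/funext => t; rewrite fourier_row_of.
transitivity (c * intc L (fun t => \sum_l F l (row_of t) * (s (row_of t, g) k l * phi (row_of t)))).
  congr (_ * _); apply: eq_intc => t; rewrite mulr_suml.
  by apply: eq_bigr => l _; ring.
rewrite intc_sum; last first.
  move=> l; have [i1 _ _] := rapid_tame (rapid_slow (ss k l) rphi).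
  have [i2 [B fB] _] := rapid_tame (rF l).
  apply: (cint_Mbounded (B := B) _ fB) => //; by case: i2.
rewrite mulr_sumr; apply: eq_bigr => l _.
rewrite -(PE _ _ (rF l) (rs l)) unweight_packetd.
by congr (intc _ _); apply/funext => t; rewrite fourier_row_of.
Qed.

Lemma Op_L2_packet M N (s : freq -> 'M[C]_(M, N)) (F : 'I_N -> pt -> C) :
  (forall k l, slow (fun x => s (x, g) k l)) -> (forall l, rapid (F l)) ->
  Op_L2 g s (packetd F) (packet (matvec s F)).
Proof.
move=> ss rF; exists (packetd (matvec s F)); split.
- by apply: tempered_packetd; exact: rapid_matvec.
- exact: is_Op_packet.
- by apply: is_L2_packet; exact: rapid_matvec.
Qed.

(** The weight of the inner product cancels the two factors [exp(g t)], and conjugation turns the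
    second [ift] into an [ft], the form that [parseval] accepts. *)
Lemma ipg_packet N (F G : 'I_N -> pt -> C) :
  (forall k, rapid (F k)) -> (forall k, rapid (G k)) ->
  ipg g (packet F) (packet G) =
  (massT R m.+1)%:C%C * intc L (fun t => \sum_k F k (row_of t) * ((G k (row_of t))^*)%C).
Proof.
move=> rF rG.
have tJ k : tame ((fun x => ((G k x)^*)%C) \o @row_of R m) by apply: rapid_tame; exact: rapidJ.
transitivity (intc L (fun t => \sum_k (ift (F k \o @row_of R m) t *
    ft ((fun x => ((G k x)^*)%C) \o @row_of R m) t))).
  apply: eq_intc => t; rewrite /= /hdot mulr_sumr; apply: eq_bigr => k _.
  rewrite !mxE row_ofK conjcMl.
  rewrite -ftJ; last by have [] := rapid_tame (rG k).
  have -> : (((weight g (row_of t))%:C)^*)%C = ((weight g (row_of t))%:C)%C :> C.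
    by apply: complex_ext; rewrite ?cReJ ?cImJ//= oppr0.
  set W := (weight (- (2 * g)) _)%:C%C; set w := (weight g _)%:C%C.
  have e : W * w * w = 1 by rewrite /W /w -!rmorphM/= weight2.
  set a := ift _ _; set b := ft _ _.
  rewrite -[RHS]mul1r -e; ring.
rewrite intc_sum; last first.
  by move=> k; apply: cint_ift_ft => //; exact: rapid_tame.
rewrite intc_sum; last first.
  move=> k; have [i1 [B fB] _] := rapid_tame (rF k); have [i2 _ _] := tJ k.
  apply: (cint_Mbounded (B := B) _ fB) => //; by case: i1.
rewrite mulr_sumr; apply: eq_bigr => k _.
by rewrite (parseval (rapid_tame (rF k)) (tJ k)).
Qed.

End WavePackets.

(** * Continuity of symbols up to the boundary *)

Section WithinContinuity.
Variable R : realType.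
Local Notation C := R[i].

(** Meant for [h y = (y, g)] with [g > 0]: the image lies in [Xi], so continuity relative to [Xi]
    becomes ordinary continuity in [y]. *)
Lemma within_continuous_pullback (V W U : topologicalType) (A : set V) (f : V -> U)
    (h : W -> V) (w : W) : {within A, continuous f} -> {for w, continuous h} ->
  (forall y, A (h y)) -> {for w, continuous (f \o h)}.
Proof.
move=> /subspace_continuousP cf ch Ah.
apply: (@cvg_comp _ _ _ h f _ (within A (nbhs (h w)))); last exact: cf.
move=> P hP; have h1 : nbhs w (h @^-1` [set y | A y -> P y]) by exact: ch.
by apply: filterS h1 => y hy; exact: hy (Ah y).
Qed.

Lemma pair_continuous (V W : topologicalType) (c : W) (x : V) :
  {for x, continuous (fun y : V => (y, c))}.
Proof. by apply: cvg_pair; [exact: cvg_id|exact: cvg_cst]. Qed.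

Let cvg_within_extension (V : topologicalType) (A U : set V) (f h : V -> R) (x : V) :
  open U -> U x -> A x -> {for x, continuous h} ->
  (forall y, U y -> A y -> f y = h y) -> f @ within A (nbhs x) --> f x.
Proof.
move=> oU Ux Ax ch fh P; rewrite (fh x Ux Ax) => hP.
have h1 : nbhs x (h @^-1` P) by exact: ch.
have h2 : nbhs x U by exact: open_nbhs_nbhs.
have h3 : nbhs x (fun y => A y -> P (f y)).
  by apply: filterS2 h1 h2 => y Py Uy Ay; rewrite fh.
exact: h3.
Qed.

Lemma smooth_on_continuous (V : normedModType R) (A : set V) (f : V -> C) :
  smooth_on A f ->
  {within A, continuous (@complex.Re R \o f)} /\
  {within A, continuous (@complex.Im R \o f)}.
Proof.
move=> sf; split; apply/subspace_continuousP => x Ax;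
  have [U [h [oU Ux sh fh]]] := sf x Ax.
- have c : {for x, continuous (ReF h)} by have [[c _] _] := sh 0%N; exact: c.
  apply: (@cvg_within_extension V A U (@complex.Re R \o f) (ReF h) x oU Ux Ax c).
  by move=> y Uy Ay; rewrite /= fh.
- have c : {for x, continuous (ImF h)} by have [_ [c _]] := sh 0%N; exact: c.
  apply: (@cvg_within_extension V A U (@complex.Im R \o f) (ImF h) x oU Ux Ax c).
  by move=> y Uy Ay; rewrite /= fh.
Qed.

End WithinContinuity.

(** * Growth of symbols at fixed [gamma] *)

Section SymbolGrowth.
Variables (R : realType) (m : nat).
Local Notation C := R[i].
Local Notation pt := 'rV[R]_m.+1.
Local Notation freq := (Defs.freq R m).

Lemma freq_normE (z : freq) : `|z| = Num.max `|z.1| `|z.2|.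
Proof. by []. Qed.

(** The norm of a pair is a maximum, so this is the unit half-sphere for that norm. It is compact
    and meets every ray of [Xi]. *)
Let shell : set freq :=
  ([set x : pt | `|x| <= 1] `*` `[0, 1]) `&` [set z : freq | 1 <= `|z|].

Let compact_shell : compact shell.
Proof.
apply: compact_closedI; last first.
  apply: (@closed_comp _ _ (fun z : freq => `|z|) [set x : R | 1 <= x]).
    by move=> z _; exact: norm_continuous.
  exact: closed_ge.
apply: compact_setX; last exact: segment_compact.
apply: bounded_closed_compact.
  exists 1; split => // M M1 x /= x1; exact: le_trans x1 (ltW M1).
apply: (@closed_comp _ _ (fun x : pt => `|x|) [set x : R | x <= 1]).
  by move=> z _; exact: norm_continuous.
exact: closed_le.
Qed.

Let shell_Xi z : shell z -> Xi z.
Proof.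
move=> [[_ /=]]; rewrite in_itv/= => /andP[z2 _] z1; split => //.
by apply: contraTneq z1 => ->; rewrite normr0 ler10.
Qed.

Lemma Xi_gt0 (x : pt) (g : R) : 0 < g -> Xi (x, g).
Proof.
move=> g0; split; last exact: ltW.
by apply/eqP => -[_ /eqP]; rewrite gt_eqF.
Qed.

Lemma homogeneous_bounded (f : freq -> R) : {within Xi, continuous f} ->
  homogeneous0 Xi f -> exists M, forall x g, 0 < g -> `|f (x, g)| <= M.
Proof.
move=> cf hf.
have cs : {within shell, continuous f}.
  apply: continuous_subspaceW cf => z; exact: shell_Xi.
have [M [_ HM]] := compact_bounded (continuous_compact cs compact_shell).
(* [compact_bounded] guarantees the bound for every constant strictly above [M], hence the choice
   [M + 1]. *)
exists (M + 1) => x g g0.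
set s := `|(x, g) : freq|.
have s0 : 0 < s by rewrite normr_gt0; case: (Xi_gt0 x g0).
have e : (x, g) = s *: (s^-1 *: ((x, g) : freq)).
  by rewrite scalerA mulfV ?gt_eqF// scale1r.
have sh : shell (s^-1 *: ((x, g) : freq)).
  have n1 : `|s^-1 *: ((x, g) : freq)| = 1.
    by rewrite normrZ ger0_norm ?invr_ge0 ?ltW// mulVf ?gt_eqF.
  split; last by rewrite /= n1.
  have := n1; rewrite freq_normE => nn.
  have [a b] : `|(s^-1 *: ((x, g) : freq)).1| <= 1 /\ `|(s^-1 *: ((x, g) : freq)).2| <= 1.
    by rewrite -nn !le_max !lexx orbT.
  split => //=; rewrite in_itv/=; apply/andP; split.
    by rewrite mulr_ge0 ?invr_ge0 ?ltW.
  exact: le_trans (ler_norm _) b.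
rewrite e hf//; last exact: shell_Xi.
apply: (HM (M + 1)); first by rewrite ltrDl.
by exists (s^-1 *: ((x, g) : freq)).
Qed.

Lemma slow_symbol0 M N (s : freq -> 'M[C]_(M, N)) (g : R) : 0 < g -> symbol0 s ->
  forall k l, slow (fun x => s (x, g) k l).
Proof.
move=> g0 [ss hs] k l; have [cR cI] := smooth_on_continuous (ss k l).
have ci (x : pt) : {for x, continuous (fun y : pt => (y, g) : freq)}.
  exact: pair_continuous.
have AX (y : pt) : Xi ((y, g) : freq) by exact: Xi_gt0.
split.
  split=> x.
    have := (@within_continuous_pullback freq pt R Xi _ (fun y : pt => (y, g)) x cR (ci x) AX).
    exact.
  exact: (@within_continuous_pullback freq pt R Xi _ (fun y : pt => (y, g)) x cI (ci x) AX).
have [M1 h1] := homogeneous_bounded cR (fun z t Xz t0 => congr1 (fun A : 'M[C]_(M, N) => complex.Re (A k l)) (hs z t Xz t0)).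
have [M2 h2] := homogeneous_bounded cI (fun z t Xz t0 => congr1 (fun A : 'M[C]_(M, N) => complex.Im (A k l)) (hs z t Xz t0)).
exists 0%N, (M1 + M2) => x; rewrite expr0 mulr1 (le_trans (cmod_le _))//.
by rewrite lerD//; [exact: h1|exact: h2].
Qed.

Lemma slow_coord (i : 'I_m.+1) : slow (fun x : pt => (x ord0 i)%:C%C).
Proof.
split; first by apply: ccont_real; exact: coord_continuous.
exists 1%N, 1 => x; rewrite cmod_real mul1r expr1 (le_trans (norm_coord_le _ _))//.
by rewrite lerDr.
Qed.

Lemma slow_asym n (A : 'I_m.+1 -> 'M[C]_n) (g : R) k l :
  slow (fun x : pt => asym A (x, g) k l).
Proof.
rewrite (_ : (fun _ => _) = (fun x : pt => ((x ord0 ord0)%:C%C + (0 +i* - g)%C) * A ord0 k l +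
  \sum_(j < m) (x ord0 (lift ord0 j))%:C%C * A (lift ord0 j) k l)); last first.
  apply/funext => x; rewrite /asym !mxE summxE; congr (_ * _ + _).
    by apply: complex_ext; rewrite ?cReD ?cImD /= ?addr0 ?add0r.
  by apply: eq_bigr => j _; rewrite !mxE.
apply: slowD.
  apply: slowM; last exact: slow_cst.
  by apply: slowD; [exact: slow_coord|exact: slow_cst].
apply: slow_sum => j; apply: slowM; last exact: slow_cst.
exact: slow_coord.
Qed.

End SymbolGrowth.

(** * The Hermitian product of [C^N] *)

Section HermitianProduct.
Variables (R : realType) (N : nat).
Local Notation C := R[i].
Implicit Types (u v w : 'cV[C]_N) (c : C).

Lemma hdotDl u v w : hdot (u + v) w = hdot u w + hdot v w.
Proof.
by rewrite /hdot -big_split; apply: eq_bigr => k _; rewrite mxE mulrDl.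
Qed.

Lemma hdotZl c u w : hdot (c *: u) w = c * hdot u w.
Proof. by rewrite /hdot mulr_sumr; apply: eq_bigr => k _; rewrite mxE mulrA. Qed.

Lemma hdotDr u v w : hdot u (v + w) = hdot u v + hdot u w.
Proof.
by rewrite /hdot -big_split; apply: eq_bigr => k _; rewrite mxE conjcD mulrDr.
Qed.

Lemma hdotZr c u w : hdot u (c *: w) = (c^*)%C * hdot u w.
Proof.
by rewrite /hdot mulr_sumr; apply: eq_bigr => k _; rewrite mxE conjcMl mulrCA.
Qed.

Lemma hdot0l w : hdot 0 w = 0.
Proof. by rewrite -[X in hdot X](scale0r 0) hdotZl mul0r. Qed.

Lemma hdot0r u : hdot u 0 = 0.
Proof. by rewrite /hdot big1// => k _; rewrite mxE conjc0 mulr0. Qed.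

Lemma sqnorm_ge0 u : 0 <= sqnorm u.
Proof. by rewrite sqnormE sumr_ge0// => k _; rewrite exprn_ge0// cmod_ge0. Qed.

Lemma sqnorm_eq0 u : sqnorm u <= 0 -> u = 0.
Proof.
move=> u0; have {u0} : \sum_k cmod (u k ord0) ^+ 2 == 0.
  by rewrite -sqnormE eq_le u0 sqnorm_ge0.
rewrite psumr_eq0; last by move=> k _; rewrite exprn_ge0// cmod_ge0.
move/allP => h; apply/colP => k; rewrite mxE.
have := h k; rewrite mem_index_enum => /(_ isT); rewrite expf_eq0/= => /eqP.
exact: ComplexField.Normc.eq0_normc.
Qed.

Lemma hdot_sqnorm u : hdot u u = (sqnorm u)%:C%C.
Proof.
apply: complex_ext => //=.
by rewrite /hdot cIm_sum big1// => k _; rewrite cIm_mulJ.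
Qed.

End HermitianProduct.

(** * Localization at one frequency *)

Section Localization.
Variables (R : realType) (m : nat).
Local Notation RT := (measurableTypeR R).
Local Notation T := (m.+1.-tuple RT).
Local Notation L := (lebesgue_Rn R m.+1).
Local Notation mu := (@lebesgue_measure R).
Local Notation C := R[i].
Local Notation pt := 'rV[R]_m.+1.
Local Notation freq := (Defs.freq R m).

Lemma norm_le_coord (x : pt) (c : R) : 0 <= c -> (forall i, `|x ord0 i| <= c) ->
  `|x| <= c.
Proof.
move=> c0 xc; have -> : `|x| = mx_norm x by [].
by rewrite mx_normrE; apply: bigmax_le => // -[i j] _ /=; rewrite ord1.
Qed.

Lemma rapid_is_slow (f : pt -> C) : rapid f -> slow f.
Proof.
move=> [cf fr]; split => //; have [M h] := fr 0%N; exists 0%N, M => x.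
by have := h x; rewrite !expr0 mul1r mulr1.
Qed.

Section Point.
Variables (x0 : pt).

(** The tent is squared because both factors of an inner product of packets carry it. *)
Definition tent_integral (r : R) (f : pt -> C) : C :=
  intc L (fun t => (tent x0 r (row_of t) ^+ 2)%:C%C * f (row_of t)).

Lemma cint_tent r f : slow f ->
  cint L (fun t => (tent x0 r (row_of t) ^+ 2)%:C%C * f (row_of t)).
Proof.
move=> sf; have rb := rapid_tent x0 r.
have [+ _ _] := rapid_tame (rapid_slow sf (rapid_slow (rapid_is_slow rb) rb)).
congr (cint _ _); apply/funext => t /=.
by rewrite -rmorphM/= -expr2 mulrC.
Qed.

Lemma tent_integralD r f h : slow f -> slow h ->
  tent_integral r (fun x => f x + h x) = tent_integral r f + tent_integral r h.
Proof.
move=> sf sh; rewrite -[RHS](intcD (cint_tent r sf) (cint_tent r sh)).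
by apply: eq_intc => t; rewrite mulrDr.
Qed.

Lemma tent_integralZ r c f : slow f ->
  tent_integral r (fun x => c * f x) = c * tent_integral r f.
Proof.
move=> sf; rewrite -[RHS](intcZ c (cint_tent r sf)).
by apply: eq_intc => t; rewrite mulrCA.
Qed.

Lemma Re_tent_integral r f : complex.Re (tent_integral r f) =
  \int[L]_t (tent x0 r (row_of t) ^+ 2 * complex.Re (f (row_of t))).
Proof.
rewrite /tent_integral [LHS]/(\int[L]_t _).
by apply: eq_Rintegral => t _; rewrite cReM /= mul0r subr0.
Qed.

Let box r (i : 'I_m.+1) : set R := `[x0 ord0 i - r / 2, x0 ord0 i + r / 2].

Let integral_box r i : 0 < r ->
  cint mu (fun x : R => (\1_(box r i) x)%:C%C) /\
  intc mu (fun x : R => (\1_(box r i) x)%:C%C) = r%:C%C.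
Proof.
move=> r0; have mb : measurable (box r i) by exact: measurable_itv.
have mub : mu (box r i) = r%:E.
  rewrite lebesgue_measure_itv/= lte_fin ifT; last by lra.
  by rewrite -EFinB; congr EFin; lra.
split.
  apply: (@cint_le _ (measurableTypeR R) R mu _ (\1_(box r i))).
  - by apply: cmeas_real; exact: measurable_indic.
  - exact: integrable_indic_itv.
  - by move=> x; rewrite cmod_real ger0_norm.
rewrite intc_real /Rintegral integral_indic// setIT.
by rewrite [X in fine X]mub.
Qed.

Lemma tent_mass_gt0 r : 0 < r -> 0 < \int[L]_t (tent x0 r (row_of t) ^+ 2).
Proof.
move=> r0.
have [pi pe] := @intc_prod R m.+1 (fun i x => (\1_(box r i) x)%:C%C)
  (fun i => (integral_box i r0).1).
pose P (t : T) : R := \prod_i \1_(box r i) (tnth t i).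
have PE : (fun t : T => \prod_i (\1_(box r i) (tnth t i))%:C%C) = (fun t => (P t)%:C%C : C).
  by apply/funext => t; rewrite prod_complex.
rewrite PE in pi pe.
have PI : \int[L]_t P t = r ^+ m.+1.
  have := congr1 (@complex.Re R) pe; rewrite intc_real/= => ->.
  under eq_bigr do rewrite (integral_box _ r0).2.
  by rewrite prod_complex prodr_const card_ord.
have PL := cint_Re pi.
have bL : L.-integrable setT (fun t => (tent x0 r (row_of t) ^+ 2)%:E).
  have := cint_Re (cint_tent r (slow_cst m 1)).
  by under eq_fun do rewrite mulr1.
(* On the cube of side [r] centred at [x0], which has volume [r ^+ m.+1], the tent is at least
   [r / 2]. *)
apply: (@lt_le_trans _ _ (\int[L]_t ((r / 2) ^+ 2 * P t))).
  rewrite RintegralZl// PI mulr_gt0// exprn_gt0// divr_gt0//.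
apply: le_Rintegral => //.
  rewrite (_ : _ \o _ = fun x => (((r / 2) ^+ 2)%:E * (P x)%:E)%E); last first.
    by apply/funext => x /=; rewrite EFinM.
  exact: integrableZl.
move=> t _.
have [/forallP tb|/forallPn[i ti]] := boolP [forall i, (tnth t i : R) \in box r i]; last first.
  rewrite /P (bigD1 i)//= indicE (negbTE ti) mul0r mulr0.
  by rewrite exprn_ge0// le_max lexx.
have -> : P t = 1.
  by rewrite /P big1// => i _; rewrite indicE tb.
rewrite mulr1 lerXn2r ?nnegrE ?divr_ge0 ?(ltW r0)//.
  by rewrite /tent le_max lexx.
rewrite /tent le_max; apply/orP; right.
have : `|row_of t - x0| <= r / 2.
  apply: norm_le_coord => [|i]; first by rewrite divr_ge0// ltW.
  rewrite !mxE; have := tb i; rewrite inE /box/= in_itv/= => /andP[h1 h2].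
  rewrite ler_norml; lra.
lra.
Qed.

(** No limit of normalized averages is taken: if [Re f] were negative at [x0], continuity would give
    [Re f <= - e] on a ball, with [- e] half the value at [x0], and the single tent supported there
    would have a negative integral. *)
Lemma localize (f : pt -> C) : slow f ->
  (forall r, 0 < r -> 0 <= complex.Re (tent_integral r f)) ->
  0 <= complex.Re (f x0).
Proof.
move=> sf fr; rewrite leNgt; apply/negP => f0.
have [[cR _] _] := sf.
pose e := - complex.Re (f x0) / 2.
have e0 : 0 < e by rewrite /e; lra.
have /cvgrPdist_lt/(_ _ e0)/nbhs_ballP[r /= r0 hr] := cR x0.
have fe y : `|y - x0| < r -> complex.Re (f y) <= - e.
  move=> yr; have : ball x0 r y by rewrite mx_norm_ball/= distrC.
  move/hr => /=; rewrite ltr_norml => /andP[+ _]; rewrite /e; lra.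
have bL : L.-integrable setT (fun t => (tent x0 r (row_of t) ^+ 2)%:E).
  have := cint_Re (cint_tent r (slow_cst m 1)).
  by under eq_fun do rewrite mulr1.
have := fr r r0; rewrite Re_tent_integral; apply/negP; rewrite -ltNge.
apply: (@le_lt_trans _ _ (\int[L]_t (- e * (tent x0 r (row_of t) ^+ 2)))); last first.
  by rewrite RintegralZl// mulNr oppr_lt0 mulr_gt0// tent_mass_gt0.
apply: le_Rintegral => //.
- have := cint_Re (cint_tent r sf).
  by under eq_fun do rewrite cReM /= mul0r subr0.
- rewrite (_ : _ \o _ = fun t => ((- e)%:E * (tent x0 r (row_of t) ^+ 2)%:E)%E); last first.
    by apply/funext => x /=; rewrite EFinM.
  exact: integrableZl.
- move=> t _; rewrite mulrC.
  have [h|h] := ltP `|row_of t - x0| r.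
    by rewrite ler_wpM2r ?fe// exprn_ge0// le_max lexx.
  have -> : tent x0 r (row_of t) = 0.
    by rewrite /tent; apply: max_l; rewrite subr_le0.
  by rewrite expr0n/= !mulr0.
Qed.

End Point.
End Localization.

(* AM-GM: [2 a b <= s a^2 + b^2 / s]. *)
Lemma weighted_AMGM (R : realType) (M K s a b I1 Iu Iw : R) : 0 < M -> 0 < K -> 0 < s ->
  0 <= a -> 0 <= b -> a ^+ 2 = M * Iu -> b ^+ 2 = M * Iw -> M * I1 <= K * a * b ->
  0 <= K * s * Iu + (K / s * Iw - I1).
Proof.
move=> M0 K0 s0 a0 b0 a2 b2 h; rewrite -(pmulr_rge0 _ M0).
have -> : M * (K * s * Iu + (K / s * Iw - I1)) =
    K * (s * a ^+ 2 + s^-1 * b ^+ 2) - M * I1.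
  by rewrite a2 b2; field; rewrite gt_eqF.
rewrite subr_ge0 (le_trans h)// -mulrA ler_wpM2l ?(ltW K0)//.
have q : 0 <= s^-1 * (s * a - b) ^+ 2 by rewrite mulr_ge0 ?invr_ge0 ?(ltW s0)// sqr_ge0.
have e : s^-1 * (s * a - b) ^+ 2 = s * a ^+ 2 + s^-1 * b ^+ 2 - 2 * (a * b).
  by field; rewrite gt_eqF.
have ab : 0 <= a * b by exact: mulr_ge0.
lra.
Qed.


(** * Packets with tent amplitudes *)

Section LocalizedPackets.
Variables (R : realType) (m : nat).
Local Notation L := (lebesgue_Rn R m.+1).
Local Notation C := R[i].
Local Notation pt := 'rV[R]_m.+1.
Local Notation freq := (Defs.freq R m).
Variable x0 : pt.

(** The vector [a] depends on the frequency so that the class is stable under symbols: applying [s]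
    replaces [a] by [s a] exactly, with no error term. *)
Definition bumped N r (a : pt -> 'cV[C]_N) : 'I_N -> pt -> C :=
  fun l x => (tent x0 r x)%:C%C * a x l ord0.

Definition slowv N (a : pt -> 'cV[C]_N) := forall l, slow (fun x => a x l ord0).

Lemma slowv_cst N (v : 'cV[C]_N) : slowv (fun=> v).
Proof. by move=> l; exact: slow_cst. Qed.

Lemma slowv_mulmx M N g (s : freq -> 'M[C]_(M, N)) (a : pt -> 'cV[C]_N) :
  (forall k l, slow (fun x => s (x, g) k l)) -> slowv a ->
  slowv (fun x => s (x, g) *m a x).
Proof.
move=> ss sa k; under eq_fun do rewrite mxE.
by apply: slow_sum => l; exact: slowM.
Qed.

Lemma slow_hdot N (a b : pt -> 'cV[C]_N) : slowv a -> slowv b ->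
  slow (fun x => hdot (a x) (b x)).
Proof.
by move=> sa sb; apply: slow_sum => k; apply: slowM => //; exact: slowJ.
Qed.

Lemma rapid_bumped N r (a : pt -> 'cV[C]_N) : slowv a ->
  forall l, rapid (bumped r a l).
Proof.
move=> sa l; rewrite /bumped; under eq_fun do rewrite mulrC.
by apply: rapid_slow => //; exact: rapid_tent.
Qed.

Lemma matvec_bumped M N g r (s : freq -> 'M[C]_(M, N)) (a : pt -> 'cV[C]_N) :
  matvec g s (bumped r a) = bumped r (fun x => s (x, g) *m a x).
Proof.
apply/funext => k; apply/funext => x; rewrite /matvec /bumped mxE mulr_sumr.
by apply: eq_bigr => l _; rewrite mulrCA.
Qed.

Lemma ipg_bumped N g r (a b : pt -> 'cV[C]_N) : slowv a -> slowv b ->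
  ipg g (packet g (bumped r a)) (packet g (bumped r b)) =
  (massT R m.+1)%:C%C * tent_integral x0 r (fun x => hdot (a x) (b x)).
Proof.
move=> sa sb; rewrite ipg_packet; try exact: rapid_bumped.
congr (_ * _); apply: eq_intc => t; rewrite /hdot mulr_sumr.
apply: eq_bigr => k _; rewrite /bumped conjcMl.
have -> : ((tent x0 r (row_of t))%:C^*)%C = (tent x0 r (row_of t))%:C%C.
  by apply: complex_ext; rewrite ?cReJ ?cImJ//= oppr0.
by rewrite expr2 rmorphM/=; ring.
Qed.

Lemma normg_bumped N g r (a : pt -> 'cV[C]_N) : slowv a ->
  normg g (packet g (bumped r a)) ^+ 2 =
  massT R m.+1 * complex.Re (tent_integral x0 r (fun x => hdot (a x) (a x))).
Proof.
move=> sa; rewrite /normg ipg_bumped// cRe_realM sqr_sqrtr//.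
apply: mulr_ge0; first exact: ltW (massT_gt0 _ _).
rewrite Re_tent_integral Rintegral_ge0// => t _.
rewrite mulr_ge0 ?exprn_ge0 ?le_max ?lexx//; exact: sqnorm_ge0.
Qed.

Lemma Op_L2_bumped M N g r (s : freq -> 'M[C]_(M, N)) (a : pt -> 'cV[C]_N) :
  (forall k l, slow (fun x => s (x, g) k l)) -> slowv a ->
  Op_L2 g s (packetd g (bumped r a)) (packet g (bumped r (fun x => s (x, g) *m a x))).
Proof.
move=> ss sa; rewrite -matvec_bumped; apply: Op_L2_packet => //.
exact: rapid_bumped.
Qed.

Lemma is_Op_bumped M N g r (s : freq -> 'M[C]_(M, N)) (a : pt -> 'cV[C]_N) :
  (forall k l, slow (fun x => s (x, g) k l)) -> slowv a ->
  is_Op g s (packetd g (bumped r a)) (packetd g (bumped r (fun x => s (x, g) *m a x))).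
Proof.
move=> ss sa; rewrite -matvec_bumped; apply: is_Op_packet => //.
exact: rapid_bumped.
Qed.

End LocalizedPackets.

(** * Pointwise inequalities for the symbols at [gamma = 1] *)

Section SymbolInequalities.
Variables (R : realType) (m n : nat).
Local Notation C := R[i].
Local Notation pt := 'rV[R]_m.+1.
Local Notation freq := (Defs.freq R m).
Variables (A : 'I_m.+1 -> 'M[C]_n) (delta sigma : freq -> 'M[C]_n).
Hypotheses (sdelta : symbol0 delta) (ssigma : symbol0 sigma).

Let sD k l : slow (fun x : pt => delta (x, 1) k l) := slow_symbol0 ltr01 sdelta k l.
Let sS k l : slow (fun x : pt => sigma (x, 1) k l) := slow_symbol0 ltr01 ssigma k l.
Let sA k l : slow (fun x : pt => asym A (x, 1) k l) := slow_asym A 1 k l.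

Let L2D x0 r (a : pt -> 'cV[C]_n) : slowv a ->
  L2Delta delta 1 (packetd 1 (bumped x0 r a)).
Proof.
move=> sa; split; first by apply: tempered_packetd; exact: rapid_bumped.
exists (packet 1 (bumped x0 r (fun x => delta (x, 1) *m a x))).
exact: Op_L2_bumped.
Qed.

Let L2P x0 r (a : pt -> 'cV[C]_n) : slowv a ->
  is_L2 1 (packetd 1 (bumped x0 r a)) (packet 1 (bumped x0 r a)).
Proof. by move=> sa; apply: is_L2_packet; exact: rapid_bumped. Qed.

Let M0 : 0 < massT R m.+1 := massT_gt0 R m.+1.

(** [localize] only gives signs. It is applied to all complex multiples of the difference of the two
    sides, whose tent integrals vanish. *)
Lemma symbol_hermitian (x0 : pt) (u w : 'cV[C]_n) : sym_hermitian delta sigma ->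
  hdot (sigma (x0, 1) *m u) w = hdot u (sigma (x0, 1) *m w).
Proof.
move=> sym.
have su := slowv_cst m u; have sw := slowv_cst m w.
have sSu := slowv_mulmx sS su; have sSw := slowv_mulmx sS sw.
have e r : tent_integral x0 r (fun x => hdot (sigma (x, 1) *m u) w) =
    tent_integral x0 r (fun x => hdot u (sigma (x, 1) *m w)).
  have := sym 1 _ _ _ _ _ _ (lexx _) (L2D x0 r su) (L2D x0 r sw) (L2P x0 r su)
    (L2P x0 r sw) (Op_L2_bumped x0 r sS su) (Op_L2_bumped x0 r sS sw).
  rewrite !ipg_bumped// => /mulfI; apply.
  by apply/eqP => /(congr1 (@complex.Re R))/= h; move: M0; rewrite h ltxx.
have h1 := slow_hdot sSu sw; have h2 := slow_hdot su sSw.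
have z c : 0 <= complex.Re (c * (hdot (sigma (x0, 1) *m u) w + (-1) * hdot u (sigma (x0, 1) *m w))).
  apply: (localize (x0 := x0) (f := fun x => c * (hdot (sigma (x, 1) *m u) w +
      (-1) * hdot u (sigma (x, 1) *m w)))).
    apply: slowM; first exact: slow_cst.
    by apply: slowD => //; apply: slowM => //; exact: slow_cst.
  move=> r r0; rewrite tent_integralZ; last first.
    by apply: slowD => //; apply: slowM => //; exact: slow_cst.
  rewrite tent_integralD//; last by apply: slowM => //; exact: slow_cst.
  by rewrite tent_integralZ// e mulN1r subrr mulr0.
apply/eqP; rewrite -subr_eq0; apply/eqP.
set d := _ - _; have dE : d = hdot (sigma (x0, 1) *m u) w + (-1) * hdot u (sigma (x0, 1) *m w).
  by rewrite mulN1r.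
(* The multiplier [- conj d] makes the real part equal to [- |d|^2], which forces [d = 0]. *)
have := z (- (d^*)%C); rewrite -dE mulNr cReN mulrC cRe_mulJ.
rewrite oppr_ge0 => d0; apply: ComplexField.Normc.eq0_normc.
apply/eqP; rewrite -[_ == 0](@expf_eq0 _ _ 2) eq_le d0/=.
by rewrite exprn_ge0// cmod_ge0.
Qed.

(** The product of norms is linearized by [weighted_AMGM] while still integrated, and only then
    localized. [K] is chosen before [x0], which the passage to the boundary relies on. *)
Lemma symbol_bounded : sym_bounded delta sigma ->
  exists2 K : R, 0 < K & forall (x0 : pt) (u w : 'cV[C]_n) (s : R), 0 < s ->
    complex.Re (hdot (sigma (x0, 1) *m u) w) <=
    K * (s * sqnorm (delta (x0, 1) *m u) + s^-1 * sqnorm (delta (x0, 1) *m w)).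
Proof.
move=> [K K0 bd]; exists K => // x0 u w s s0.
have su := slowv_cst m u; have sw := slowv_cst m w.
have sSu := slowv_mulmx sS su.
have sDu := slowv_mulmx sD su; have sDw := slowv_mulmx sD sw.
have h1 := slow_hdot sSu sw; have h2 := slow_hdot sDu sDu; have h3 := slow_hdot sDw sDw.
have s1 : slow (fun x : pt => (K * s)%:C%C * hdot (delta (x, 1) *m u) (delta (x, 1) *m u)).
  by apply: slowM => //; exact: slow_cst.
have s2 : slow (fun x : pt => (K / s)%:C%C * hdot (delta (x, 1) *m w) (delta (x, 1) *m w)).
  by apply: slowM => //; exact: slow_cst.
have s3 : slow (fun x : pt => (-1) * hdot (sigma (x, 1) *m u) w).
  by apply: slowM => //; exact: slow_cst.
have key r : 0 < r -> 0 <= complex.Re (tent_integral x0 r (fun x =>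
    (K * s)%:C%C * hdot (delta (x, 1) *m u) (delta (x, 1) *m u) +
    ((K / s)%:C%C * hdot (delta (x, 1) *m w) (delta (x, 1) *m w) +
     (-1) * hdot (sigma (x, 1) *m u) w))).
  move=> r0; rewrite !tent_integralD//; last exact: slowD.
  rewrite !tent_integralZ// !cReD !cRe_realM mulN1r cReN.
  have := bd 1 _ _ _ _ _ _ (lexx _) (L2D x0 r su) (L2D x0 r sw)
    (Op_L2_bumped x0 r sS su) (L2P x0 r sw)
    (Op_L2_bumped x0 r sD su) (Op_L2_bumped x0 r sD sw).
  rewrite ipg_bumped// => /(le_trans (le_trans (ler_norm _) (Re_le_cmod _))).
  rewrite cRe_realM.
  have := normg_bumped x0 1 r sDu; have := normg_bumped x0 1 r sDw.
  move=> b2 a2 h.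
  exact: (weighted_AMGM M0 K0 s0 (sqrtr_ge0 _) (sqrtr_ge0 _) a2 b2 h).
have := localize (slowD s1 (slowD s2 s3)) key.
rewrite !cReD !cRe_realM mulN1r cReN !hdot_sqnorm => h; rewrite mulrDr -subr_ge0 !mulrA; lra.
Qed.

Lemma symbol_positive (x0 : pt) (u : 'cV[C]_n) : sym_positive A delta sigma ->
  0 <= complex.Im (hdot (sigma (x0, 1) *m (asym A (x0, 1) *m u)) u).
Proof.
move=> [c c0 pos].
have su := slowv_cst m u.
have sAu := slowv_mulmx sA su; have sSAu := slowv_mulmx sS sAu.
have h1 := slow_hdot sSAu su.
(* An imaginary part is the real part after multiplication by [- i], which is what [localize] can
   handle. *)
have -> : complex.Im (hdot (sigma (x0, 1) *m (asym A (x0, 1) *m u)) u) =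
    complex.Re ((0 -i* 1)%C * hdot (sigma (x0, 1) *m (asym A (x0, 1) *m u)) u).
  by rewrite cReM /= mul0r sub0r mulN1r opprK.
apply: (localize (x0 := x0) (f := fun x => (0 -i* 1)%C *
  hdot (sigma (x, 1) *m (asym A (x, 1) *m u)) u)).
  by apply: slowM => //; exact: slow_cst.
move=> r r0; rewrite tent_integralZ// cReM /= mul0r sub0r mulN1r opprK.
have := pos 1 _ _ _ _ _ (lexx _) (L2D x0 r su) (L2P x0 r su)
  (tempered_packetd _ (rapid_bumped x0 r sAu)) (is_Op_bumped x0 r sA su)
  (Op_L2_bumped x0 r sS sAu) (Op_L2_bumped x0 r sD su).
rewrite ipg_bumped// cIm_realM => h.
rewrite -(pmulr_rge0 _ M0) (le_trans _ h)// mulr_ge0 ?exprn_ge0 ?sqrtr_ge0//.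
by rewrite mulr1 ltW.
Qed.

End SymbolInequalities.

(** * Limits of complex sequences and of matrices *)

Section ComplexLimits.
Variable R : realType.
Local Notation C := R[i].

Definition ccvg (u : nat -> C) (l : C) : Prop :=
  (fun N => complex.Re (u N)) @ \oo --> complex.Re l /\
  (fun N => complex.Im (u N)) @ \oo --> complex.Im l.

Definition mxcvg M N (s : nat -> 'M[C]_(M, N)) (l : 'M[C]_(M, N)) : Prop :=
  forall i j, ccvg (fun k => s k i j) (l i j).

Lemma ccvg_cst c : ccvg (fun=> c) c.
Proof. by split; exact: cvg_cst. Qed.

Lemma ccvgD u v a b : ccvg u a -> ccvg v b -> ccvg (fun k => u k + v k) (a + b).
Proof.
move=> [ur ui] [vr vi]; split.
  by under eq_fun do rewrite cReD; rewrite cReD; exact: cvgD.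
by under eq_fun do rewrite cImD; rewrite cImD; exact: cvgD.
Qed.

Lemma ccvgM u v a b : ccvg u a -> ccvg v b -> ccvg (fun k => u k * v k) (a * b).
Proof.
move=> [ur ui] [vr vi]; split.
  by under eq_fun do rewrite cReM; rewrite cReM; apply: cvgB; exact: cvgM.
by under eq_fun do rewrite cImM; rewrite cImM; apply: cvgD; exact: cvgM.
Qed.

Lemma ccvgJ u a : ccvg u a -> ccvg (fun k => ((u k)^*)%C) (a^*)%C.
Proof.
move=> [ur ui]; split.
  by under eq_fun do rewrite cReJ; rewrite cReJ.
by under eq_fun do rewrite cImJ; rewrite cImJ; exact: cvgN.
Qed.

Lemma ccvg_sum N (u : 'I_N -> nat -> C) (a : 'I_N -> C) :
  (forall i, ccvg (u i) (a i)) -> ccvg (fun k => \sum_i u i k) (\sum_i a i).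
Proof.
move=> h; elim: N u a h => [|N IH] u a h.
  by under eq_fun do rewrite big_ord0; rewrite big_ord0; exact: ccvg_cst.
under eq_fun do rewrite big_ord_recl; rewrite big_ord_recl.
by apply: ccvgD => //; exact: IH.
Qed.

Lemma mxcvg_cst M N (l : 'M[C]_(M, N)) : mxcvg (fun=> l) l.
Proof. by move=> i j; exact: ccvg_cst. Qed.

Lemma mxcvg_mul M N P (s : nat -> 'M[C]_(M, N)) (t : nat -> 'M[C]_(N, P)) l k :
  mxcvg s l -> mxcvg t k -> mxcvg (fun x => s x *m t x) (l *m k).
Proof.
move=> sl tk i j; under eq_fun do rewrite mxE.
by rewrite mxE; apply: ccvg_sum => a; exact: ccvgM.
Qed.

Lemma ccvg_hdot N (s t : nat -> 'cV[C]_N) l k :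
  mxcvg s l -> mxcvg t k -> ccvg (fun x => hdot (s x) (t x)) (hdot l k).
Proof.
by move=> sl tk; apply: ccvg_sum => a; apply: ccvgM => //; exact: ccvgJ.
Qed.

End ComplexLimits.

(** * Passage to the boundary [gamma = 0] *)

Section BoundaryLimits.
Variables (R : realType) (m n : nat).
Local Notation C := R[i].
Local Notation freq := (Defs.freq R m).

Definition approach (z : freq) (N : nat) : freq := (z.1, N.+1%:R^-1).

Lemma approach_gt0 z N : 0 < (approach z N).2.
Proof. by rewrite /= invr_gt0. Qed.

Lemma approach_cvg z : z.2 = 0 -> approach z @ \oo --> z.
Proof.
case: z => x g /= ->.
have c1 : (fun _ : nat => x) @ \oo --> x by exact: cvg_cst.
exact: cvg_pair c1 (@cvg_harmonic R).
Qed.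

Lemma within_cvg_approach (f : freq -> R) z : {within Xi, continuous f} ->
  Xi z -> z.2 = 0 -> (fun N => f (approach z N)) @ \oo --> f z.
Proof.
move=> /subspace_continuousP cf Xz z0.
apply: (@cvg_comp _ _ _ (approach z) f _ (within Xi (nbhs z))); last exact: cf.
move=> P hP.
have h : \forall N \near \oo, Xi (approach z N) -> P (approach z N).
  exact: (@approach_cvg z z0 (fun y => Xi y -> P y) hP).
by apply: filterS h => N; apply; apply: Xi_gt0; exact: approach_gt0 z N.
Qed.

Lemma mxcvg_symbol0 M N (s : freq -> 'M[C]_(M, N)) z : symbol0 s -> Xi z ->
  z.2 = 0 -> mxcvg (fun k => s (approach z k)) (s z).
Proof.
move=> [ss _] Xz z0 i j; have [cR cI] := smooth_on_continuous (ss i j).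
by split; [exact: (within_cvg_approach cR)|exact: (within_cvg_approach cI)].
Qed.

Lemma mxcvg_asym (A : 'I_m.+1 -> 'M[C]_n) z : z.2 = 0 ->
  mxcvg (fun k => asym A (approach z k)) (asym A z).
Proof.
move=> z0 i j; rewrite /asym !mxE; under eq_fun do rewrite !mxE.
apply: ccvgD; last exact: ccvg_cst.
apply: ccvgM; last exact: ccvg_cst.
split => /=; first exact: cvg_cst.
by apply: cvgN; have := @cvg_harmonic R; rewrite z0; exact.
Qed.

Lemma rescale_gt0 (z : freq) : 0 < z.2 -> z = z.2 *: (z.2^-1 *: z.1, 1).
Proof.
case: z => x g /= g0; congr pair; first by rewrite /= scalerA mulfV ?gt_eqF// scale1r.
by rewrite /= [RHS]mulr1.
Qed.

Lemma symbol0_rescale M N (s : freq -> 'M[C]_(M, N)) z : symbol0 s -> 0 < z.2 ->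
  s z = s (z.2^-1 *: z.1, 1).
Proof.
by move=> [_ hs] z0; rewrite {1}(rescale_gt0 z0) hs//; exact: Xi_gt0.
Qed.

(** [asym] has degree 1, so a factor [gamma > 0] survives; it does not affect the sign in
    [boundary_positive]. *)
Lemma asym_rescale (A : 'I_m.+1 -> 'M[C]_n) z : 0 < z.2 ->
  asym A z = (z.2)%:C%C *: asym A (z.2^-1 *: z.1, 1).
Proof.
case: z => x g /= g0; rewrite /asym scalerDr scalerA scaler_sumr; congr (_ *: _ + _).
  apply: complex_ext; rewrite ?cRe_realM ?cIm_realM /= ?mxE; last by rewrite mulrN1.
  by rewrite mulrA mulfV ?gt_eqF// mul1r.
apply: eq_bigr => j _; rewrite scalerA; congr (_ *: _).
by rewrite -rmorphM/= !mxE mulrA mulfV ?gt_eqF// mul1r.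
Qed.

Variables (A : 'I_m.+1 -> 'M[C]_n) (delta sigma : freq -> 'M[C]_n) (z : freq).
Hypotheses (sdelta : symbol0 delta) (ssigma : symbol0 sigma).
Hypotheses (Xz : Xi z) (z0 : z.2 = 0).

Let cS := mxcvg_symbol0 ssigma Xz z0.
Let cD := mxcvg_symbol0 sdelta Xz z0.
Let cA := mxcvg_asym A z0.

Lemma boundary_hermitian (u w : 'cV[C]_n) : sym_hermitian delta sigma ->
  hdot (sigma z *m u) w = hdot u (sigma z *m w).
Proof.
move=> sym.
have [r2 i2] := ccvg_hdot (mxcvg_cst u) (mxcvg_mul cS (mxcvg_cst w)).
have := ccvg_hdot (mxcvg_mul cS (mxcvg_cst u)) (mxcvg_cst w).
rewrite (_ : (fun=> _) = (fun k => hdot u (sigma (approach z k) *m w))) => [[r1 i1]|].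
  apply: complex_ext.
    exact: cvg_unique r1 r2.
  exact: cvg_unique i1 i2.
apply/funext => k; rewrite (symbol0_rescale ssigma (approach_gt0 z k)).
exact: symbol_hermitian sym.
Qed.

(** Rescaling [approach z k] to [gamma = 1] multiplies [z.1] by [k + 1], so the limit exists with a
    fixed [K] only because [symbol_bounded] is uniform in the frequency. *)
Lemma boundary_bounded : sym_bounded delta sigma ->
  exists2 K : R, 0 < K & forall (u w : 'cV[C]_n) (s : R), 0 < s ->
    complex.Re (hdot (sigma z *m u) w) <=
    K * (s * sqnorm (delta z *m u) + s^-1 * sqnorm (delta z *m w)).
Proof.
move=> /(symbol_bounded sdelta ssigma)[K K0 h]; exists K => // u w s s0.
have [r1 _] := ccvg_hdot (mxcvg_mul cS (mxcvg_cst u)) (mxcvg_cst w).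
have cDu := mxcvg_mul cD (mxcvg_cst u); have cDw := mxcvg_mul cD (mxcvg_cst w).
have [r2 _] := ccvg_hdot cDu cDu; have [r3 _] := ccvg_hdot cDw cDw.
have r4 : (fun k => K * (s * sqnorm (delta (approach z k) *m u) +
    s^-1 * sqnorm (delta (approach z k) *m w))) @ \oo -->
    K * (s * sqnorm (delta z *m u) + s^-1 * sqnorm (delta z *m w)).
  by apply: cvgMr; apply: cvgD; exact: cvgMr.
apply: (ler_cvg_to r1 r4); apply: nearW => k.
rewrite (symbol0_rescale ssigma (approach_gt0 z k)).
by rewrite (symbol0_rescale sdelta (approach_gt0 z k)); exact: h.
Qed.

Lemma boundary_positive (u : 'cV[C]_n) : sym_positive A delta sigma ->
  0 <= complex.Im (hdot (sigma z *m (asym A z *m u)) u).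
Proof.
move=> pos.
have [_ i1] := ccvg_hdot (mxcvg_mul cS (mxcvg_mul cA (mxcvg_cst u))) (mxcvg_cst u).
apply: (ler_cvg_to (cvg_cst _) i1); apply: nearW => k.
have g0 := approach_gt0 z k.
rewrite (symbol0_rescale ssigma g0) (asym_rescale A g0) -scalemxAl -scalemxAr hdotZl.
rewrite cIm_realM mulr_ge0//; first exact: ltW.
exact: symbol_positive pos.
Qed.

End BoundaryLimits.

(** * Linear algebra of the kernel of the symmetrizer *)

Section SymbolKernel.
Variables (R : realType) (n : nat).
Local Notation C := R[i].
Variables (S D T : 'M[C]_n).

Lemma le0_of_small_multiples (q Q : R) :
  (forall t, 0 < t -> q <= t * Q) -> q <= 0.
Proof.
move=> h; rewrite leNgt; apply/negP => q0.
(* Taking [t = q / (2 (|Q| + 1))] gives [t Q <= q / 2], which contradicts [q <= t Q] when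
   [q > 0]. *)
have P0 : 0 < 2 * (`|Q| + 1) by rewrite mulr_gt0// ltr_wpDl.
have := h _ (divr_gt0 q0 P0); rewrite mulrAC ler_pdivlMr// => h1.
have : q * Q <= q * `|Q| by rewrite ler_wpM2l ?(ltW q0)// ler_norm.
have : 0 <= q * `|Q| by rewrite mulr_ge0// ltW.
lra.
Qed.

Lemma kernel_of_bounded (u : 'cV[C]_n) (K : R) :
  (forall w s, 0 < s -> complex.Re (hdot (S *m u) w) <=
     K * (s * sqnorm (D *m u) + s^-1 * sqnorm (D *m w))) ->
  D *m u = 0 -> S *m u = 0.
Proof.
move=> h Du; apply: sqnorm_eq0.
apply: (@le0_of_small_multiples _ (K * sqnorm (D *m (S *m u)))) => t t0.
have := h (S *m u) t^-1; rewrite invr_gt0 => /(_ t0); rewrite invrK Du.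
by rewrite /sqnorm hdot0l /= mulr0 add0r mulrCA.
Qed.

(* Along [u + i t y], [y = S T u], the form [Im <S T ., .>] equals
   [- t |y|^2 + O(t^2)]. *)
Lemma kernel_invariant (u : 'cV[C]_n) :
  (forall v w, hdot (S *m v) w = hdot v (S *m w)) ->
  (forall v, 0 <= complex.Im (hdot (S *m (T *m v)) v)) ->
  S *m u = 0 -> S *m (T *m u) = 0.
Proof.
move=> herm pos Su; set y := S *m (T *m u); apply: sqnorm_eq0.
apply: (@le0_of_small_multiples _ (complex.Im (hdot (S *m (T *m y)) y))) => t t0.
(* The increment is imaginary because the cross term [<S T u, y> = |y|^2] is real: a real increment
   would leave no trace of it in the imaginary part. The pairings with [u] in the second slot vanish
   since [S] is Hermitian and [S u = 0]. *)
have := pos (u + (0 +i* t)%C *: y).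
rewrite !mulmxDr -!scalemxAr !hdotDl !hdotDr !hdotZl !hdotZr.
have -> : hdot (S *m (T *m u)) u = 0 by rewrite herm Su hdot0r.
have -> : hdot (S *m (T *m y)) u = 0 by rewrite herm Su hdot0r.
rewrite -/y hdot_sqnorm mulr0 !add0r; set c := hdot _ y.
rewrite !(cReM, cImM, cReD, cImD, cReJ, cImJ) /= => h.
rewrite -(ler_pM2l t0) -subr_ge0; move: h.
by congr (0 <= _); ring.
Qed.

End SymbolKernel.

Theorem proposition3p1 (R : realType) (m n p : nat)
    (A : 'I_m.+1 -> 'M[R[i]]_n) (b : freq R m -> 'M[R[i]]_(p, n))
    (delta sigma : freq R m -> 'M[R[i]]_n) (z : freq R m) :
  classWR A b ->
  lopatinskii_family A b delta ->
  WR_symmetrizer A b delta sigma ->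
  Gamma A b z ->
  forall v : 'cV[R[i]]_n, krylov (asym A z) (ell A b z) v ->
    hdot (sigma z *m v) v = 0.
Proof.
move=> [_ ell0 _ _ _] [sdelta _ ker] [ssigma [herm bnd pos _]] Gz v kv.
have [sz [e ee en0]] := Gz; have [Xz _] := sz.
(* Class WR makes [ell] trivial on the sphere where [gamma > 0], so a critical frequency lies on the
   boundary. *)
have z0 : z.2 = 0.
  apply/eqP; rewrite eq_le (proj2 Xz) andbT leNgt; apply/negP => zp.
  by move: ee; rewrite (ell0 z sz zp) => /eqP; rewrite (negbTE en0).
have [_ ellker] := ker z Gz.
have [K K0 hK] := boundary_bounded sdelta ssigma Xz z0 bnd.
(* Unlike the zero set of the quadratic form, the kernel of [sigma z] is a subspace, so it can be
   used as the set [W] in the definition of [krylov]. *)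
suff -> : sigma z *m v = 0 by rewrite hdot0l.
apply: (kv [set v | sigma z *m v = 0]).
- split=> [|c x y /= hx hy]; first by rewrite /= mulmx0.
  by rewrite mulmxDr -scalemxAr hx hy scaler0 addr0.
- move=> x /= hx; apply: kernel_invariant hx => [x1 x2|x1].
    exact: boundary_hermitian herm.
  exact: boundary_positive pos.
- move=> x ex /=; apply: kernel_of_bounded (ellker x ex) => w s s0; exact: hK.
Qed.
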